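(* Let $\pi$, $(d_n)$ and $M$ be as in the context. For any $\mu\in\mathcal I_\pi(M)$ and any integer $r\ge1$, $$\bar h(\mu,r)\le\Sigma_r(\mu)\qquad\text{and}\qquad\bar h(\mu)\le\Sigma(\mu).$$
   Context: **Random labeling and topology.** $M$ is a finite set. Let $\mathbb N=\{1,2,\dots\}$ and $\mathbb N^f=\bigcup_{k\ge0}\mathbb N^k$ with $\mathbb N^0=\{o\}$. A rooted $M$-colored graph $(G,f,v)$ is a connected graph $G$ with a map $f$ from its vertices to $M$ and a distinguished vertex $v$. If $G$ is locally finite, its randomly labeled version is the isomorphic random rooted colored graph on a subset of $\mathbb N^f$ given by the breadth-first search from the root with ties broken uniformly at random: the root gets label $o$, and the $j$-th offspring of the vertex labeled $(i_1,\dots,i_{k-1})$ gets label $(i_1,\dots,i_{k-1},j)$. $\mathcal G^\bullet_M$ is the set of rooted colored graphs arising as such labelings, with metric $\sum_{r\ge0}2^{-r}\mathbf 1_{g_r\ne g'_r}$, where $g_r$ is the restriction of $g$ to vertices at distance at most $r$ from the root. Fix a distance $\mathrm d$ on $\mathcal P(\mathcal G^\bullet_M)$ (probability measures) generating the weak topology (e.g. Lévy–Prohorov). For $\nu\in\mathcal P(\mathcal G^\bullet_M)$, $\nu_r$ is the law of the restriction to vertices at distance at most $r$ from the root. For a finite graph $G$ with vertex set $V$ and $f:V\to M$, $\mathrm{distr}_G(f)=\frac1{|V|}\sum_{v\in V}\mathrm{distr}_{G,v}(f)$, where $\mathrm{distr}_{G,v}(f)$ is the law of the randomly labeled version of the connected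 component of $v$ in $(G,f)$, rooted at $v$. **Trees and invariant processes.** $\pi$ is a probability measure on the non-negative integers with mean $d=\sum_k k\pi(k)\in(0,\infty)$, and $\hat\pi(k)=(k+1)\pi(k+1)/d$. $\mathrm{UGW}(\pi)$ is the law of the Galton–Watson tree $(T,o)$ (on a subset of $\mathbb N^f$) in which the root $o$ has a number of offspring of law $\pi$ and all other vertices have independent numbers of offspring of law $\hat\pi$. A random rooted colored graph $(G,f,o)$ is unimodular if $\mathbb E\sum_vF(G,f,o,v)=\mathbb E\sum_vF(G,f,v,o)$ for all non-negative isomorphism-invariant functions $F$ of colored graphs with two ordered distinguished vertices. $\mathcal I_\pi(M)$ is the set of laws of randomly labeled rooted colored trees $(T,X)$ with $T\sim\mathrm{UGW}(\pi)$, $X$ a random coloring of the vertices of $T$ by $M$, and $(T,X,o)$ unimodular. **Sofic entropies.** $n$ runs along an infinite subset of $\mathbb N$; $d_n=(d_n(1),\dots,d_n(n))$ are sequences of non-negative integers with even sum such that $\frac1n\sum_{v=1}^n\delta_{d_n(v)}$ converges weakly to $\pi$ and $\sup_n\max_vd_n(v)\le\Delta$ for some real $\Delta$. $\mathcal G_n(d_n)$ is the set of simple graphs on $\{1,\dots,n\}$ in which each $v$ has degree $d_n(v)$ (non-empty for $n$ large), and $G_n$ is uniform on it. For $\mu\in\mathcal I_\pi(M)$, $\epsilon>0$, $r\ge0$, set $\mathcal F_G(\mu,r,\epsilon)=\{f\in M^n:\mathrm d(\mathrm{distr}_G(f)_r,\mu_r)\le\epsilon\}$ and $H_G(\mu,r,\epsilon)=\frac1n\log|\mathcal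 F_G(\mu,r,\epsilon)|\in\{-\infty\}\cup[0,\infty)$. For $0<\alpha<1$, let $h_n(\mu,r,\epsilon,\alpha)=\sup\{h\in\{-\infty\}\cup[0,\infty):\mathbb P(H_{G_n}(\mu,r,\epsilon)\ge h)\ge\alpha\}$, $\bar h(\mu,r,\alpha)=\lim_{\epsilon\to0}\limsup_nh_n(\mu,r,\epsilon,\alpha)$, $\underline h(\mu,r,\alpha)=\lim_{\epsilon\to0}\liminf_nh_n(\mu,r,\epsilon,\alpha)$. These do not depend on $\alpha\in(0,1)$; the common values are $\bar h(\mu,r)$, $\underline h(\mu,r)$, and $\bar h(\mu)=\lim_{r\to\infty}\bar h(\mu,r)$, $\underline h(\mu)=\lim_{r\to\infty}\underline h(\mu,r)$. **Annealed entropy.** $B_r(S)$ is the set of vertices at distance at most $r$ from $S$ in the tree; $S_r=B_r(o)$ and, if $\deg(o)\ge1$, $E_r=B_{r-1}(\{o,1\})$ ($r\ge1$). For $(T,X)\sim\mu\in\mathcal I_\pi(M)$, let $\vec\mu(\cdot)=\frac1d\mathbb E[\deg(o)\mathbf 1((T,X,(o,1))\in\cdot)]$, a law on colored trees rooted at the directed edge $(o,1)$, and let $(\vec T,\vec X)$ have law $\vec\mu$. $X_{S_r}$ denotes the colored tree $(T,X)$ restricted to $S_r$, and $\vec X_{E_r}$ the colored tree $(\vec T,\vec X)$ restricted to $E_r$. $H$ is Shannon entropy (natural logarithm) of a discrete random variable or law. For $r\ge1$, $\Sigma_r(\mu)=H(X_{S_r})-\frac d2H(\vec X_{E_r})-H(\pi)$;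 this is non-increasing in $r$ and $\Sigma(\mu)=\lim_{r\to\infty}\Sigma_r(\mu)$. *)

(* Defs.v *)
From HB Require Import structures.
From mathcomp Require Import all_boot all_order all_algebra finmap.
From mathcomp Require Import all_classical all_reals all_analysis measurable_realfun.
Set Implicit Arguments.
Unset Strict Implicit.
Unset Printing Implicit Defensive.
Import Order.TTheory GRing.Theory Num.Theory.
Import numFieldNormedType.Exports numFieldTopology.Exports.
Local Open Scope classical_set_scope.
Local Open Scope ring_scope.

(** * Colored graphs on labels *)

(* [::] is the label o of the root; the entries of the other labels are
   positive, the j-th offspring of x being [rcons x j] with j >= 1. *)
Definition label := seq nat.

(* [color x] is [None] exactly when x is not a vertex. *)
Record cgraph (M : Type) := CGraph {
  color : label -> option M;
  adj : rel label }.

HB.instance Definition _ M := gen_eqMixin (cgraph M).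
HB.instance Definition _ M := gen_choiceMixin (cgraph M).

Definition vert M (g : cgraph M) : set label := [set x | color g x].

(* B_r(S): the vertices joined to a vertex of S by a walk of length <= r. *)
Definition nball M (g : cgraph M) (S : set label) (r : nat) : set label :=
  [set x | exists y s, [/\ S y, vert g y, path (adj g) y s,
                           (size s <= r)%N & last y s = x]].

Definition induced_graph M (g : cgraph M) (S : set label) : cgraph M :=
  CGraph (fun x => if `[< S x >] then color g x else None)
         (fun x y => [&& `[< S x >], `[< S y >] & adj g x y]).

Definition deg M (g : cgraph M) (x : label) : nat :=
  #|` fset_set [set y | adj g x y]|.

(* The order in which a breadth-first search explores the labels: by length,
   then lexicographically. *)
Definition explore_le (x y : label) : bool :=
  (size x < size y)%N ||
  (size x == size y) && Order.le (x : seqlexi nat) (y : seqlexi nat).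

(* The locally finite colored graphs that arise as breadth-first labelings:
   the vertex of label [rcons x j] was discovered while x was explored, hence
   x is the first of its neighbours in the exploration order, and the
   offspring of x are numbered 1, 2, ... without gap. Connectedness follows
   from [bfs_parent]. *)
Record bfs_labeled M (g : cgraph M) : Prop := BfsLabeled {
  bfs_root : vert g [::];
  bfs_vert : forall x y, adj g x y -> vert g x;
  bfs_sym : symmetric (adj g);
  bfs_irr : irreflexive (adj g);
  bfs_fin : forall x, finite_set [set y | adj g x y];
  bfs_parent : forall x j, vert g (rcons x j) ->
    (0 < j)%N /\ adj g x (rcons x j);
  bfs_sibling : forall x j, vert g (rcons x j.+2) -> vert g (rcons x j.+1);
  bfs_first : forall x j y, adj g (rcons x j) y -> explore_le x y }.

Record lgraph M := LGraph {
  lgraph_val :> cgraph M;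
  lgraphP : bfs_labeled lgraph_val }.

HB.instance Definition _ M := gen_eqMixin (lgraph M).
HB.instance Definition _ M := gen_choiceMixin (lgraph M).

Lemma lgraph_inj M : injective (@lgraph_val M).
Proof.
move=> [g gP] [h hP] /= gh; rewrite gh in gP *.
by congr LGraph; exact: Prop_irrelevance.
Qed.

Lemma explore_le_size x y : explore_le x y -> (size x <= size y)%N.
Proof. by case/orP => [/ltnW//|/andP[/eqP->]]. Qed.

Section restriction.
Variable M : Type.
Implicit Type g : lgraph M.

Lemma adj_size g x y : adj g x y -> (size y <= (size x).+1)%N.
Proof.
move=> gxy; case/lastP: y gxy => [//|y j] gxy; rewrite size_rcons ltnS.
by apply/explore_le_size/(bfs_first (lgraphP g)); rewrite (bfs_sym (lgraphP g)); exact: gxy.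
Qed.

(* In a breadth-first labeling the distance to the root is the length of the
   label. *)
Lemma nball_root g r :
  nball g [set [::]] r = [set x | vert g x /\ (size x <= r)%N].
Proof.
apply/seteqP; split => [x [_ [s [-> _ gs sr <-]]]|x [gx xr]].
  have H : forall (z : label) t, vert g z -> path (adj g) z t ->
      vert g (last z t) /\ (size (last z t) <= size z + size t)%N.
    move=> z t; elim: t z => [|y t IH] z gz /=; first by rewrite addn0.
    move=> /andP[zy yt].
    have gy : vert g y.
      by apply: (bfs_vert (lgraphP g)); rewrite (bfs_sym (lgraphP g)); exact: zy.
    have [? le] := IH _ gy yt; split => //; apply: leq_trans le _.
    by rewrite addnS -addSn leq_add2r; exact: adj_size zy.
  have [? le] := H _ _ (bfs_root (lgraphP g)) gs; split => //.
  exact: leq_trans le sr.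
exists [::]; suff [s [ps ss ls]] : exists s, [/\ path (adj g) [::] s,
    (size s <= size x)%N & last [::] s = x].
  exists s; split => //; first exact: (bfs_root (lgraphP g)).
  exact: leq_trans ss xr.
move: gx {xr}; elim/last_ind: x => [|x j IH] gx; first by exists [::].
have [_ xj] := bfs_parent (lgraphP g) gx.
have [s [ps ss ls]] := IH (bfs_vert (lgraphP g) xj).
exists (rcons s (rcons x j)); split; last by rewrite last_rcons.
  by rewrite rcons_path ps ls.
by rewrite !size_rcons.
Qed.

Lemma restr_labeled g r : bfs_labeled (induced_graph g (nball g [set [::]] r)).
Proof.
have vE x : vert (induced_graph g (nball g [set [::]] r)) x <->
    vert g x /\ (size x <= r)%N.
  rewrite nball_root /vert /induced_graph /mkset /=.
  by case: asboolP => h; split => //; case: h.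
have aE x y : adj (induced_graph g (nball g [set [::]] r)) x y <->
    [/\ adj g x y, (size x <= r)%N & (size y <= r)%N].
  rewrite nball_root /induced_graph /=; split.
    by move=> /and3P[/asboolP[_ ?] /asboolP[_ ?] ?].
  move=> [xy xr yr]; apply/and3P; split => //; apply/asboolP; split => //.
    exact: (bfs_vert (lgraphP g) xy).
  by apply: (bfs_vert (lgraphP g)); rewrite (bfs_sym (lgraphP g)); exact: xy.
split.
- by apply/vE; split => //; exact: (bfs_root (lgraphP g)).
- by move=> x y /aE[xy xr _]; apply/vE; split => //; exact: bfs_vert (lgraphP g) _ _ xy.
- move=> x y; rewrite /= (bfs_sym (lgraphP g)).
  by rewrite andbA [X in X && _]andbC -andbA.
- by move=> x /=; rewrite (bfs_irr (lgraphP g)) !andbF.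
- move=> x; apply: sub_finite_set (bfs_fin (lgraphP g) x) => y /=.
  by move=> /and3P[].
- move=> x j /vE[gx]; rewrite size_rcons => xr.
  have [j0 xj] := bfs_parent (lgraphP g) gx; split => //.
  by apply/aE; rewrite size_rcons; split => //; exact: ltnW.
- move=> x j /vE[gx]; rewrite size_rcons => xr; apply/vE; rewrite size_rcons.
  by split => //; exact: (bfs_sibling (lgraphP g)).
- by move=> x j y /aE[xy _ _]; exact: bfs_first (lgraphP g) _ _ _ xy.
Qed.

Definition restr (r : nat) g : lgraph M := LGraph (restr_labeled g r).

Lemma restr_min r s g : restr s (restr r g) = restr (minn r s) g.
Proof.
apply: lgraph_inj; rewrite /= !nball_root.
have -> : nball (induced_graph g [set x | vert g x /\ (size x <= r)%N]) [set [::]] s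
    = [set x | vert g x /\ (size x <= minn r s)%N].
  transitivity (nball (restr r g) [set [::]] s).
    by rewrite /= nball_root.
  rewrite nball_root /= nball_root; apply/seteqP; split => x /=.
    by rewrite /vert /= /mkset leq_min; case: asboolP => [[gx xr]|_] [] // _ ->;
       rewrite xr.
  rewrite /vert /mkset /= leq_min => -[gx /andP[xr xs]].
  by case: asboolP => // h; exfalso; apply: h.
rewrite /induced_graph /=; congr CGraph.
  apply/funext => x; case: asboolP => //= -[gx]; rewrite leq_min => /andP[xr xs].
  by case: asboolP => // h; exfalso; apply: h.
apply/funext => x; apply/funext => y.
apply/idP/idP => [/and5P[-> -> _ _ ->] //|/and3P[]].
move=> /asboolP[gx lx] /asboolP[gy ly] xy.
apply/and5P; split => //; apply/asboolP; split => //.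
- by move: lx; rewrite leq_min => /andP[].
- by move: ly; rewrite leq_min => /andP[].
Qed.

Lemma restr_separates (g h : lgraph M) :
  (forall r, restr r g = restr r h) -> g = h.
Proof.
move=> gh; apply: lgraph_inj.
have cE (x : label) : color g x = color h x.
  have /(congr1 (fun k : lgraph M => color k x)) := gh (size x).
  rewrite /= !nball_root /vert /mkset.
  case: asboolP => [[_ _]|ng]; case: asboolP => [[_ _]|nh] //.
  - by move=> gx; rewrite gx; case: (color h x) nh => // a [].
  - by move=> hx; rewrite -hx; case: (color g x) ng => // a [].
  case: (color g x) ng => [a []//|_].
  by case: (color h x) nh => [a []//|].
have adjR (k : lgraph M) x y : adj k x y ->
    adj (restr (maxn (size x) (size y)) k) x y.
  move=> xy; rewrite /= !nball_root; apply/and3P; split => //; apply/asboolP.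
    by split; [exact: bfs_vert (lgraphP k) _ _ xy | exact: leq_maxl].
  split; last exact: leq_maxr.
  by apply: (bfs_vert (lgraphP k)); rewrite (bfs_sym (lgraphP k)); exact: xy.
have aE x y : adj g x y = adj h x y.
  apply/idP/idP => /adjR; first by rewrite gh => /and3P[].
  by rewrite -gh => /and3P[].
case: g h {gh adjR} cE aE => [[cg ag] gP] [[ch ah] hP] /= cE aE.
congr CGraph; first by apply/funext => x; exact: cE.
by apply/funext => x; apply/funext => y; exact: aE.
Qed.

End restriction.

(** * Breadth-first search and random labeling *)

Lemma explore_le_trans : transitive explore_le.
Proof.
move=> y x z /orP[xy|/andP[/eqP xy lxy]] /orP[yz|/andP[/eqP yz lyz]]; apply/orP.
- by left; exact: ltn_trans xy yz.
- by left; rewrite -yz.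
- by left; rewrite xy.
- by right; rewrite xy yz eqxx /=; exact: le_trans lxy lyz.
Qed.

Lemma explore_le_refl : reflexive explore_le.
Proof. by move=> x; rewrite /explore_le eqxx lexx orbT. Qed.

Definition explore_lt x y := (x != y) && explore_le x y.

Lemma explore_le_anti : antisymmetric explore_le.
Proof.
move=> x y /andP[/orP[xy|/andP[/eqP xy lxy]] /orP[yx|/andP[/eqP yx lyx]]].
- by have := ltn_trans xy yx; rewrite ltnn.
- by move: xy; rewrite yx ltnn.
- by move: yx; rewrite xy ltnn.
- by apply: (@le_anti _ (seqlexi nat)); rewrite lxy lyx.
Qed.

Lemma explore_lt_trans : transitive explore_lt.
Proof.
move=> y x z /andP[xy lxy] /andP[yz lyz]; apply/andP; split; last first.
  exact: explore_le_trans lxy lyz.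
apply: contra xy => /eqP xz; rewrite -xz in lyz.
by apply/eqP/explore_le_anti; rewrite lxy lyz.
Qed.

Lemma lexi_rcons (x y : label) i j : size x = size y ->
  ((rcons x i : seqlexi nat) <= (rcons y j : seqlexi nat))%O =
  ((x : seqlexi nat) < (y : seqlexi nat))%O || (x == y) && (i <= j)%N.
Proof.
elim: x y => [|a x IH] [|b y] //= => [_|[xy]].
  by rewrite lexi_cons lexi0s implybT !leEnat andbT.
rewrite lexi_cons ltxi_cons IH // eqseq_cons !leEnat.
by case: (ltngtP a b).
Qed.


Lemma explore_lt_rcons x i j : (i < j)%N -> explore_lt (rcons x i) (rcons x j).
Proof.
move=> ij; apply/andP; split.
  by rewrite eqseq_rcons eqxx /= neq_ltn ij.
by rewrite /explore_le !size_rcons eqxx lexi_rcons // eqxx (ltnW ij) !orbT.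
Qed.

Lemma explore_lt_rcons2 x y i j :
  explore_lt x y -> explore_lt (rcons x i) (rcons y j).
Proof.
move=> /andP[nxy xy]; apply/andP; split.
  by rewrite eqseq_rcons negb_and nxy.
move: xy; rewrite /explore_le !size_rcons !ltnS eqSS.
case/orP => [->//|/andP[/eqP sxy lxy]]; apply/orP; right.
by rewrite sxy eqxx /= lexi_rcons // lt_neqAle nxy lxy.
Qed.

Lemma explore_lt_root x i : explore_lt [::] (rcons x i).
Proof. by rewrite /explore_lt /explore_le size_rcons /= andbT; case: x. Qed.

Section bfs.
Variables (T : eqType) (e : rel T) (ord : seq T) (v : T).

(* Breadth-first search from v in the finite graph with vertices [ord] and
   edge relation e; [ord] is also the order that breaks the ties. The result
   lists the discovered vertices with their labels, in order of discovery, and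
   step k explores the k-th vertex of that list. *)
Fixpoint bfs (k : nat) : seq (T * label) :=
  if k is k'.+1 then
    let s := bfs k' in
    if onth s k' is Some (x, w) then
      let ys := [seq y <- ord | e x y & y \notin unzip1 s] in
      s ++ zip ys [seq rcons w j | j <- iota 1 (size ys)]
    else s
  else [:: (v, [::])].

Definition explored := bfs (size ord).

Let x0 := (v, [::] : label).

Record bfs_inv k (s : seq (T * label)) : Prop := {
  inv_sorted : sorted explore_lt (unzip2 s);
  inv_head : exists s', s = x0 :: s';
  inv_done : forall m y, (m < k)%N -> (m < size s)%N -> y \in ord ->
    e (nth x0 s m).1 y -> y \in unzip1 s;
  inv_parent : forall i, (i < size s)%N -> (0 < i)%N -> exists m j,
    [/\ (m < i)%N && (m < k)%N, (nth x0 s i).2 = rcons (nth x0 s m).2 j.+1,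
        e (nth x0 s m).1 (nth x0 s i).1,
        forall m', (m' < m)%N -> ~~ e (nth x0 s m').1 (nth x0 s i).1 &
        (0 < j)%N -> rcons (nth x0 s m).2 j \in unzip2 s] }.

Lemma bfsP k : bfs_inv k (bfs k).
Proof.
elim: k => [|k IH] /=.
  by split => //= [|i]; [exists [::]|rewrite ltnS leqn0 => /eqP->].
case E : (onth (bfs k) k) => [[x w]|]; last first.
  have ks : (size (bfs k) <= k)%N by rewrite leqNgt -onthTE E.
  case: IH => A B C D; split => //.
    by move=> m y _ ms; apply: C => //; exact: leq_trans ms ks.
  move=> i is0 i0; have [m [j [/andP[mi mk] H1 H2 H3 H4]]] := D i is0 i0.
  by exists m, j; split => //; rewrite mi ltnS ltnW.
set s := bfs k in IH E *; set ys := [seq y <- _ | _].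
set new := zip _ _.
have ks : (k < size s)%N by rewrite -onthTE E.
have xwE : nth x0 s k = (x, w) by apply: onth_nth; exact: E.
case: IH => A [s' s's] C D.
have sz : size [seq rcons w j | j <- iota 1 (size ys)] = size ys.
  by rewrite size_map size_iota.
have un1 : unzip1 new = ys by rewrite unzip1_zip // sz.
have un2 : unzip2 new = [seq rcons w j | j <- iota 1 (size ys)].
  by rewrite unzip2_zip // sz.
have sn : size new = size ys by rewrite size_zip sz minnn.
have nw i : (i < size new)%N ->
    nth x0 new i = (nth v ys i, rcons w i.+1).
  move=> ni; rewrite /new /x0 nth_zip ?sz //; congr pair.
  by rewrite (nth_map 0) ?size_iota ?nth_iota -?sn.
have inS i : (i < size s)%N -> nth x0 (s ++ new) i = nth x0 s i.
  by move=> si; rewrite nth_cat si.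
have ysP i : (i < size ys)%N ->
    [/\ nth v ys i \in ord, e x (nth v ys i) & nth v ys i \notin unzip1 s].
  by move=> iy; have := mem_nth v iy; rewrite mem_filter => /andP[/andP[-> ->] ->].
split.
- rewrite /unzip2 map_cat -/(unzip2 s) -/(unzip2 new) un2.
  have : sorted explore_lt [seq rcons w j | j <- iota 1 (size ys)].
    apply: (homo_sorted (e := ltn)); last exact: iota_ltn_sorted.
    by move=> i j; exact: explore_lt_rcons.
  have : explore_lt (last [::] (unzip2 s)) (rcons w 1).
    have -> : last [::] (unzip2 s) = (nth x0 s (size s')).2.
      by rewrite -nth_last size_map s's -[in RHS](nth_map x0 [::] snd).
    have [e0|s'0] := posnP (size s').
      by rewrite e0 s's; exact: explore_lt_root.
    have ss' : (size s' < size s)%N by rewrite s's.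
    have [m [j [/andP[mi mk] -> _ _ _]]] := D _ ss' s'0.
    apply: explore_lt_rcons2.
    have -> : w = (nth x0 s k).2 by rewrite xwE.
    have ms := ltn_trans mk ks.
    rewrite -!(nth_map x0 [::] snd) //.
    by apply: (sorted_ltn_nth explore_lt_trans) => //; rewrite inE size_map //.
  move: A; rewrite s's /= cat_path => -> /=.
  by case: (size ys) => [//|n] /= -> ->.
- by rewrite s's; exists (s' ++ new).
- move=> m y mk _ yo; rewrite inS; last exact: leq_trans mk ks.
  rewrite /unzip1 map_cat -/(unzip1 s) -/(unzip1 new) un1 mem_cat => exy.
  move: mk exy; rewrite ltnS leq_eqVlt => /orP[/eqP->|mk] exy; last first.
    by rewrite (C m y mk _ yo exy) //; exact: ltn_trans mk ks.
  rewrite xwE /= in exy.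
  by rewrite mem_filter exy yo andbT /=; case: (_ \in unzip1 s).
- move=> i; rewrite size_cat => iu i0.
  have [si|si] := ltnP i (size s).
    have [m [j [/andP[mi mk] H1 H2 H3 H4]]] := D i si i0.
    have ms := ltn_trans mi si.
    exists m, j; rewrite !inS //; split => //.
    + by rewrite mi ltnS ltnW.
    + by move=> m' mm'; rewrite inS ?H3 //; exact: ltn_trans mm' ms.
    + by move=> j0; rewrite /unzip2 map_cat mem_cat H4.
  pose t := (i - size s)%N.
  have tn : (t < size new)%N by rewrite /t ltn_subLR.
  have -> : nth x0 (s ++ new) i = (nth v ys t, rcons w t.+1).
    by rewrite nth_cat ltnNge si /= nw.
  have [yo ey ny] := ysP t (eq_ind _ (fun n => (t < n)%N) tn _ sn).
  exists k, t; rewrite inS // xwE /=; split => //.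
  + by rewrite (leq_trans ks si) ltnSn.
  + move=> m' mk; rewrite inS; last exact: ltn_trans mk ks.
    by apply: contra ny => /(C m' _ mk) ->//; exact: ltn_trans mk ks.
  + move=> t0; rewrite /unzip2 map_cat mem_cat -/(unzip2 new) un2; apply/orP; right.
    by apply: map_f; rewrite mem_iota t0 add1n ltnS -sn ltnW.
Qed.

End bfs.

Section labeled.
Variables (T : eqType) (M : Type) (e : rel T) (e_sym : symmetric e)
  (e_irr : irreflexive e) (ord : seq T) (f : T -> M) (v : T).

Let s := explored e ord v.

Definition bfs_cgraph : cgraph M := CGraph
  (fun w => ohead [seq f p.1 | p <- s & p.2 == w])
  (fun w w' => has (fun p => has (fun q =>
     [&& p.2 == w, q.2 == w' & e p.1 q.1]) s) s).

Lemma bfs_cgraph_labeled : bfs_labeled bfs_cgraph.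
Proof.
have [A [s' s's] _ D] := bfsP e ord v (size ord).
rewrite -/(explored e ord v) -/s in A s's D.
have vE w : vert bfs_cgraph w <-> w \in unzip2 s.
  rewrite /vert /mkset /=; split.
    case E : [seq p <- s | p.2 == w] => [//|p l] _.
    have : p \in [seq p <- s | p.2 == w] by rewrite E mem_head.
    by rewrite mem_filter => /andP[/eqP <- ps]; exact: map_f.
  move=> /mapP[p ps ->]; case E : [seq q <- s | q.2 == p.2] => [|//].
  have : p \in [seq q <- s | q.2 == p.2] by rewrite mem_filter eqxx.
  by rewrite E.
have aE w w' : adj bfs_cgraph w w' <-> exists p q,
    [/\ p \in s, q \in s, p.2 = w, q.2 = w' & e p.1 q.1].
  split => [/hasP[p ps /hasP[q qs /and3P[/eqP ? /eqP ? ?]]]|].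
    by exists p, q.
  move=> [p [q [ps qs <- <- epq]]]; apply/hasP; exists p => //.
  by apply/hasP; exists q => //; rewrite !eqxx.
have u2 : uniq (unzip2 s).
  apply: sorted_uniq A; first exact: explore_lt_trans.
  by move=> x; rewrite /explore_lt eqxx.
have inj p q : p \in s -> q \in s -> p.2 = q.2 -> p = q.
  move=> ps qs pq; rewrite -(nth_index (v, [::]) ps) -(nth_index (v, [::]) qs).
  congr nth; apply/eqP.
  rewrite -(nth_uniq [::] _ _ u2) ?size_map ?index_mem //.
  by rewrite !(nth_map (v, [::])) ?index_mem // !nth_index // pq.
have par x j : rcons x j \in unzip2 s -> exists m i,
  [/\ (m < i < size s)%N, (nth (v, [::]) s i).2 = rcons x j,
    x = (nth (v, [::]) s m).2, (0 < j)%N &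
    [/\ e (nth (v, [::]) s m).1 (nth (v, [::]) s i).1,
    forall m', (m' < m)%N -> ~~ e (nth (v, [::]) s m').1 (nth (v, [::]) s i).1 &
        (1 < j)%N -> rcons x j.-1 \in unzip2 s]].
  move=> /mapP[p ps pE]; pose i := index p s.
  have si : (i < size s)%N by rewrite index_mem.
  have sp : nth (v, [::]) s i = p by rewrite nth_index.
  have i0 : (0 < i)%N.
    rewrite lt0n; apply/eqP => i0; move: sp; rewrite i0 s's /= => vp.
    by move: pE; rewrite -vp /=; case: (x).
  have [m [j' [/andP[mi _] H1 H2 H3 H4]]] := D i si i0.
  move: (H1); rewrite sp -pE => /rcons_inj[xE jE]; subst j.
  exists m, i; rewrite mi si; split => //; first by rewrite sp.
  by split => // j0; rewrite xE; exact: H4.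
split.
- by apply/vE; rewrite s's mem_head.
- by move=> x y /aE[p [q [ps qs <- _ _]]]; apply/vE; exact: map_f.
- move=> x y; apply/idP/idP => /aE[p [q [ps qs px qy epq]]]; apply/aE;
    by exists q, p; split => //; rewrite e_sym.
- move=> x; apply/negP => /aE[p [q [ps qs px qy]]].
  by rewrite (inj p q) ?e_irr // px qy.
- move=> x; apply: (@sub_finite_set _ _ [set` unzip2 s]); last exact: finite_seq.
  by move=> y /aE[p [q [ps qs _ <- _]]]; exact: map_f.
- move=> x j /vE/par[m [i [/andP[mi si] pi xE j0 [H1 H2 H3]]]]; split => //.
  apply/aE; exists (nth (v, [::]) s m), (nth (v, [::]) s i); split => //.
    by apply: mem_nth; exact: ltn_trans mi si.
  exact: mem_nth.
- by move=> x j /vE/par[m [i [_ _ _ _ [_ _ H3]]]]; apply/vE; exact: H3.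
- move=> x j y /aE[p [q [ps qs px qy epq]]].
  have xs : rcons x j \in unzip2 s by rewrite -px map_f.
  have [m [i [/andP[mi si] pi xE _ [_ H2 _]]]] := par _ _ xs.
  have pE : nth (v, [::]) s i = p by apply: inj; rewrite ?mem_nth // pi px.
  have [qm|mq] := ltnP (index q s) m.
    by have := H2 _ qm; rewrite nth_index // pE e_sym epq.
  move: mq; rewrite leq_eqVlt xE -qy => /orP[/eqP->|mq].
    by rewrite nth_index //; exact: explore_le_refl.
  have qi : (index q s < size s)%N by rewrite index_mem.
  have -> : q.2 = nth [::] (unzip2 s) (index q s).
    by rewrite (nth_map (v, [::])) // nth_index.
  have ms := ltn_trans mi si.
  rewrite -(nth_map (v, [::]) [::] snd) //.
  have /andP[] // : explore_lt (nth [::] (unzip2 s) m) (nth [::] (unzip2 s) (index q s)).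
  apply: (sorted_ltn_nth explore_lt_trans) => //; rewrite inE size_map //.
Qed.

Definition bfs_graph : lgraph M := LGraph bfs_cgraph_labeled.

End labeled.

(** * The space of labeled graphs *)

(* Measurable types are pointed in the library; for an empty set of colors
   there is no colored graph with a root. *)
#[short(type="pfinType")]
HB.structure Definition PointedFinite := {T of Finite T & isPointed T}.

Section point.
Variable M : pfinType.

Lemma point_labeled :
  bfs_labeled (CGraph (fun x => if x == [::] then Some (point : M) else None)
                      (fun _ _ => false)).
Proof.
split => //.
- by move=> x; apply: (@sub_finite_set _ _ set0) => //; move=> y.
- by move=> x j; rewrite /vert /mkset /=; case: x.
- by move=> x j; rewrite /vert /mkset /=; case: x.
Qed.

HB.instance Definition _ := isPointed.Build (lgraph M) (LGraph point_labeled).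

End point.

(* The set of labeled graphs with the distance [gdist] below and its Borel
   sets; the parameter R is the type of the values of the distance. *)
Definition gspace (R : realType) (M : pfinType) : Type := lgraph M.

HB.instance Definition _ R M := Pointed.on (gspace R M).

Section gdist.
Variables (R : realType) (M : pfinType).
Implicit Types g h : gspace R M.

Definition gdist_term g h : nat -> R :=
  fun r => 2^-1 ^+ r * (restr r g != restr r h :> lgraph M)%:R.

Definition gdist g h : R := limn (series (gdist_term g h)).

Local Notation u := gdist_term.

Lemma gdist_le1 g h r : 0 <= u g h r <= 2^-1 ^+ r.
Proof.
rewrite /gdist_term; case: (_ != _); rewrite ?mulr1 ?mulr0 ?lexx ?andbT exprn_ge0 ?invr_ge0 //.
Qed.

Lemma is_cvg_gdist g h : cvgn (series (u g h)).
Proof.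
apply: (@series_le_cvg _ _ (fun r => 2^-1 ^+ r)).
- by move=> r; have /andP[] := gdist_le1 g h r.
- by move=> r; rewrite exprn_ge0 // invr_ge0.
- by move=> r; have /andP[] := gdist_le1 g h r.
have := @is_cvg_geometric_series R 1 2^-1.
rewrite /geometric /=; under eq_fun do rewrite mul1r; apply.
by rewrite gtr0_norm ?invr_gt0 // invf_lt1 // ltr1n.
Qed.

Lemma gdistxx g : gdist g g = 0.
Proof.
rewrite /gdist (_ : series _ = cst 0) ?lim_cst //.
by apply/funext => n; rewrite /series /= big1 // => i _; rewrite /gdist_term eqxx mulr0.
Qed.

Lemma gdist_sym g h : gdist g h = gdist h g.
Proof.
by rewrite /gdist; congr (limn (series _)); apply/funext => r; rewrite /gdist_term eq_sym.
Qed.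

Lemma gdist_le g h g' h' : (forall r, restr r g = restr r h ->
    restr r g' = restr r h') -> gdist g' h' <= gdist g h.
Proof.
move=> H; apply: ler_lim; [exact: is_cvg_gdist|exact: is_cvg_gdist|].
apply: nearW => n; apply: ler_sum => r _; apply: ler_wpM2l.
  by rewrite exprn_ge0 // invr_ge0.
case: (eqVneq (restr r g) (restr r h)) => [/H ->|_]; first by rewrite eqxx.
by rewrite ler_nat; case: (_ != _).
Qed.

Lemma gdist_triangle h g k : gdist g k <= gdist g h + gdist h k.
Proof.
rewrite -limD; [|exact: is_cvg_gdist|exact: is_cvg_gdist].
apply: ler_lim; [exact: is_cvg_gdist| |].
  by apply: is_cvgD; exact: is_cvg_gdist.
apply: nearW => n.
apply: (@le_trans _ _ (\sum_(0 <= i < n) (u g h i + u h k i))); last first.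
  by rewrite big_split.
apply: ler_sum => r _; rewrite /gdist_term -mulrDr; apply: ler_wpM2l.
  by rewrite exprn_ge0 // invr_ge0.
rewrite -natrD ler_nat.
by case: (eqVneq (restr r g) (restr r h)) => [->|_]; case: (_ != _).
Qed.

Lemma gdist_ge g h r : restr r g <> restr r h -> 2^-1 ^+ r <= gdist g h.
Proof.
move=> /eqP rgh; apply: (@le_trans _ _ (series (u g h) r.+1)).
  rewrite /series /= big_nat_recr //= /gdist_term rgh mulr1 lerDr.
  by apply: sumr_ge0 => i _; have /andP[] := gdist_le1 g h i.
apply: nondecreasing_cvgn_le; last exact: is_cvg_gdist.
by apply: nondecreasing_series => i _ _; have /andP[] := gdist_le1 g h i.
Qed.

Lemma gdist_eq0 g h : gdist g h = 0 -> g = h.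
Proof.
move=> gh0; apply: restr_separates => r; apply: contrapT => /gdist_ge.
by rewrite gh0 leNgt exprn_gt0 // invr_gt0.
Qed.

HB.instance Definition _ := isMetric.Build R (gspace R M)
  gdistxx gdist_eq0 gdist_sym gdist_triangle.

HB.instance Definition _ := Measurable.copy (gspace R M)
  (g_sigma_algebraType (@open (gspace R M))).

Definition grestr (r : nat) (g : gspace R M) : gspace R M := restr r g.

Lemma grestr_continuous r : continuous (grestr r).
Proof.
move=> g A /nbhs_ballP[e e0 eA]; apply/nbhs_ballP; exists e => // h gh.
apply: eA; apply: le_lt_trans gh; apply: gdist_le => s gh.
by rewrite /grestr !restr_min minnC -!restr_min gh.
Qed.

Lemma measurable_grestr r : measurable_fun setT (grestr r).
Proof.
apply: (@measurability _ _ (gspace R M) (gspace R M) setT (grestr r) (@open (gspace R M))) => //.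
move=> _ [A oA <-]; rewrite setTI; apply: sub_sigma_algebra.
by apply: open_comp => // g _; exact: grestr_continuous.
Qed.

HB.instance Definition _ r :=
  isMeasurableFun.Build _ _ _ _ (grestr r) (measurable_grestr r).

End gdist.

(* The law of the restriction to the ball of radius r around the root. *)
Definition restr_law (R : realType) (M : pfinType)
    (nu : probability (gspace R M) R) (r : nat) : probability (gspace R M) R :=
  distribution nu (@grestr R M r).

(** * Uniform laws on lists and random labelings *)

(* Repetitions in the list count with multiplicity. *)
Section unif_law.
Local Open Scope ereal_scope.
Context d (T : measurableType d) (R : realType) (l : seq T).

Definition unif_law (l0 : l != [::]) (A : set T) : \bar R :=
  ((size l)%:R^-1)%:E * \sum_(x <- l) \d_x A.

Variable l0 : l != [::].

Let unif_law0 : unif_law l0 set0 = 0.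
Proof. by rewrite /unif_law big1 ?mule0 // => x _; rewrite measure0. Qed.

Let unif_law_ge0 A : 0 <= unif_law l0 A.
Proof. by rewrite mule_ge0 ?lee_fin ?invr_ge0 // sume_ge0. Qed.

Let unif_law_sigma_additive : semi_sigma_additive (unif_law l0).
Proof.
have s0 : (0 <= (size l)%:R^-1 :> R)%R by rewrite invr_ge0.
pose m := mscale (NngNum s0)
  (msum (fun i => dirac (nth point l i) : {measure set T -> \bar R}) (size l)).
rewrite (_ : unif_law l0 = m); first exact: measure_semi_sigma_additive.
apply/funext => A; rewrite /unif_law /m /mscale /msum /=; congr (_ * _).
by rewrite (big_nth point) big_mkord.
Qed.

HB.instance Definition _ := isMeasure.Build _ _ _ (unif_law l0)
  unif_law0 unif_law_ge0 unif_law_sigma_additive.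

Let unif_law_setT : unif_law l0 setT = 1.
Proof.
rewrite /unif_law; under eq_bigr do rewrite diracT.
rewrite sumEFin -(natr_sum R _ _ (fun=> 1%N)) sum1_size -EFinM mulVf //.
by rewrite pnatr_eq0 size_eq0.
Qed.

HB.instance Definition _ := Measure_isProbability.Build _ _ _
  (unif_law l0) unif_law_setT.

End unif_law.

Section labelings.
Variables (T : eqType) (M : Type) (e : rel T) (e_sym : symmetric e)
  (e_irr : irreflexive e) (V : seq T) (f : T -> M) (v : T).

(* One labeling per order of the vertices. Offspring sets of distinct vertices
   are disjoint, so that ordering them all according to one uniform order of V
   breaks the ties uniformly and independently. *)
Definition labelings : seq (lgraph M) :=
  [seq bfs_graph e_sym e_irr s f v | s <- permutations V].

Lemma labelings_neq0 : labelings != [::].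
Proof.
rewrite -size_eq0 size_map -lt0n -has_predT; apply/hasP; exists V => //.
by rewrite mem_permutations.
Qed.

End labelings.

(* distr_G(f) for the graph on {1, ..., n.+1} with edge set E *)
Section distr.
Variables (R : realType) (M : pfinType) (n : nat).
Implicit Types (E : {set {set 'I_n.+1}}) (f : {ffun 'I_n.+1 -> M}).

Definition edge E : rel 'I_n.+1 := fun x y => (x != y) && ([set x; y]%SET \in E).

Lemma edge_sym E : symmetric (edge E).
Proof. by move=> x y; rewrite /edge eq_sym finset.setUC. Qed.

Lemma edge_irr E : irreflexive (edge E).
Proof. by move=> x; rewrite /edge eqxx. Qed.

Definition rooted_labelings E f : seq (lgraph M) :=
  flatten [seq labelings (edge_sym E) (edge_irr E) (enum 'I_n.+1) f v
          | v <- enum 'I_n.+1].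

Lemma rooted_labelings_neq0 E f : rooted_labelings E f != [::].
Proof.
apply/eqP => H; have := labelings_neq0 (edge_sym E) (edge_irr E) (enum 'I_n.+1) f ord0.
case L : (labelings _ _ _ _ _) => [//|g l] _.
have : g \in rooted_labelings E f; last by rewrite H.
apply/flattenP; exists (g :: l); last exact: mem_head.
by rewrite -L; apply: map_f; rewrite mem_enum.
Qed.

Definition distr E f : probability (gspace R M) R :=
  @unif_law _ (gspace R M) R (rooted_labelings E f) (rooted_labelings_neq0 E f).

End distr.

(* The law of the random labeling of the ball of radius r around the root. A
   breadth-first search of g meets the vertices of this ball first, hence these
   are the restrictions of the random labeling of g. *)
Definition ball_distr (R : realType) (M : pfinType) (g : lgraph M) (r : nat) :
    probability (gspace R M) R :=
  let b := restr r g in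
  @unif_law _ (gspace R M) R _ (labelings_neq0
    (bfs_sym (lgraphP b)) (bfs_irr (lgraphP b))
    (enum_fset (fset_set (vert b))) (fun x => odflt point (color b x)) [::]).

(** * Offspring law, Galton-Watson trees and invariant processes *)

Definition mean (R : realType) (p : probability nat R) : \bar R :=
  \int[p]_k (k%:R)%:E.

Definition size_biased (R : realType) (p : probability nat R) (k : nat) : R :=
  k.+1%:R * fine (p [set k.+1]) / fine (mean p).

(* N x is the number of offspring of the individual x *)
Section tree.
Variable N : label -> nat.

Definition in_tree (x : label) : bool :=
  all (fun m => 0 < nth 0 x m <= N (take m x))%N (iota 0 (size x)).

Definition parent (x y : label) : bool :=
  prefix x y && (size y == (size x).+1).

Definition tree_adj (x y : label) : bool :=
  [&& in_tree x, in_tree y & parent x y || parent y x].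

End tree.

(* The offspring numbers defining a Galton-Watson tree of law UGW(p). *)
Definition gw_offspring (R : realType) (p : probability nat R)
    d (Omega : measurableType d) (P : probability Omega R)
    (N : label -> {mfun Omega >-> nat}) : Prop :=
  (forall x k, P (N x @^-1` [set k]) =
     if x == [::] then p [set k] else (size_biased p k)%:E) /\
  (forall (s : seq label) (k : label -> nat), uniq s ->
     P (\bigcap_(x in [set` s]) N x @^-1` [set k x]) =
     (\prod_(x <- s) fine (P (N x @^-1` [set k x])))%:E).

(* The roots need not correspond. *)
Definition isomorphism M (g h : lgraph M) (phi : label -> label) : Prop :=
  [/\ set_bij (vert g) (vert h) phi,
      forall x y, vert g x -> vert g y -> adj h (phi x) (phi y) = adj g x y &
      forall x, vert g x -> color h (phi x) = color g x].

Definition unimodular (R : realType) (M : pfinType)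
    (nu : probability (gspace R M) R) : Prop :=
  forall F : gspace R M -> label -> label -> \bar R,
    (forall g x y, (0 <= F g x y)%E) ->
    (forall x y, measurable_fun [set g : gspace R M | vert g x /\ vert g y]
                                (fun g => F g x y)) ->
    (forall g h phi, isomorphism g h phi ->
       forall x y, vert g x -> vert g y -> F h (phi x) (phi y) = F g x y) ->
    (\int[nu]_g (\esum_(x in vert g) F g [::] x) =
     \int[nu]_g (\esum_(x in vert g) F g x [::]))%E.

(* mu is the law of the randomly labeled version of the colored Galton-Watson
   tree TX; it is determined by its restrictions to balls around the root. *)
Definition invariant_process (R : realType) (M : pfinType)
    (p : probability nat R) (mu : probability (gspace R M) R) : Prop :=
  exists d (Omega : measurableType d) (P : probability Omega R)
    (N : label -> {mfun Omega >-> nat}) (TX : {mfun Omega >-> gspace R M}),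
  [/\ gw_offspring p P N,
      forall w, vert (TX w) = [set x | in_tree (N^~ w) x] /\
                adj (TX w) = tree_adj (N^~ w),
      unimodular (distribution P TX) &
      forall r A, measurable A ->
        restr_law mu r A = (\int[P]_w ball_distr R (TX w) r A)%E].

(** * Weak topology *)

Section weak_topology.
Variables (R : realType) (M : pfinType).
Implicit Types nu : probability (gspace R M) R.

Definition bounded_continuous (phi : gspace R M -> R) : Prop :=
  continuous phi /\ exists C, forall g, `|phi g| <= C.

Definition weak_open (U : set (probability (gspace R M) R)) : Prop :=
  forall nu, U nu -> exists (k : nat) (phi : 'I_k -> gspace R M -> R) (e : R),
    [/\ forall i, bounded_continuous (phi i), 0 < e &
        forall nu', (forall i,
          `|(\int[nu']_g phi i g) - (\int[nu]_g phi i g)| < e) -> U nu'].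

Definition dist_open (dist : probability (gspace R M) R ->
    probability (gspace R M) R -> R) (U : set (probability (gspace R M) R)) :=
  forall nu, U nu -> exists2 e, 0 < e & forall nu', dist nu nu' < e -> U nu'.

(* dist is a distance that generates the weak topology *)
Definition weak_distance (dist : probability (gspace R M) R ->
    probability (gspace R M) R -> R) : Prop :=
  [/\ forall nu nu', dist nu nu' = 0 <-> forall A, measurable A -> nu A = nu' A,
      forall nu nu', dist nu nu' = dist nu' nu,
      forall nu1 nu2 nu3, dist nu1 nu3 <= dist nu1 nu2 + dist nu2 nu3 &
      forall U, weak_open U <-> dist_open dist U].

End weak_topology.

(** * Sofic entropy *)

(* The set of simple graphs on {1, ..., n.+1} with degrees dn. *)
Definition graphs (n : nat) (dn : 'I_n.+1 -> nat) : {set {set {set 'I_n.+1}}} :=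
  [set E : {set {set 'I_n.+1}} | [forall A in E, #|A| == 2%N] &&
     [forall x, #|[set y | edge E x y]| == dn x]]%SET.

Section sofic_entropy.
Variables (R : realType) (M : pfinType).
Variable dist : probability (gspace R M) R -> probability (gspace R M) R -> R.
Variable N : set nat.
Variable dn : forall n, 'I_n.+1 -> nat.
Implicit Types (mu : probability (gspace R M) R) (r : nat) (eps alpha : R).

Definition good_colorings n (E : {set {set 'I_n.+1}}) mu r eps :
    {set {ffun 'I_n.+1 -> M}} :=
  [set f | dist (restr_law (distr R E f) r) (restr_law mu r) <= eps]%SET.

Definition coloring_entropy n (E : {set {set 'I_n.+1}}) mu r eps : \bar R :=
  let c := #|good_colorings E mu r eps| in
  if c == 0%N then -oo%E else (ln c%:R / n.+1%:R)%:E.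

(* P(H_{G_n}(mu, r, eps) >= h) for G_n uniform on the graphs with degrees dn *)
Definition prob_entropy_ge n mu r eps (h : \bar R) : R :=
  #|[set E in graphs (@dn n) | (h <= coloring_entropy E mu r eps)%E]%SET|%:R /
  #|graphs (@dn n)|%:R.

Definition entropy_quantile n mu r eps alpha : \bar R :=
  ereal_sup [set h | (h = -oo \/ 0 <= h < +oo)%E /\
                     alpha <= prob_entropy_ge n mu r eps h].

Definition upper_entropy_ball mu r alpha : \bar R :=
  lim (limf_esup (fun n => entropy_quantile n mu r eps alpha) (within N \oo)
       @[eps --> 0^'+]).

Definition upper_entropy mu alpha : \bar R :=
  limn (fun r => upper_entropy_ball mu r alpha).

End sofic_entropy.

(** * Annealed entropy *)

(* Shannon entropy of the discrete law with point masses q *)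
Definition shannon (R : realType) (T : choiceType) (q : T -> \bar R) : \bar R :=
  \esum_(x in setT) (- (fine (q x) * ln (fine (q x))))%:E.

Section annealed_entropy.
Variables (R : realType) (M : pfinType) (p : probability nat R).
Variable mu : probability (gspace R M) R.

(* The law of the tree rooted at the directed edge (o,1). The labels of the two
   ends of that edge are fixed, so it need not be recorded. *)
Definition edge_law (A : set (gspace R M)) : \bar R :=
  (((fine (mean p))^-1)%:E * \int[mu]_(g in A) (deg g [::])%:R%:E)%E.

Definition vertex_ball (g : lgraph M) (r : nat) : cgraph M :=
  induced_graph g (nball g [set [::]] r).

(* The restriction to E_r, for r >= 1. *)
Definition edge_ball (g : lgraph M) (r : nat) : cgraph M :=
  induced_graph g (nball g [set [::]; [:: 1%N]] r.-1).

Definition Sigma_ball (r : nat) : \bar R :=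
  (shannon (fun b : cgraph M => mu [set g | vertex_ball g r = b])
   - (fine (mean p) / 2)%:E *
     shannon (fun b : cgraph M => edge_law [set g | edge_ball g r = b])
   - shannon (fun k => p [set k]))%E.

Definition Sigma : \bar R := limn Sigma_ball.

End annealed_entropy.

(* Main.v *)
(* First moment method. By Markov's inequality it is enough to bound the mean
   number of colorings of G_n whose local statistics are close to mu, and the
   uniform graph is obtained from configurations: the degrees d_n are cut into
   half-edges, which are assigned to the slots of a sequence of e oriented edges.
   A colored simple configuration determines, for every vertex, the list of the
   types of its branches, and for every edge the pair of types of its two sides.
   Summing over these types gives a product of two factors, exp(n (H(X) - H(pi)))
   for the vertices (H(X) being the entropy of the unlabeled ball with ordered
   branches) and exp(-n d/2 H(edge types)) for matching the half-edges. That
   simple configurations are a polynomial fraction of all configurations follows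
   from a greedy construction finished by switchings; each simple graph has the
   same number of configurations. Exchangeability of the labels turns the
   resulting exponent into Sigma_r(mu), and unimodularity makes the law of the
   edge types symmetric, which is what the bound and its monotonicity in r need. *)
Require Import Defs.
From HB Require Import structures.
From mathcomp Require Import all_boot all_order all_algebra finmap.
From mathcomp Require Import all_classical all_reals all_analysis measurable_realfun.
From mathcomp Require Import zify lra.
Set Implicit Arguments.
Unset Strict Implicit.
Unset Printing Implicit Defensive.
Import Order.TTheory GRing.Theory Num.Theory.
Import numFieldNormedType.Exports numFieldTopology.Exports.
Local Open Scope classical_set_scope.
Local Open Scope ring_scope.

(** Degrees are bounded, so a ball of radius [k] is an element of the finite type [ptree k] and all
    entropies are finite sums. The graphs may have cycles, and no local convergence to a tree is
    proved: a vertex is typed by its ball in the universal cover, which is isomorphic to the labeled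
    ball when that ball is a tree. Walks that may not step back give an edge two types, one from
    each end, and these are swaps of each other with or without cycles; this is the only constraint
    that matching half-edges imposes on types. Vertex types keep the order of the branches at the
    root, because half-edges are distinguishable, but nothing deeper, so that the two ends of an
    edge can be compared. The coefficient d/2 comes from a square root: arranging the half-edges
    inside their type classes contributes the product of the [p t ^+ n t], listing the types of the
    edges divides by its square root. Probabilities may vanish, so their logarithms are unbounded.
    The limit laws are therefore thickened by a multiple of [delta], at a cost of order
    [delta * ln delta], and [delta] tends to 0 only after the number of vertices tends to
    infinity. *)

Section plane_trees.
Variables (M : finType) (D : nat).

(** * Plane trees *)

(** Trees of height at most [k] with at most [D] children per vertex; a vertex at depth [k] keeps
    only its color. Both bounds are there to make the type finite. *)
Fixpoint ptree (k : nat) : finType :=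
  if k is k'.+1 then (M * {bseq D of ptree k'})%type : finType else M.

(** [insub_bseq] replaces a list of more than [D] children by the empty list. *)
Definition node k (c : M) (l : seq (ptree k)) : ptree k.+1 :=
  (c, insub_bseq D l).

Definition rootc k (P : ptree k.+1) : M := P.1.
Definition kids k (P : ptree k.+1) : seq (ptree k) := P.2.

Lemma size_kids k (P : ptree k.+1) : (size (kids P) <= D)%N.
Proof. exact: size_bseq. Qed.

Lemma kids_node k c (l : seq (ptree k)) :
  kids (node c l) = if (size l <= D)%N then l else [::].
Proof.
by rewrite /kids /node /= /insub_bseq val_insubd.
Qed.

Lemma kids_nodeT k c (l : seq (ptree k)) : (size l <= D)%N ->
  kids (node c l) = l.
Proof. by move=> sl; rewrite kids_node ifT. Qed.

Lemma nodeK k (P : ptree k.+1) : node (rootc P) (kids P) = P.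
Proof.
case: P => c l; rewrite /node /rootc /kids /=; congr pair; apply: val_inj.
by rewrite /= /insub_bseq val_insubd ifT ?size_bseq.
Qed.

Lemma ptree_eqP k (P Q : ptree k.+1) :
  rootc P = rootc Q -> kids P = kids Q -> P = Q.
Proof. by move=> PQ lPQ; rewrite -(nodeK P) PQ lPQ nodeK. Qed.

Definition rank_le (T : finType) (x y : T) := (enum_rank x <= enum_rank y)%N.

Lemma rank_le_total (T : finType) : total (@rank_le T).
Proof. by move=> x y; exact: leq_total. Qed.
Lemma rank_le_trans (T : finType) : transitive (@rank_le T).
Proof. by move=> x y z; exact: leq_trans. Qed.
Lemma rank_le_anti (T : finType) : antisymmetric (@rank_le T).
Proof. by move=> x y; rewrite -eqn_leq => /eqP/val_inj/enum_rank_inj. Qed.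

(* The children of every vertex are sorted recursively, so that two plane trees
   have the same canonical form iff they are isomorphic rooted colored trees. *)
Fixpoint canon (k : nat) : ptree k -> ptree k :=
  match k return ptree k -> ptree k with
  | 0 => id
  | k'.+1 => fun P => node (rootc P) (sort (@rank_le _) (map (@canon k') (kids P)))
  end.

Lemma size_sort_canon k (l : seq (ptree k)) :
  size (sort (@rank_le _) (map (@canon k) l)) = size l.
Proof. by rewrite size_sort size_map. Qed.

Lemma sort_perm (T : finType) (l l' : seq T) :
  sort (@rank_le _) l = sort (@rank_le _) l' <-> perm_eq l l'.
Proof.
split=> [E|/permP ll']; last first.
  apply/perm_sortP; [exact: rank_le_total|exact: rank_le_trans|
    exact: rank_le_anti|exact/permP].
have /permPl H := perm_sort (@rank_le T) l.
have /permPl H' := perm_sort (@rank_le T) l'.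
by rewrite -(permPl H) E.
Qed.

Lemma rootc_canon k (P : ptree k.+1) : rootc (canon P) = rootc P.
Proof. by []. Qed.

Lemma kids_canon k (P : ptree k.+1) :
  kids (canon P) = sort (@rank_le _) (map (@canon k) (kids P)).
Proof. by rewrite kids_nodeT // size_sort_canon size_kids. Qed.

Lemma size_kids_canon k (P : ptree k.+1) : size (kids (canon P)) = size (kids P).
Proof. by rewrite kids_canon size_sort_canon. Qed.

Lemma canon_eqP k (P Q : ptree k.+1) : canon P = canon Q <->
  rootc P = rootc Q /\ perm_eq (map (@canon k) (kids P)) (map (@canon k) (kids Q)).
Proof.
split=> [E|[cPQ PQ]].
  split; first by rewrite -rootc_canon E.
  by apply/sort_perm; rewrite -!kids_canon E.
apply: ptree_eqP; rewrite ?rootc_canon // !kids_canon; exact/sort_perm.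
Qed.

Lemma canon_node k c (l l' : seq (ptree k)) :
  perm_eq (map (@canon k) l) (map (@canon k) l') ->
  canon (node c l) = canon (node c l').
Proof.
move=> ll'; apply/canon_eqP; split => //; rewrite !kids_node.
have /perm_size := ll'; rewrite !size_map => ->.
by case: leqP.
Qed.

Lemma canon_idem k (P : ptree k) : canon (canon P) = canon P.
Proof.
elim: k P => [//|k IH] P; apply/canon_eqP; split => //.
rewrite kids_canon; have /permPl H := perm_sort (@rank_le _) (map (@canon k) (kids P)).
apply: (@perm_trans _ (map (@canon k) (map (@canon k) (kids P)))).
  exact/perm_map.
by rewrite -map_comp (eq_map (g := @canon k)).
Qed.

Fixpoint tr (k : nat) : ptree k.+1 -> ptree k :=
  match k return ptree k.+1 -> ptree k with
  | 0 => @rootc 0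
  | k'.+1 => fun P => node (rootc P) (map (@tr k') (kids P))
  end.

Lemma rootc_tr k (P : ptree k.+2) : rootc (tr P) = rootc P.
Proof. by []. Qed.

Lemma kids_tr k (P : ptree k.+2) : kids (tr P) = map (@tr k) (kids P).
Proof. by rewrite kids_nodeT // size_map size_kids. Qed.

Lemma tr_node k c (l : seq (ptree k.+1)) : tr (node c l) = node c (map (@tr k) l).
Proof.
apply: ptree_eqP => //; rewrite kids_tr !kids_node size_map.
by case: leqP.
Qed.

(** Truncation does not respect the order used for sorting, so it is followed by a new canonical
    form; that one forgets any sorting done before. *)
Lemma canon_tr_canon k (P : ptree k.+1) : canon (tr (canon P)) = canon (tr P).
Proof.
elim: k P => [//|k IH] P; apply/canon_eqP; split => //.
rewrite !kids_tr kids_canon.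
have /permPl H := perm_sort (@rank_le _) (map (@canon k.+1) (kids P)).
apply: (@perm_trans _ (map (@canon k) (map (@tr k) (map (@canon k.+1) (kids P))))).
  by do 2 apply: perm_map.
by rewrite -!map_comp (eq_map (g := @canon k \o @tr k)).
Qed.

Lemma canon_tr k (P Q : ptree k.+1) : canon P = canon Q ->
  canon (tr P) = canon (tr Q).
Proof. by move=> PQ; rewrite -canon_tr_canon PQ canon_tr_canon. Qed.

Definition delnth (T : Type) i (l : seq T) := take i l ++ drop i.+1 l.

Lemma map_delnth (T U : Type) (h : T -> U) i l :
  map h (delnth i l) = delnth i (map h l).
Proof. by rewrite /delnth map_cat map_take map_drop. Qed.

Lemma delnth_perm (T : eqType) (x0 : T) i (l : seq T) : (i < size l)%N ->
  perm_eq l (nth x0 l i :: delnth i l).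
Proof.
move=> il; rewrite -{1}(cat_take_drop i l) (drop_nth x0) // /delnth.
by rewrite perm_catC /= perm_cons perm_catC.
Qed.

Lemma size_delnth (T : Type) i (l : seq T) : (i < size l)%N ->
  size (delnth i l) = (size l).-1.
Proof. by move=> il; rewrite size_cat size_take size_drop il; lia. Qed.

(** The root's half of the ball around its [i]-th edge. Truncating gives it the height [k] of the
    other half, the [i]-th branch, as in the ball [E_r] with [r = k.+1]. *)
Definition side k (P : ptree k.+1) i : ptree k :=
  tr (node (rootc P) (delnth i (kids P))).

Variable m0 : M.

Definition pt0 k : ptree k :=
  match k return ptree k with 0 => m0 | k'.+1 => node m0 [::] end.

Definition etype k (P : ptree k.+1) i : (ptree k * ptree k)%type :=
  (canon (side P i), canon (nth (pt0 k) (kids P) i)).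

(* Only the order of the children of the root is remembered. *)
Definition ord k (P : ptree k.+1) : ptree k.+1 :=
  node (rootc P) (map (@canon k) (kids P)).

Lemma kids_ord k (P : ptree k.+1) : kids (ord P) = map (@canon k) (kids P).
Proof. by rewrite kids_nodeT // size_map size_kids. Qed.

Lemma rootc_ord k (P : ptree k.+1) : rootc (ord P) = rootc P.
Proof. by []. Qed.

Lemma map_canon_idem k (l : seq (ptree k)) :
  map (@canon k) (map (@canon k) l) = map (@canon k) l.
Proof. by rewrite -map_comp; apply: eq_map => x /=; rewrite canon_idem. Qed.

Lemma canon_ord k (P : ptree k.+1) : canon (ord P) = canon P.
Proof. by apply/canon_eqP; split => //; rewrite kids_ord map_canon_idem. Qed.

Lemma canon_side k c (l : seq (ptree k)) (P : ptree k.+1) i :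
  rootc P = c -> perm_eq (map (@canon k) (delnth i (kids P))) (map (@canon k) l) ->
  canon (side P i) = canon (tr (node c l)).
Proof.
by move=> <- Pl; apply: canon_tr; apply: canon_node.
Qed.

Lemma etype_ord k (P : ptree k.+1) i : (i < size (kids P))%N ->
  etype (ord P) i = etype P i.
Proof.
move=> iP; congr pair; last by rewrite kids_ord (nth_map (pt0 k)) // canon_idem.
by apply: canon_side => //; rewrite kids_ord -map_delnth map_canon_idem.
Qed.

Definition edge_count k (P : ptree k.+1) (t : ptree k * ptree k) : nat :=
  count (fun i => etype P i == t) (iota 0 (size (kids P))).

(** Equal branches are interchangeable: the type of an edge depends on the color of the root, the
    multiset [u] of unlabeled branches and the branch [b] itself, not on its position. Hence edge
    counts are isomorphism invariants. *)
Definition etype_of k (c : M) (u : seq (ptree k)) (b : ptree k) :=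
  (canon (tr (node c (rem b u))), b).

Lemma etypeE k (P : ptree k.+1) i : (i < size (kids P))%N ->
  etype P i = etype_of (rootc P) (map (@canon k) (kids P))
                (nth (pt0 k) (map (@canon k) (kids P)) i).
Proof.
move=> iP; have iP' : (i < size (map (@canon k) (kids P)))%N by rewrite size_map.
congr pair; last by rewrite (nth_map (pt0 k)).
apply: canon_side => //.
set u := map _ (kids P); set b := nth _ u i.
have H : perm_eq (delnth i u) (rem b u).
  have := delnth_perm (pt0 k) iP'; rewrite -/u -/b => H.
  have /perm_to_rem H' : b \in u by rewrite mem_nth.
  by move: H'; rewrite (permPl H) perm_cons.
rewrite map_delnth -/u.
have -> : map (@canon k) (rem b u) = rem b u.
  rewrite -[RHS]map_id; apply/eq_in_map => x /mem_rem /mapP[y _ ->].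
  by rewrite canon_idem.
by [].
Qed.

Lemma etype_of_perm k c (u u' : seq (ptree k)) b : perm_eq u u' -> b \in u ->
  etype_of c u b = etype_of c u' b.
Proof.
move=> uu' bu; congr pair; apply: canon_tr; apply: canon_node; apply: perm_map.
have bu' : b \in u' by rewrite -(perm_mem uu').
rewrite -(perm_cons b) -(permPl (perm_to_rem bu)).
by rewrite (permPl uu') perm_to_rem.
Qed.

Lemma edge_countE k (P : ptree k.+1) t :
  edge_count P t = count (fun b =>
    etype_of (rootc P) (map (@canon k) (kids P)) b == t) (map (@canon k) (kids P)).
Proof.
set u := map _ _; rewrite /edge_count.
have -> : iota 0 (size (kids P)) = iota 0 (size u) by rewrite size_map.
rewrite -[X in _ = count _ X](mkseq_nth (pt0 k) u) /mkseq count_map; apply: eq_in_count => i.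
by rewrite mem_iota add0n /= => iu /=; rewrite etypeE // -(size_map (@canon k)).
Qed.

Lemma edge_count_canon k (P Q : ptree k.+1) t : canon P = canon Q ->
  edge_count P t = edge_count Q t.
Proof.
move=> /canon_eqP[cPQ PQ]; rewrite !edge_countE cPQ; set u := map _ (kids P).
rewrite (permP PQ); apply: eq_in_count => b bu.
by rewrite (etype_of_perm _ PQ) // (perm_mem PQ).
Qed.

Lemma edge_count_le k (P : ptree k.+1) t : (edge_count P t <= D)%N.
Proof.
by apply: leq_trans (size_kids P); rewrite -[leqRHS](size_iota 0) count_size.
Qed.

End plane_trees.

(** * Types of vertices in graphs *)

Section unfolding.
Variables (M : finType) (D : nat).

(* The non-backtracking walks of length at most k that start at x and do not
   step to y first, ordered as a plane tree by the neighbour lists [nb]. This is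
   a ball of the universal cover: the graph need not be a tree. *)
Fixpoint gtree (T : eqType) (nb : T -> seq T) (col : T -> M) k (x : T)
    (y : option T) : ptree M D k :=
  match k return ptree M D k with
  | 0 => col x
  | k'.+1 => @node M D _ (col x)
      [seq gtree nb col k' z (Some x) | z <- nb x & Some z != y]
  end.

Definition utype (T : eqType) (nb : T -> seq T) (col : T -> M) k x y :
  ptree M D k := canon (gtree nb col k x y).

(** Induction on the length of the walks. [Dom k x] says that walks of length [k] from [x] stay
    where [phi] is controlled; injectivity keeps the forbidden neighbour apart from the others. The
    lemma serves breadth-first labelings, restrictions to balls and graph isomorphisms alike. *)
Lemma utype_iso (T T' : eqType) (nb : T -> seq T) (nb' : T' -> seq T')
    (col : T -> M) (col' : T' -> M) (phi : T -> T')
    (X : T -> Prop) (Dom : nat -> T -> Prop) :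
  (forall x y, X x -> X y -> phi x = phi y -> x = y) ->
  (forall k x, Dom k x -> X x) ->
  (forall k x, Dom k x -> col' (phi x) = col x) ->
  (forall k x, Dom k.+1 x -> perm_eq (map phi (nb x)) (nb' (phi x)) /\
     forall z, z \in nb x -> Dom k z) ->
  forall k x y, Dom k x -> (forall y0, y = Some y0 -> X y0) ->
  utype nb' col' k (phi x) (omap phi y) = utype nb col k x y.
Proof.
move=> inj DX cE nE; rewrite /utype; elim=> [|k IH] x y Dx Xy /=.
  exact: cE Dx.
have [nbE nbD] := nE _ _ Dx.
rewrite (cE _ _ Dx); apply: canon_node; rewrite perm_sym.
apply: (@perm_trans _ (map (@canon M D k) (map (fun z => gtree nb' col' k z (Some (phi x)))
   [seq z <- map phi (nb x) | Some z != omap phi y]))); last first.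
  by do 2 apply: perm_map; exact: perm_filter.
rewrite filter_map -!map_comp.
rewrite (@eq_in_filter _ (preim phi [pred z | Some z != omap phi y])
   (fun z => Some z != y) (nb x)); last first.
  move=> z zx /=; case: y Xy => [y|//] Xy /=; congr negb.
  apply/eqP/eqP => [[/inj ->]|[->]] //; last exact: Xy.
  by apply: DX; exact: nbD.
rewrite [X in perm_eq X _](_ : _ = map (@canon M D k \o
  (fun z => gtree nb' col' k z (Some (phi x))) \o phi) [seq z <- nb x | Some z != y]) //.
apply/eq_in_map => z; rewrite mem_filter => /andP[_ zx] /=.
by rewrite -(IH z (Some x)) //; [exact: nbD|move=> _ [<-]; exact: DX Dx].
Qed.

Section one_graph.
Variables (T : eqType) (nb : T -> seq T) (col : T -> M) (m0 : M).
Local Notation gtree := (gtree nb col).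
Local Notation utype := (utype nb col).

Lemma tr_gtree k x y : tr (gtree k.+1 x y) = gtree k x y.
Proof.
elim: k x y => [//|k IH] x y.
have -> : gtree k.+2 x y =
    node (col x) [seq gtree k.+1 z (Some x) | z <- nb x & Some z != y] by [].
rewrite tr_node -map_comp; congr node.
by apply: eq_map => z; exact: IH.
Qed.

Lemma filter_delnth x (l : seq T) i : uniq l -> (i < size l)%N ->
  [seq z <- l | Some z != Some (nth x l i)] = delnth i l.
Proof.
move=> ul il; transitivity (rem (nth x l i) l).
  by rewrite rem_filter //; apply: eq_filter => z.
by rewrite remE index_uniq.
Qed.

Lemma kids_gtree k x : (size (nb x) <= D)%N ->
  kids (gtree k.+1 x None) = [seq gtree k z (Some x) | z <- nb x].
Proof.
move=> sx; rewrite kids_nodeT filter_predT // size_map //.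
Qed.

(** Deleting the [i]-th branch amounts to forbidding a first step to that neighbour, and the
    truncation in [side] removes the extra level. *)
Lemma side_gtree k x i : uniq (nb x) -> (size (nb x) <= D)%N ->
  (i < size (nb x))%N ->
  side (gtree k.+1 x None) i = gtree k x (Some (nth x (nb x) i)).
Proof.
move=> ux sx ix; rewrite -[RHS]tr_gtree /side kids_gtree // -map_delnth.
by rewrite -(@filter_delnth x).
Qed.

Lemma etype_gtree k x i : uniq (nb x) -> (size (nb x) <= D)%N ->
  (i < size (nb x))%N -> let y := nth x (nb x) i in
  etype m0 (gtree k.+1 x None) i = (utype k x (Some y), utype k y (Some x)).
Proof.
move=> ux sx ix y; rewrite /etype side_gtree // kids_gtree //.
by rewrite (nth_map x).
Qed.

Lemma edge_count_gtree k x t : uniq (nb x) -> (size (nb x) <= D)%N ->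
  edge_count m0 (gtree k.+1 x None) t =
  count (fun y => (utype k x (Some y), utype k y (Some x)) == t) (nb x).
Proof.
move=> ux sx; rewrite /edge_count kids_gtree // size_map.
rewrite -[X in _ = count _ X](mkseq_nth x (nb x)) /mkseq count_map.
by apply: eq_in_count => i; rewrite mem_iota /= add0n => ix; rewrite etype_gtree.
Qed.

(** The list [l] fixes the order of the branches at the root; it will be the list of neighbours in
    the order of the half-edges. *)
Definition star k x (l : seq T) : ptree M D k.+1 :=
  node (col x) [seq utype k z (Some x) | z <- l].

Lemma kids_star k x l : (size l <= D)%N ->
  kids (star k x l) = [seq utype k z (Some x) | z <- l].
Proof. by move=> sl; rewrite kids_nodeT // size_map. Qed.

Lemma canon_star k x l : (size l <= D)%N -> perm_eq l (nb x) ->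
  canon (star k x l) = utype k.+1 x None.
Proof.
move=> sl lx; apply/canon_eqP; split => //.
rewrite kids_star // kids_gtree -?(perm_size lx) //.
rewrite -!map_comp (eq_map (g := fun z => utype k z (Some x))) ?perm_map //.
by move=> z /=; rewrite canon_idem.
Qed.

Lemma etype_star k x l i : (size l <= D)%N -> perm_eq l (nb x) -> uniq l ->
  (i < size l)%N -> let y := nth x l i in
  etype m0 (star k x l) i = (utype k x (Some y), utype k y (Some x)).
Proof.
move=> sl lx ul il y.
have sx : (size (nb x) <= D)%N by rewrite -(perm_size lx).
have ux : uniq (nb x) by rewrite -(perm_uniq lx).
have yx : y \in nb x by rewrite -(perm_mem lx) mem_nth.
have jx : (index y (nb x) < size (nb x))%N by rewrite index_mem.
have := etype_gtree k ux sx jx; rewrite nth_index // => <-.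
rewrite !etypeE ?kids_star ?kids_gtree ?size_map //.
rewrite -!map_comp.
have E : map (@canon M D k \o (fun z => utype k z (Some x))) l =
    map (@canon M D k \o (fun z => gtree k z (Some x))) l.
  by apply: eq_map => z /=; rewrite canon_idem.
rewrite E.
rewrite !(nth_map x) ?nth_index // -/y.
apply: etype_of_perm; first exact: perm_map.
by apply: map_f; rewrite (perm_mem lx).
Qed.

End one_graph.
End unfolding.

(** * Counting *)

Section factorial_bounds.
Variable R : realType.

(** The power [n.+1] of the inequality 1 - 1/(n+1) <= exp(-1/(n+1)). *)
Lemma expR_pow_succ n : expR 1 * n%:R ^+ n.+1 <= n.+1%:R ^+ n.+1 :> R.
Proof.
have n1 : n.+1%:R != 0 :> R by rewrite pnatr_eq0.
have H : n%:R / n.+1%:R <= expR (- n.+1%:R^-1) :> R.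
  apply: le_trans (expR_ge1Dx _).
  by rewrite ler_pdivrMr ?ltr0n // mulrDl mul1r mulNr mulVf // -natr1 addrK.
have := lerXn2r n.+1 _ _ H; rewrite !nnegrE expR_ge0 divr_ge0 // => /(_ isT isT).
rewrite -expRM_natl mulrN mulfV // expRN expr_div_n.
rewrite ler_pdivrMr ?exprn_gt0 ?ltr0n // => H'.
by rewrite -ler_pdivlMl ?expR_gt0.
Qed.

Lemma fact_upper n : (0 < n)%N ->
  n`!%:R * expR n%:R <= expR 1 * n%:R ^+ n.+1 :> R.
Proof.
elim: n => [//|[|n] IH] _; first by rewrite mul1r expr1n mulr1.
have IH' := IH isT => {IH}.
rewrite factS natrM.
have -> : expR n.+2%:R = expR n.+1%:R * expR 1 :> R by rewrite -natr1 expRD.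
rewrite (_ : _ * _ = n.+2%:R * expR 1 * (n.+1`!%:R * expR n.+1%:R)); last by lra.
apply: (@le_trans _ _ (n.+2%:R * expR 1 * (expR 1 * n.+1%:R ^+ n.+2))).
  by apply: ler_wpM2l => //; rewrite mulr_ge0 // expR_ge0.
rewrite (_ : _ * _ * _ = expR 1 * n.+2%:R * (expR 1 * n.+1%:R ^+ n.+2)); last by lra.
rewrite [n.+2%:R ^+ _]exprS [leRHS]mulrA; apply: ler_wpM2l; last exact: expR_pow_succ.
by rewrite mulr_ge0 // expR_ge0.
Qed.

Lemma fact_upper_le n m (b : R) : (n <= m)%N -> n%:R <= b ->
  n`!%:R * expR n%:R <= expR 1 * m.+1%:R * b ^+ n.
Proof.
move=> nm nb; have b0 : 0 <= b by apply: le_trans nb.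
have [->|n0] := posnP n.
  rewrite mul1r expR0 mulr1 -[1 in leLHS]mul1r ler_pM ?ler1n //.
  by rewrite -(expR0 R) ler_expR.
apply: le_trans (fact_upper n0) _.
rewrite -mulrA ler_wpM2l ?expR_ge0 // exprS ler_pM ?exprn_ge0 //.
  by rewrite ler_nat ltnW.
by rewrite lerXn2r ?nnegrE.
Qed.

Lemma fact_lower n : n%:R ^+ n <= n`!%:R * expR n%:R :> R.
Proof.
elim: n => [|n IH]; first by rewrite expr0 mul1r -{1}(expR0 R) ler_expR.
rewrite factS natrM.
have -> : expR n.+1%:R = expR n%:R * expR 1 :> R by rewrite -natr1 expRD.
rewrite exprS -!mulrA.
apply: ler_wpM2l => //; rewrite mulrA.
apply: (@le_trans _ _ (n%:R ^+ n * expR 1)); last by rewrite ler_wpM2r ?expR_ge0.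
have [->|n0] := posnP n; first by rewrite !expr0 mul1r -{1}(expR0 R) ler_expR.
have n1 : n%:R != 0 :> R by rewrite pnatr_eq0 -lt0n.
have H : n.+1%:R / n%:R <= expR (n%:R^-1) :> R.
  apply: le_trans (expR_ge1Dx _).
  by rewrite -natr1 mulrDl mulfV // mul1r.
have := lerXn2r n _ _ H; rewrite !nnegrE expR_ge0 divr_ge0 // => /(_ isT isT).
rewrite -expRM_natl mulfV // expr_div_n ler_pdivrMr ?exprn_gt0 ?ltr0n //.
by rewrite mulrC.
Qed.

(** Up to a polynomial factor, the inverse of a multinomial coefficient is at most the weight of one
    sequence of type [nn]. The weights dominate the frequencies rather than equal them, so that a
    thickened law can be used for [p]. *)
Lemma prod_fact_le (T : finType) (nn : T -> nat) (p : T -> R) m :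
  (\sum_t nn t = m)%N -> (forall t, (nn t)%:R <= m%:R * p t) ->
  \prod_t (nn t)`!%:R <=
  (expR 1 * m.+1%:R) ^+ #|T| * \prod_t p t ^+ nn t * m`!%:R.
Proof.
move=> sm np.
have nm t : (nn t <= m)%N by rewrite -sm (bigD1 t) //= leq_addr.
have pp t : 0 <= m%:R * p t by apply: le_trans (np t).
have em0 : 0 < expR m%:R :> R by exact: expR_gt0.
rewrite -(ler_pM2r em0).
have -> : expR m%:R = \prod_t expR (nn t)%:R :> R by rewrite -expR_sum -natr_sum sm.
rewrite -big_split /=.
apply: (@le_trans _ _ (\prod_t (expR 1 * m.+1%:R * (m%:R * p t) ^+ nn t))).
  apply: ler_prod => t _; rewrite mulr_ge0 ?expR_ge0 //=.
  exact: fact_upper_le.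
rewrite big_split /= prodr_const -expR_sum -natr_sum sm -!mulrA.
apply: ler_wpM2l; first by rewrite exprn_ge0 // mulr_ge0 // expR_ge0.
have -> : \prod_t (m%:R * p t) ^+ nn t = m%:R ^+ m * \prod_t p t ^+ nn t.
  under eq_bigr do rewrite exprMn.
  by rewrite big_split /= -expr_sum sm.
have [m0|m0] := posnP m.
  have n0 t : nn t = 0%N by apply/eqP; rewrite -leqn0 -m0.
  rewrite m0 !expr0 expR0 !mulr1 mul1r.
  by under eq_bigr do rewrite n0 expr0; rewrite big1.
have p0 t : 0 <= p t by rewrite -(pmulr_rge0 _ (_ : 0 < m%:R :> R)) ?ltr0n.
rewrite mulrC ler_wpM2l ?fact_lower //.
by apply: prodr_ge0 => t _; exact: exprn_ge0.
Qed.

End factorial_bounds.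

(** * Method of types for oriented edges *)

Section type_classes.
Variables (R : realType) (T : finType) (inv : T -> T) (invK : involutive inv).

Definition profile e (z : {ffun 'I_e -> T}) (t : T) : nat :=
  (#|[set j | z j == t]%SET| + #|[set j | inv (z j) == t]%SET|)%N.

Lemma prod_profile e (z : {ffun 'I_e -> T}) (g : T -> R) :
  \prod_j (g (z j) * g (inv (z j))) = \prod_t g t ^+ profile z t.
Proof.
rewrite big_split /=; under [RHS]eq_bigr do rewrite exprD.
rewrite big_split /=; congr (_ * _).
  rewrite (partition_big z predT) //=; apply: eq_bigr => t _.
  rewrite (eq_bigr (fun=> g t)) => [|j /eqP-> //].
  by rewrite prodr_const; congr (_ ^+ _); apply: eq_card => j; rewrite inE.
rewrite (partition_big (inv \o z) predT) //=; apply: eq_bigr => t _.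
rewrite (eq_bigr (fun=> g t)) => [|j /eqP-> //].
by rewrite prodr_const; congr (_ ^+ _); apply: eq_card => j; rewrite inE.
Qed.

(** All [z] of profile [nn] have the same weight under the product of the [g (z j) * g (inv (z j))].
    The total mass is at most the right side, since 2ab <= a^2 + b^2 and [inv] permutes the
    types. *)
Lemma card_profile_le e (nn : T -> nat) (g : T -> R) : (forall t, 0 <= g t) ->
  #|[set z : {ffun 'I_e -> T} | [forall t, profile z t == nn t]]%SET|%:R *
    \prod_t g t ^+ nn t <= (\sum_t g t ^+ 2) ^+ e.
Proof.
move=> g0.
apply: (@le_trans _ _ ((\sum_t g t * g (inv t)) ^+ e)); last first.
  apply: lerXn2r; rewrite ?nnegrE.
  - by apply: sumr_ge0 => t _; rewrite mulr_ge0.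
  - by apply: sumr_ge0 => t _; rewrite exprn_ge0.
  have E : \sum_t g t ^+ 2 = \sum_t g (inv t) ^+ 2.
    by rewrite (reindex_inj (inv_inj invK)).
  rewrite -(ler_pM2l (_ : 0 < 2)) //.
  have -> : 2 * \sum_t g t ^+ 2 = \sum_t (g t ^+ 2 + g (inv t) ^+ 2).
    by rewrite big_split /= -E; lra.
  rewrite mulr_sumr; apply: ler_sum => t _; rewrite -subr_ge0.
  by rewrite (_ : _ - _ = (g t - g (inv t)) ^+ 2) ?sqr_ge0 //; lra.
rewrite -[X in _ ^+ X](card_ord e) -prodr_const bigA_distr_bigA /=.
rewrite [leRHS](bigID (fun z : {ffun 'I_e -> T} => [forall t, profile z t == nn t])) /=.
rewrite -[leLHS]addr0 lerD //; last first.
  by apply: sumr_ge0 => z _; apply: prodr_ge0 => j _; rewrite mulr_ge0.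
rewrite [leRHS](eq_bigr (fun=> \prod_t g t ^+ nn t)) => [|z zn]; last first.
  have {}zn t : profile z t = nn t by apply/eqP; move: t; apply/forallP.
  by rewrite prod_profile; apply: eq_bigr => t _; rewrite zn.
rewrite sumr_const mulr_natl le_eqVlt; apply/orP; left; apply/eqP; congr (_ *+ _).
by apply: eq_card => z; rewrite inE.
Qed.

End type_classes.

Section arrangements.
Variables (H : eqType) (T : finType) (s : H -> T).

(** All ways to draw from [A], without replacement, a sequence whose successive types are [zeta]. *)
Fixpoint arr (zeta : seq T) (A : seq H) : seq (seq H) :=
  if zeta is t :: zeta' then
    flatten [seq [seq h :: x | x <- arr zeta' (rem h A)] | h <- A & s h == t]
  else [:: [::]].

Lemma size_arr zeta A :
  (size (arr zeta A) <= \prod_t (count (fun h => s h == t) A)`!)%N.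
Proof.
elim: zeta A => [|t zeta IH] A /=.
  by rewrite prodn_gt0 // => t; rewrite fact_gt0.
rewrite size_flatten /shape -map_comp sumnE big_map big_filter.
have [c0|c0] := posnP (count (fun h => s h == t) A).
  rewrite big1_seq ?prodn_gt0 // => h /andP[ht hA].
  by move: c0 => /eqP; rewrite -leqn0 leqNgt -has_count; case/hasP; exists h.
pose c := (\prod_(u | u != t) (count (fun h => s h == u) A)`!)%N.
apply: (@leq_trans (\sum_(h <- A | s h == t)
   ((count (fun h => s h == t) A).-1)`! * c)); last first.
  rewrite big_const_seq iter_addn_0 [leqRHS](bigD1 t) //= -/c.
  by rewrite mulnC mulnA -[in leqRHS](prednK c0) factS prednK.
rewrite big_seq_cond [leqRHS]big_seq_cond.
apply: leq_sum => h /andP[hA /eqP ht] /=; rewrite size_map.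
apply: leq_trans (IH _) _; rewrite (bigD1 t) //=.
have cE u : count (fun h => s h == u) (rem h A) =
    (count (fun h => s h == u) A - (s h == u))%N.
  have /permP/(_ (fun h => s h == u)) := perm_to_rem hA.
  by move=> -> /=; lia.
rewrite cE ht eqxx subn1 leq_mul2l /c; apply/orP; right.
by rewrite leq_eqVlt; apply/orP; left; apply/eqP; apply: eq_bigr => u /negbTE ut;
   rewrite cE ht eq_sym ut subn0.
Qed.

Lemma mem_arr zeta A x : uniq x -> {subset x <= A} -> map s x = zeta ->
  x \in arr zeta A.
Proof.
elim: x zeta A => [|h x IH] [|t zeta] A //= /andP[hx ux] xA [ht xz].
apply/flattenP; exists [seq h :: y | y <- arr zeta (rem h A)].
  apply: (map_f (fun h => [seq h :: y | y <- arr zeta (rem h A)])).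
  by rewrite mem_filter ht eqxx xA // mem_head.
apply: map_f; apply: IH => // y yx.
have yA : y \in A by apply: xA; rewrite inE yx orbT.
have yh : y != h by apply: contraNneq hx => <-.
have hA : h \in A by apply: xA; exact: mem_head.
by have := yA; rewrite (perm_mem (perm_to_rem hA)) inE (negbTE yh).
Qed.

End arrangements.

Lemma card_arrangements (P H T : finType) (s : H -> T) (zeta : P -> T) :
  (#|[set x : {ffun P -> H} | injectiveb x & [forall q, s (x q) == zeta q]]%SET| <=
    \prod_t (#|[set h | s h == t]%SET|)`!)%N.
Proof.
have := size_arr s [seq zeta q | q <- enum P] (enum H).
have E t : count (fun h => s h == t) (enum H) = #|[set h | s h == t]%SET|.
  by rewrite cardE /enum_mem -size_filter -filter_predI; congr size;
     apply: eq_filter => h; rewrite !inE andbT.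
under eq_bigr do rewrite E.
move=> Hle; apply: leq_trans Hle.
rewrite cardE -(size_map (fun x : {ffun P -> H} => [seq x q | q <- enum P])).
apply: uniq_leq_size.
  rewrite map_inj_uniq ?enum_uniq // => x y /eq_in_map xy.
  by apply/ffunP => q; apply: xy; rewrite mem_enum.
move=> y /mapP[x]; rewrite mem_enum inE => /andP[/injectiveP xi /forallP xz] ->.
apply: mem_arr.
- by rewrite map_inj_uniq // enum_uniq.
- by move=> h _; rewrite mem_enum.
- by rewrite -map_comp; apply: eq_map => q /=; exact/eqP.
Qed.

Lemma sum_bseq (R : comNzSemiRingType) (T : finType) (D m : nat) (x0 : T)
    (F : nat -> T -> R) : (m <= D)%N ->
  \sum_(l : {bseq D of T} | size l == m) \prod_(i < m) F i (nth x0 l i) =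
  \prod_(i < m) \sum_x F i x.
Proof.
move=> mD; rewrite bigA_distr_bigA /=.
pose h (f : {ffun 'I_m -> T}) : {bseq D of T} := insub_bseq D [seq f i | i <- enum 'I_m].
pose h' (l : {bseq D of T}) : {ffun 'I_m -> T} := [ffun i : 'I_m => nth x0 l i].
have hE f : h f = [seq f i | i <- enum 'I_m] :> seq T.
  by rewrite /h /insub_bseq val_insubd size_map size_enum_ord mD.
have nthh f (i : 'I_m) : nth x0 (h f) i = f i.
  by rewrite hE (nth_map i) ?size_enum_ord // nth_ord_enum.
rewrite (reindex_onto h h') => [|l /eqP sl]; last first.
  apply: val_inj; rewrite [LHS]hE; apply: (@eq_from_nth _ x0).
    by rewrite size_map size_enum_ord.
  rewrite size_map size_enum_ord => i im.
  rewrite (nth_map (Ordinal im)) ?size_enum_ord // ffunE.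
  by rewrite (nth_enum_ord (Ordinal im)).
apply: eq_big => [f|f _].
  rewrite hE size_map size_enum_ord eqxx /=.
  by apply/eqP/ffunP => i; rewrite ffunE nthh.
by apply: eq_bigr => i _; rewrite nthh.
Qed.

(** * Configurations *)

Section configurations.
Variables (n e : nat) (d : 'I_n.+1 -> nat).
Hypothesis de : (\sum_v d v = e.*2)%N.

(* Half-edges, and the positions they occupy in a sequence of e oriented
   edges. *)
Definition half := {v : 'I_n.+1 & 'I_(d v)}.
Definition pos := ('I_e * bool)%type.
Definition conf := {ffun pos -> half}.
Definition flip (q : pos) : pos := (q.1, ~~ q.2).

Lemma flipK : involutive flip.
Proof. by move=> [j b]; rewrite /flip /= negbK. Qed.

Definition vtx (x : conf) (q : pos) : 'I_n.+1 := tag (x q).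

Definition edges_of (x : conf) : {set {set 'I_n.+1}} :=
  [set [set vtx x (j, false); vtx x (j, true)] | j : 'I_e]%SET.

Definition simple (x : conf) := injectiveb x && (edges_of x \in graphs d).

Lemma card_half : #|{: half}| = e.*2.
Proof.
rewrite card_tagged sumnE big_map big_enum /= -de.
by apply: eq_bigr => v _; rewrite card_ord.
Qed.

Lemma card_pos : #|{: pos}| = e.*2.
Proof. by rewrite card_prod card_ord card_bool muln2. Qed.

Lemma conf_onto (x : conf) : injective x -> forall h, exists q, x q = h.
Proof.
move=> xi h; have [y _ yK] : bijective x.
  by apply: inj_card_bij => //; rewrite card_half card_pos.
by exists (y h).
Qed.

Definition gnb (E : {set {set 'I_n.+1}}) v : seq 'I_n.+1 :=
  enum [set y | edge E v y]%SET.

Lemma size_gnb E v : E \in graphs d -> size (gnb E v) = d v.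
Proof. by rewrite inE => /andP[_ /forallP/(_ v)/eqP <-]; rewrite -cardE. Qed.

Lemma edges_of_neq (x : conf) j : edges_of x \in graphs d ->
  vtx x (j, false) != vtx x (j, true).
Proof.
rewrite inE => /andP[/forallP E2 _].
have jE : [set vtx x (j, false); vtx x (j, true)]%SET \in edges_of x by apply: imset_f.
have := E2 [set vtx x (j, false); vtx x (j, true)]%SET.
by rewrite jE cards2 eqSS eqb1.
Qed.

Lemma edges_ofP (x : conf) u v : (forall j, vtx x (j, false) != vtx x (j, true)) ->
  reflect (exists2 q, vtx x q = u & vtx x (flip q) = v) (edge (edges_of x) u v).
Proof.
move=> xN; apply: (iffP andP).
  move=> [uv /imsetP[j _ /setP juv]].
  have := juv u; rewrite !inE eqxx /= => /esym/orP uE.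
  have := juv v; rewrite !inE eqxx orbT /= => /esym/orP vE.
  case: uE => /eqP uE; case: vE => /eqP vE.
  - by move: uv; rewrite uE vE eqxx.
  - by exists (j, false); rewrite ?uE ?vE.
  - by exists (j, true); rewrite ?uE ?vE.
  - by move: uv; rewrite uE vE eqxx.
move=> [[j b] <- <-].
have jE : [set vtx x (j, false); vtx x (j, true)]%SET \in edges_of x by apply: imset_f.
have H := xN j.
by case: b; split => //; rewrite 1?eq_sym // finset.setUC.
Qed.

(** The default [tag h] is not reached for an injective configuration, which places every half-edge
    at some position. *)
Definition partner (x : conf) (h : half) : 'I_n.+1 :=
  if [pick q | x q == h] is Some q then vtx x (flip q) else tag h.

Lemma partnerE (x : conf) q : injective x -> partner x (x q) = vtx x (flip q).
Proof.
move=> xi; rewrite /partner; case: pickP => [q' /eqP/xi -> //|/(_ q)].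
by rewrite eqxx.
Qed.

Definition partners (x : conf) v : seq 'I_n.+1 :=
  [seq partner x (Tagged (fun v => 'I_(d v)) i) | i <- enum 'I_(d v)].

Lemma size_partners x v : size (partners x v) = d v.
Proof. by rewrite size_map size_enum_ord. Qed.

(** The [d v] distinct neighbours of [v] all occur in a list of length [d v], so that list has no
    repetition. *)
Lemma partners_perm x v : simple x ->
  uniq (partners x v) /\ perm_eq (partners x v) (gnb (edges_of x) v).
Proof.
move=> /andP[/injectiveP xi xE].
have sub : {subset gnb (edges_of x) v <= partners x v}.
  move=> u; rewrite mem_enum inE => /(edges_ofP _ _ (fun j => edges_of_neq j xE))[q qv qu].
  apply/mapP; case E : (x q) => [w i].
  have wv : w = v by rewrite -qv /vtx E.
  subst w; exists i; first by rewrite mem_enum.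
  have <- : x q = Tagged (fun v => 'I_(d v)) i by rewrite E.
  by rewrite partnerE.
have un : uniq (gnb (edges_of x) v) by exact: enum_uniq.
have sz : (size (partners x v) <= size (gnb (edges_of x) v))%N.
  by rewrite size_partners size_gnb.
have [_ eqi] := uniq_min_size un sub sz.
have up : uniq (partners x v) := leq_size_uniq un sub sz.
by split => //; apply: uniq_perm => // u; rewrite eqi.
Qed.

End configurations.

(** * Colored configurations with prescribed local types *)

Section upper_count.
Variables (R : realType) (M : finType) (m0 : M) (D k n e : nat).
Variable d : 'I_n.+1 -> nat.
Hypotheses (de : (\sum_v d v = e.*2)%N) (dD : forall v, (d v <= D)%N).
Local Notation pt := (ptree M D).
Local Notation conf := (conf e d).
Local Notation half := (half d).

(** The [i]-th branch at [v] lies behind the [i]-th half-edge of [v], so every half-edge can read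
    its type off this function. *)
Definition otype (x : conf) (f : {ffun 'I_n.+1 -> M}) : {ffun 'I_n.+1 -> pt k.+1} :=
  [ffun v => star D (gnb (edges_of x)) f k v (partners x v)].

Definition half_type (o : {ffun 'I_n.+1 -> pt k.+1}) (h : half) : pt k * pt k :=
  etype m0 (o (tag h)) (tagged h).

Lemma canon_otype x f v : simple x ->
  canon (otype x f v) = utype D (gnb (edges_of x)) f k.+1 v None.
Proof.
move=> xs; have [_ pp] := partners_perm v xs.
by rewrite ffunE canon_star ?size_partners.
Qed.

Lemma size_otype x f v : size (kids (otype x f v)) = d v.
Proof.
have sp := size_partners x v.
by rewrite ffunE kids_star ?sp // -[RHS]sp [LHS]size_map.
Qed.

Lemma half_type_otype x f q : simple x ->
  half_type (otype x f) (x q) =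
    (utype D (gnb (edges_of x)) f k (vtx x q) (Some (vtx x (flip q))),
     utype D (gnb (edges_of x)) f k (vtx x (flip q)) (Some (vtx x q))).
Proof.
move=> xs; have [up pp] := partners_perm (vtx x q) xs.
have /andP[/injectiveP xi _] := xs.
rewrite /half_type -/(vtx x q) ffunE etype_star ?size_partners //.
have -> : nth (vtx x q) (partners x (vtx x q)) (tagged (x q)) = vtx x (flip q).
  rewrite -(partnerE q xi) /partners (nth_map (tagged (x q))) ?size_enum_ord //.
  by rewrite nth_ord_enum; congr partner; rewrite /vtx; case: (x q).
by [].
Qed.

Definition swap (T : Type) (t : T * T) : T * T := (t.2, t.1).

Lemma swapK (T : Type) : involutive (@swap T).
Proof. by case. Qed.

Lemma half_type_flip x f q : simple x ->
  half_type (otype x f) (x (flip q)) = swap (half_type (otype x f) (x q)).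
Proof. by move=> xs; rewrite !half_type_otype // flipK. Qed.

Definition ntype (o : {ffun 'I_n.+1 -> pt k.+1}) t :=
  #|[set h : half | half_type o h == t]%SET|.

Lemma sum_ntype o : (\sum_t ntype o t = e.*2)%N.
Proof.
rewrite -(card_half de) -sum1_card (partition_big (half_type o) predT) //=.
by apply: eq_bigr => t _; rewrite sum1_card; apply: eq_card => h; rewrite !inE.
Qed.

Definition compatible o : {set conf} :=
  [set x : conf | injectiveb x &
     [forall q, half_type o (x (flip q)) == swap (half_type o (x q))]]%SET.

(** The types [z] of the oriented edges prescribe the type at each position. A configuration uses
    every half-edge once, so only [z] of profile [ntype o] occur, and then half-edges can be
    permuted only within their type. *)
Lemma card_compatible_nat o :
  (#|compatible o| <=
    #|[set z : {ffun 'I_e -> pt k * pt k} |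
        [forall t, profile (@swap (pt k)) z t == ntype o t]]%SET| *
    \prod_t (ntype o t)`!)%N.
Proof.
pose zeta (z : {ffun 'I_e -> pt k * pt k}) (q : pos e) :=
  if q.2 then swap (z q.1) else z q.1.
rewrite -sum1_card (partition_big
  (fun x : conf => [ffun j => half_type o (x (j, false))]) predT) //=.
rewrite -sum_nat_const [leqRHS]big_mkcond /=; apply: leq_sum => z _.
rewrite sum1_card; set X := [set x : {ffun pos e -> half} | injectiveb x &
        [forall q, half_type o (x q) == zeta z q]]%SET.
rewrite (_ : #|_| = #|X|); last first.
  apply: eq_card => x; rewrite unfold_in !inE; case: (injectiveb x) => //=.
  apply/andP/forallP => [[/forallP H /eqP <-]|H].
    by move=> [j [|]]; rewrite /zeta /= ffunE //; exact: H (j, false).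
  split; last by apply/eqP/ffunP => j; rewrite ffunE (eqP (H (j, false))).
  by apply/forallP => -[j b]; rewrite !(eqP (H _)) /zeta /=; case: b; rewrite /= ?swapK.
have [x0|/set0Pn[x]] := eqVneq X finset.set0.
  by rewrite x0 cards0.
rewrite inE => /andP[/injectiveP xi /forallP xz].
rewrite ifT; first exact: card_arrangements.
rewrite inE; apply/forallP => t; apply/eqP; rewrite /profile /ntype.
have -> : [set h : half | half_type o h == t]%SET = [set x q | q in [set q | zeta z q == t]%SET]%SET.
  apply/setP => h; rewrite inE; apply/idP/imsetP => [ht|[q]].
    have [q qh] := conf_onto de xi h; exists q => //.
    by rewrite inE -(eqP (xz q)) qh.
  by rewrite inE -(eqP (xz q)) => ? ->.
rewrite card_imset //.
have -> : [set q | zeta z q == t]%SET =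
   ([set (j, false) | j in [set j | z j == t]%SET] :|:
    [set (j, true) | j in [set j | swap (z j) == t]%SET])%SET.
  apply/setP => -[j b]; rewrite !inE /zeta /=.
  apply/idP/orP => [|[|] /imsetP[j']]; last 2 first.
  - by rewrite inE => ? [-> ->].
  - by rewrite inE => ? [-> ->].
  by case: b => H; [right|left]; apply/imsetP; exists j; rewrite ?inE.
rewrite cardsU disjoint_setI0; last first.
  by apply/pred0P => q /=; apply/negP => /andP[/imsetP[j _ ->] /imsetP[j' _]].
by rewrite cards0 subn0 !card_imset // => j j' [].
Qed.

(** The factorials contribute the product of the [p t ^+ ntype o t], and the number of possible [z]
    is at most [(\sum_t p t) ^+ e] divided by the square root of that product. One square root
    remains. *)
Lemma card_compatible o (p : pt k * pt k -> R) : (forall t, 0 < p t) ->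
  (forall t, (ntype o t)%:R <= (e.*2)%:R * p t) ->
  #|compatible o|%:R <= (expR 1 * (e.*2).+1%:R) ^+ #|{: pt k * pt k}| *
    (\sum_t p t) ^+ e * \prod_t Num.sqrt (p t) ^+ ntype o t * (e.*2)`!%:R.
Proof.
move=> p0 np; set C := _ ^+ #|_|; set G := \prod_t _.
have C0 : 0 <= C by rewrite exprn_ge0 // mulr_ge0 // expR_ge0.
have S0 : 0 <= (\sum_t p t) ^+ e.
  by rewrite exprn_ge0 // sumr_ge0 // => t _; exact: ltW.
have G0 : 0 < G by apply: prodr_gt0 => t _; rewrite exprn_gt0 // sqrtr_gt0.
have H1 := prod_fact_le (sum_ntype o) np; rewrite -/C in H1.
have H2 := card_profile_le (@swapK (pt k)) e (ntype o) (fun t => sqrtr_ge0 (p t)).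
have SE : \sum_t Num.sqrt (p t) ^+ 2 = \sum_t p t.
  by apply: eq_bigr => t _; rewrite sqr_sqrtr // ltW.
rewrite SE in H2.
rewrite -/G in H2.
have GG : \prod_t p t ^+ ntype o t = G * G.
  rewrite /G -big_split /=; apply: eq_bigr => t _.
  by rewrite -exprMn -expr2 sqr_sqrtr // ltW.
rewrite GG in H1; have := card_compatible_nat o.
rewrite -(ler_nat R) natrM natr_prod => H3.
rewrite -(ler_pM2r G0); apply: le_trans (ler_wpM2r (ltW G0) H3) _.
set N := #|_|%:R in H2 *; set F := \prod_t _ in H1 *.
rewrite (_ : N * F * G = (N * G) * F); last by lra.
apply: (@le_trans _ _ ((\sum_t p t) ^+ e * (C * (G * G) * (e.*2)`!%:R))); last first.
  by rewrite le_eqVlt; apply/orP; left; apply/eqP; lra.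
apply: ler_pM => //.
  by rewrite mulr_ge0 // ltW.
by rewrite /F prodr_ge0.
Qed.

(** The colors are the roots of the [o v], so a pair [(x, f)] is determined by [x] and [o]. Good [o]
    are counted by weights: each has weight at least [Q], and the total is a product over the
    vertices. Only trees with [d v] branches enter at [v], which is the origin of the term
    -H(pi). *)
Lemma card_good_le (S : {set conf * {ffun 'I_n.+1 -> M}})
    (good : pred {ffun 'I_n.+1 -> pt k.+1}) (w : pt k.+1 -> R)
    (p : pt k * pt k -> R) (Q B : R) :
  (forall x f, (x, f) \in S -> simple x && good (otype x f)) ->
  (forall P, 0 <= w P) -> (forall t, 0 < p t) -> 0 <= Q -> 0 <= B ->
  (forall o, good o -> (forall v, size (kids (o v)) = d v) ->
     [/\ Q <= \prod_v w (o v), forall t, (ntype o t)%:R <= (e.*2)%:R * p t &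
         \prod_t Num.sqrt (p t) ^+ ntype o t <= B]) ->
  #|S|%:R * Q <= \prod_v (\sum_(P | size (kids P) == d v) w P) *
    ((expR 1 * (e.*2).+1%:R) ^+ #|{: pt k * pt k}| * (\sum_t p t) ^+ e * B *
     (e.*2)`!%:R).
Proof.
move=> Sg w0 p0 Q0 B0 goodP; set K := _ * (e.*2)`!%:R.
pose OK (o : {ffun 'I_n.+1 -> pt k.+1}) := good o && [forall v, size (kids (o v)) == d v].
have OKP o : OK o -> [/\ Q <= \prod_v w (o v) & #|compatible o|%:R <= K].
  move=> /andP[go /forallP so].
  have [|HQ Hn HB] := goodP o go; first by move=> v; exact/eqP.
  split => //; apply: le_trans (card_compatible p0 Hn) _.
  apply: ler_wpM2r => //; apply: ler_wpM2l => //.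
  apply: mulr_ge0; apply: exprn_ge0; first by rewrite mulr_ge0 // expR_ge0.
  by apply: sumr_ge0 => t _; exact: ltW.
have HS : (#|S| <= \sum_(o | OK o) #|compatible o|)%N.
  rewrite -sum1_card (partition_big (fun s => otype s.1 s.2) OK) => [|[x f] xf]; last first.
    have /andP[xs gx] := Sg _ _ xf; rewrite /OK gx.
    by apply/forallP => v; rewrite size_otype.
  apply: leq_sum => o _; rewrite sum1_card.
  rewrite -(@card_in_imset _ _ (fun s : conf * {ffun 'I_n.+1 -> M} => s.1)); last first.
    move=> [x f] [x' f']; rewrite !unfold_in /= => /andP[_ /eqP <-] /andP[_ /eqP xf] xx'.
    rewrite -xx' in xf *; congr pair; apply/ffunP => v.
    by have /ffunP/(_ v)/(congr1 (@rootc _ _ _)) := xf; rewrite !ffunE.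
  apply: subset_leq_card; apply/fintype.subsetP => _ /imsetP[[x f] /= H ->].
  move: H; rewrite unfold_in /= => /andP[xf /eqP <-].
  have /andP[xs _] := Sg _ _ xf; rewrite inE (andP xs).1 /=.
  by apply/forallP => q; rewrite half_type_flip.
have K0 : 0 <= K.
  apply: mulr_ge0 => //; apply: mulr_ge0 => //.
  apply: mulr_ge0; apply: exprn_ge0; first by rewrite mulr_ge0 // expR_ge0.
  by apply: sumr_ge0 => t _; exact: ltW.
apply: (@le_trans _ _ (\sum_(o | OK o) \prod_v w (o v) * K)).
  apply: (@le_trans _ _ ((\sum_(o | OK o) #|compatible o|)%:R * Q)).
    by apply: ler_wpM2r => //; rewrite ler_nat.
  rewrite natr_sum mulr_suml; apply: ler_sum => o oOK.
  by have [HQ HK] := OKP o oOK; rewrite mulrC; apply: ler_pM.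
rewrite -mulr_suml.
apply: ler_wpM2r; first exact: K0.
rewrite (bigA_distr_big_dep (fun v => [pred P | size (kids P) == d v]) (fun _ P => w P)).
rewrite [leRHS](bigID OK) /= -[leLHS]addr0; apply: lerD; last first.
  by apply: sumr_ge0 => o _; apply: prodr_ge0.
rewrite le_eqVlt; apply/orP; left; apply/eqP; apply: eq_bigl => o.
rewrite andbC; case oOK : (OK o) => //=; apply/esym/familyP => v.
by move: oOK => /andP[_ /forallP]; exact.
Qed.

End upper_count.

(** * Simple configurations are not too rare *)

Section lower_count.
Variables (n e D : nat) (d : 'I_n.+1 -> nat).
Hypotheses (de : (\sum_v d v = e.*2)%N) (dD : forall v, (d v <= D)%N).
Local Notation half := (half d).
Local Notation hpair := (half * half)%type.

Definition epair (p : hpair) : {set 'I_n.+1} := [set tag p.1; tag p.2]%SET.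

Definition halves (y : seq hpair) : seq half := map fst y ++ map snd y.

Definition psimple (y : seq hpair) :=
  [&& uniq (halves y), all (fun p => tag p.1 != tag p.2) y & uniq (map epair y)].

Lemma halves_perm y y' : perm_eq y y' -> perm_eq (halves y) (halves y').
Proof. by move=> yy'; apply: perm_cat; apply: perm_map. Qed.

Lemma psimple_perm y y' : perm_eq y y' -> psimple y = psimple y'.
Proof.
move=> yy'; rewrite /psimple (perm_uniq (halves_perm yy')) (perm_all _ yy').
by rewrite (perm_uniq (perm_map epair yy')).
Qed.

Lemma halves_cons p y : perm_eq (halves (p :: y)) [:: p.1, p.2 & halves y].
Proof. by rewrite /halves /= perm_cons -cat1s perm_catCA. Qed.

Lemma psimple_cons p y : psimple (p :: y) =
  [&& tag p.1 != tag p.2, p.1 \notin halves y, p.2 \notin halves y,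
      epair p \notin map epair y & psimple y].
Proof.
rewrite /psimple (perm_uniq (halves_cons p y)) /= inE negb_or.
have [t12|t12] := boolP (tag p.1 == tag p.2); first by rewrite /= !andbF.
have -> : p.1 != p.2 by apply: contraNneq t12 => ->.
by rewrite /=; do !case: (_ \notin _); rewrite ?andbF //= ?andbT.
Qed.

Lemma card_tag v : #|[set h : half | tag h == v]%SET| = d v.
Proof.
have inj : injective (fun i : 'I_(d v) => Tagged (fun v => 'I_(d v)) i : half).
  by move=> i j /eqP; rewrite -tag_eqE /tag_eq /= eqxx /= tagged_asE => /eqP.
rewrite -[RHS]card_ord -cardsT -(card_imset _ inj); apply: eq_card => h.
rewrite inE; apply/eqP/imsetP => [|[i _ ->] //].
by case: h => w i /= wv; subst w; exists i.
Qed.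

(** The vertex [v] and its neighbours in the partial graph [y]: no new edge from [v] may end
    there. *)
Definition nbl (y : seq hpair) v : seq 'I_n.+1 :=
  v :: [seq tag p.2 | p <- y & tag p.1 == v] ++ [seq tag p.1 | p <- y & tag p.2 == v].

Lemma nblP y v u : ([set v; u]%SET \in map epair y) -> u \in nbl y v.
Proof.
move=> /mapP[p py /setP pE]; rewrite !inE mem_cat.
have := pE u; rewrite !inE eqxx orbT => /esym/orP[] /eqP uE.
  have := pE (tag p.2); rewrite !inE eqxx orbT => /orP[] /eqP vE.
    apply/orP; right; apply/orP; right; apply/mapP; exists p => //.
    by rewrite mem_filter vE eqxx.
  have := pE v; rewrite !inE eqxx /= => /esym; rewrite vE -uE orbb => /eqP ->.
  by rewrite eqxx.
have := pE (tag p.1); rewrite !inE eqxx => /orP[] /eqP vE.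
  apply/orP; right; apply/orP; left; apply/mapP; exists p => //.
  by rewrite mem_filter vE eqxx.
have := pE v; rewrite !inE eqxx /= => /esym; rewrite vE -uE orbb => /eqP ->.
by rewrite eqxx.
Qed.

Lemma mem_nbl_edge y p : p \in y -> tag p.1 \in nbl y (tag p.2).
Proof.
by move=> py; apply: nblP; rewrite finset.setUC; exact: map_f.
Qed.

Lemma count_halves y v : psimple y -> (count (fun h => tag h == v) (halves y) <= d v)%N.
Proof.
move=> /and3P[uy _ _]; rewrite -card_tag -size_filter cardE.
apply: uniq_leq_size; first exact: filter_uniq.
by move=> h; rewrite mem_filter mem_enum inE => /andP[].
Qed.

Lemma size_nbl y v : psimple y -> (size (nbl y v) <= D.+1)%N.
Proof.
move=> ys; rewrite /= ltnS size_cat !size_map !size_filter.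
apply: leq_trans (dD v); apply: leq_trans (count_halves v ys).
by rewrite /halves count_cat !count_map.
Qed.

Lemma card_tag_in (l : seq 'I_n.+1) :
  (#|[set h : half | tag h \in l]%SET| <= size l * D)%N.
Proof.
elim: l => [|v l IH] /=.
  by rewrite eq_card0 // => h; rewrite inE.
have -> : [set h : half | tag h \in v :: l]%SET =
   ([set h : half | tag h == v] :|: [set h : half | tag h \in l])%SET.
  by apply/setP => h; rewrite !inE.
rewrite mulSn; apply: leq_trans (leq_card_setU _ _) _.
by apply: leq_add => //; rewrite card_tag.
Qed.

(** A list [nbl y v] has at most [D.+1] entries, each with at most [D] half-edges. *)
Let c := (D.+1 * D)%N.

Lemma card_free y : psimple y ->
  #|[set h | h \notin halves y]%SET| = (e.*2 - (size y).*2)%N.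
Proof.
move=> /and3P[uy _ _]; rewrite -(card_half de).
have sy : (size y).*2 = #|halves y|.
  by rewrite (card_uniqP uy) size_cat !size_map addnn.
rewrite sy -(cardC (mem (halves y))) addKn.
by apply: eq_card => h; rewrite !inE.
Qed.

(** A free half-edge [h] can be paired with any free half-edge outside the vertices of
    [nbl y (tag h)], which excludes at most [c] of them. The bound is void once at most [c]
    half-edges are free; switchings take over before that. *)
Lemma greedy_step y : psimple y ->
  ((e.*2 - (size y).*2) * (e.*2 - (size y).*2 - c) <=
   #|[set p | psimple (p :: y)]%SET|)%N.
Proof.
move=> ys; set m := (_ - (size y).*2)%N.
have -> : #|[set p | psimple (p :: y)]%SET| =
    (\sum_(h : half) \sum_(h' | psimple ((h, h') :: y)) 1)%N.
  rewrite pair_big_dep /= -sum1_card; apply: eq_bigl => -[h h'].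
  by rewrite inE.
have cf := card_free ys; rewrite -/m in cf.
rewrite -[X in (X * _ <= _)%N]cf -sum_nat_const big_mkcond; apply: leq_sum => h _.
rewrite inE; case: ifP => // hy.
apply: (@leq_trans #|[set h' | h' \notin halves y] :\:
   [set h' : half | tag h' \in nbl y (tag h)]|%SET).
  rewrite cardsD cf; apply: leq_sub2l.
  apply: leq_trans (subset_leq_card (finset.subsetIr _ _)) _.
  apply: leq_trans (card_tag_in _) _.
  by rewrite leq_mul2r size_nbl ?orbT.
rewrite sum1_card; apply: subset_leq_card; apply/fintype.subsetP => h' /setDP[h'y hh'].
rewrite inE in h'y; rewrite inE in hh'.
change (is_true (psimple ((h, h') :: y))); rewrite psimple_cons hy h'y ys /= andbT.
rewrite eq_sym (contraNneq _ hh') /= => [|->]; last by rewrite inE eqxx.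
by apply: contra hh' => /nblP.
Qed.

Definition npsimple j := #|[set y : j.-tuple hpair | psimple y]%SET|.

Lemma npsimple_greedy j :
  (npsimple j * ((e.*2 - j.*2) * (e.*2 - j.*2 - c)) <= npsimple j.+1)%N.
Proof.
pose B := [set yp : j.-tuple hpair * hpair | psimple (yp.2 :: yp.1)]%SET.
apply: (@leq_trans #|B|); last first.
  pose F (yp : j.-tuple hpair * hpair) : j.+1.-tuple hpair := [tuple of yp.2 :: yp.1].
  have Fi : injective F.
    by move=> [y p] [y' p'] /(congr1 val)[pp' yy']; congr pair => //; exact: val_inj.
  rewrite -(card_imset _ Fi); apply: subset_leq_card.
  by apply/fintype.subsetP => _ /imsetP[yp + ->]; rewrite !inE.
have -> : #|B| = (\sum_(y : j.-tuple hpair) \sum_(p | psimple (p :: y)) 1)%N.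
  rewrite pair_big_dep /= -sum1_card; apply: eq_bigl => -[y p].
  by rewrite inE.
rewrite /npsimple -sum_nat_const big_mkcond; apply: leq_sum => y _.
rewrite inE; case: ifP => // ys; rewrite sum1_card.
have := greedy_step ys; rewrite size_tuple => H; apply: leq_trans H _.
by apply: subset_leq_card; apply/fintype.subsetP => p; rewrite inE.
Qed.

(* An edge (a,b) far from two free half-edges h and h' is replaced by the two
   edges (h,a) and (h',b). *)
Lemma switch_step y : psimple y -> (size y < e)%N -> (c.*2 < size y)%N ->
  exists y1 y2 a b h h', y = y1 ++ (a, b) :: y2 /\
    psimple ((h', b) :: y1 ++ (h, a) :: y2).
Proof.
move=> ys ye yc.
have : (1 < #|[set h | h \notin halves y]%SET|)%N by rewrite card_free //; lia.
move=> /card_gt1P[h [h' [hy h'y hh']]]; rewrite !inE in hy h'y.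
pose bad1 (p : hpair) := tag p.1 \in nbl y (tag h).
pose bad2 (p : hpair) := tag p.2 \in nbl y (tag h').
have cnt (l : seq half) v : uniq l ->
    (count (fun h => tag h \in nbl y v) l <= c)%N.
  move=> ul; rewrite -size_filter.
  apply: (@leq_trans #|[set h : half | tag h \in nbl y v]%SET|).
    rewrite cardE; apply: uniq_leq_size; first exact: filter_uniq.
    by move=> x; rewrite mem_filter mem_enum finset.in_set => /andP[].
  by apply: leq_trans (card_tag_in _) _; rewrite leq_mul2r size_nbl ?orbT.
have /and3P[uy ty ey] := ys.
have [u1 _ u2] : [/\ uniq (map fst y), ~~ has (mem (map fst y)) (map snd y) &
    uniq (map snd y)] by apply/and3P; rewrite -cat_uniq.
have c1 : (count bad1 y <= c)%N.
  by have := cnt _ (tag h) u1; rewrite count_map.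
have c2 : (count bad2 y <= c)%N.
  by have := cnt _ (tag h') u2; rewrite count_map.
have : has (predC (predU bad1 bad2)) y.
  rewrite has_count -(ltn_add2l (count (predU bad1 bad2) y)) addn0 count_predC.
  apply: leq_ltn_trans yc; rewrite -addnn.
  apply: leq_trans (leq_add c1 c2).
  by rewrite -count_predUI leq_addr.
move=> /hasP[[a b] aby]; rewrite /= /bad1 /bad2 /= negb_or => /andP[na nb].
have [y1 [y2 yE]] : exists y1 y2, y = y1 ++ (a, b) :: y2.
  by case/splitPr: aby => y1 y2; exists y1, y2.
exists y1, y2, a, b, h, h'; split => //.
pose y0 := y1 ++ y2.
have py : perm_eq y ((a, b) :: y0) by rewrite yE -cat1s perm_catCA.
have py' : perm_eq ((h', b) :: y1 ++ (h, a) :: y2) [:: (h', b), (h, a) & y0].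
  by rewrite perm_cons -cat1s perm_catCA.
rewrite (psimple_perm py').
move: (ys); rewrite (psimple_perm py) psimple_cons /= => /and5P[tab ay0 by0 ey0 ys0].
have hal : halves y =i [:: a, b & halves y0].
  by apply: perm_mem; apply: perm_trans (halves_perm py) (halves_cons _ _).
move: hy h'y; rewrite !hal !inE !negb_or => /and3P[ha hb hy0] /and3P[h'a h'b h'y0].
have sub0 A : A \in map epair y0 -> A \in map epair y.
  by rewrite (perm_mem (perm_map epair py)) inE => ->; rewrite orbT.
have eha : epair (h, a) \notin map epair y0.
  by apply: contra na => /sub0/nblP.
have ehb : epair (h', b) \notin map epair y0.
  by apply: contra nb => /sub0/nblP.
have tha : tag h != tag a by apply: contraNneq na => ->; rewrite inE eqxx.
have thb : tag h' != tag b by apply: contraNneq nb => ->; rewrite inE eqxx.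
have tab' : tag a \in nbl y (tag b) by exact: (@mem_nbl_edge _ (a, b)).
rewrite psimple_cons; apply/and5P; split; first exact: thb.
- by rewrite (perm_mem (halves_cons _ _)) !inE !negb_or /= h'y0 h'a eq_sym hh'.
- rewrite (perm_mem (halves_cons _ _)) !inE !negb_or /= by0 eq_sym hb /= andbT.
  by apply: contraNneq tab => ->.
- rewrite inE negb_or ehb andbT; apply/eqP => /setP E.
  have := E (tag h'); rewrite !inE eqxx /= => /esym/orP[] /eqP h'E.
    have := E (tag a); rewrite !inE eqxx orbT => /orP[] /eqP aE.
      by move: tha; rewrite aE h'E eqxx.
    by move: tab; rewrite aE eqxx.
  have := E (tag h); rewrite !inE eqxx /= => /orP[] /eqP hE.
    by move: tha; rewrite hE h'E eqxx.
  by move: na; rewrite hE tab'.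
- by rewrite psimple_cons; apply/and5P; split.
Qed.

(** The pair [(a, b)] destroyed by a switching is recovered by [rec] from the head [(h', b)] of the
    new list and the entry [(h, a)]. So a list of length [j] is determined by one of length [j.+1]
    and an index below [j]. *)
Lemma npsimple_switch j : (j < e)%N -> (c.*2 < j)%N ->
  (npsimple j <= j * npsimple j.+1)%N.
Proof.
move=> je jc.
have [p0 _] : exists p : hpair, True.
  have : (0 < #|{: half}|)%N by rewrite (card_half de); lia.
  by move=> /card_gt0P[h _]; exists (h, h).
pose rec (z : 'I_j * j.+1.-tuple hpair) : j.-tuple hpair :=
  [tuple (if i == z.1 then ((tnth z.2 (lift ord0 i)).2, (tnth z.2 ord0).2)
          else tnth z.2 (lift ord0 i)) | i < j].
pose B := finset.setX [set: 'I_j]%SET [set y : j.+1.-tuple hpair | psimple y]%SET.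
have -> : (j * npsimple j.+1 = #|B|)%N by rewrite cardsX cardsT card_ord.
apply: leq_trans (leq_imset_card rec _); apply: subset_leq_card.
apply/fintype.subsetP => y; rewrite inE => ys.
have [||y1 [y2 [a [b [h [h' [yE y's]]]]]]] := switch_step ys.
- by rewrite size_tuple.
- by rewrite size_tuple.
have sj : size (y1 ++ (a, b) :: y2) = j by rewrite -yE size_tuple.
have sj' : size ((h', b) :: y1 ++ (h, a) :: y2) == j.+1.
  by rewrite -sj /= !size_cat.
have ij : (size y1 < j)%N by rewrite -sj size_cat /= addnS ltnS leq_addr.
apply/imsetP; exists (Ordinal ij, Tuple sj'); first by rewrite inE /= !inE y's.
apply: eq_from_tnth => i; rewrite tnth_mktuple /=.
rewrite !(tnth_nth p0) yE /= !nth_cat -val_eqE /=.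
have [ilt|igt|->] := ltngtP i (size y1) => //; last by rewrite subnn.
by rewrite -(subnSK igt) /=.
Qed.

Lemma npsimple_lower : (3 * c < e)%N ->
  ((e.*2)`! <= e ^ c * (e.*2) ^ c.*2 * npsimple e)%N.
Proof.
move=> ec; set m := e.*2; set c2 := c.*2.
(* With [M] free half-edges left, the loss of a greedy step is absorbed by the binomial, since
   [M * 'C(M.-1, c2) = (M - c2) * 'C(M, c2)]. With [c2] equal to twice [c], the binomial is 1
   exactly when [c] edges are missing. *)
have H1 j : (j <= e - c)%N ->
    (m`! * 'C(m - j.*2, c2) <= npsimple j * ((m - j.*2)`! * 'C(m, c2)))%N.
  elim: j => [_|j IH jec].
    rewrite subn0 /npsimple; apply: leq_pmull.
    apply/card_gt0P; exists [tuple]; by rewrite inE.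
  have {}IH := IH (ltnW jec); set M := (m - j.*2)%N in IH *.
  have Mc : (c2.+2 <= M)%N by rewrite /M /m /c2; lia.
  have -> : (m - j.+1.*2 = M.-2)%N by rewrite /M; lia.
  have step := npsimple_greedy j; rewrite -/m -/M in step.
  have step' : (npsimple j * (M * (M - c2)) <= npsimple j.+1)%N.
    apply: leq_trans step; rewrite !leq_mul2l; apply/orP; right; apply/orP; right.
    by apply: leq_sub2l; rewrite /c2; lia.
  have M1 : (0 < M.-1)%N by lia.
  rewrite -(leq_pmul2r M1).
  have E : (M`! = M * (M.-1 * M.-2`!))%N.
    by case: (M) Mc => [|[|M']] //= _; rewrite !factS.
  apply: (@leq_trans (npsimple j * (M`! * 'C(m, c2)) * (M - c2))); last first.
    rewrite E; apply: (@leq_trans (npsimple j * (M * (M - c2)) * (M.-2`! * 'C(m, c2)) * M.-1)).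
      rewrite leq_eqVlt; apply/orP; left; apply/eqP.
      by rewrite -!mulnA; congr (_ * (_ * _))%N; nia.
    by rewrite leq_pmul2r // leq_mul2r step' orbT.
  apply: leq_trans (leq_mul IH (leqnn _)).
  rewrite -!mulnA leq_mul2l; apply/orP; right.
  have := mul_bin_down M c2 => B; rewrite [('C(M, _) * _)%N]mulnC -B mulnC.
  apply: leq_mul; first exact: leq_pred.
  by apply: leq_bin2l; lia.
(* The last [c] edges come from switchings, each at the cost of a factor at most [e]; they need more
   than [c.*2] edges in place, whence [3 * c < e]. *)
have H2 i : (i <= c)%N -> (npsimple (e - c) <= e ^ i * npsimple (e - c + i))%N.
  elim: i => [_|i IH ic]; first by rewrite expn0 mul1n addn0.
  apply: leq_trans (IH (ltnW ic)) _; rewrite expnSr -mulnA leq_mul2l.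
  apply/orP; right; rewrite addnS.
  apply: leq_trans (npsimple_switch _ _) _; [by lia|by lia|].
  by rewrite leq_mul2r; apply/orP; right; lia.
have := H1 (e - c)%N (leqnn _).
have -> : (m - (e - c).*2 = c2)%N by rewrite /m /c2; lia.
rewrite binn muln1 => H3; apply: leq_trans H3 _.
have := H2 c (leqnn _); rewrite subnK; last by lia.
move=> H4; rewrite [(c2`! * _)%N]mulnC bin_ffact.
have -> : (e ^ c * m ^ c2 * npsimple e = e ^ c * npsimple e * m ^ c2)%N by lia.
apply: leq_mul => //; rewrite ffact_prod -[X in (_ <= _ ^ X)%N]card_ord -prod_nat_const.
by apply: leq_prod => i _; exact: leq_subr.
Qed.

End lower_count.

(** * The uniform graph as the image of a uniform simple configuration *)

Section simple_configurations.
Variables (n e : nat) (d : 'I_n.+1 -> nat).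
Hypothesis de : (\sum_v d v = e.*2)%N.
Local Notation half := (half d).
Local Notation conf := (conf e d).

Lemma edges_ofE (x : conf) :
  edges_of x = [set [set vtx x q; vtx x (flip q)] | q : pos e]%SET.
Proof.
apply/setP => A; apply/imsetP/imsetP => [[j _ ->]|[[j b] _ ->]].
  by exists (j, false).
by exists j => //; case: b => //; rewrite finset.setUC.
Qed.

Lemma npsimple_le_simple : (npsimple d e <= #|[set x : conf | simple x]%SET|)%N.
Proof.
pose F (y : e.-tuple (half * half)) : conf :=
  [ffun q => if q.2 then (tnth y q.1).2 else (tnth y q.1).1].
have Fi : injective F.
  move=> y y' /ffunP yy'; apply: eq_from_tnth => j.
  have := yy' (j, false); have := yy' (j, true); rewrite !ffunE /=.
  by case: (tnth y j) => a b; case: (tnth y' j) => a' b' /= -> ->.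
rewrite /npsimple -(card_imset _ Fi); apply: subset_leq_card.
apply/fintype.subsetP => _ /imsetP[y + ->]; rewrite inE => /and3P[uy ty ey].
set x := F y; rewrite inE.
have xi : injective x.
  move=> q q' qq'; pose h0 := x q.
  (* [halves] lists the first ends of all pairs before the second ends, hence the offset [e]. *)
  have xE p : x p = nth h0 (halves y) (p.2 * e + p.1)%N.
    rewrite /x /F ffunE /halves nth_cat !size_map size_tuple.
    case: p => j [] /=; last by rewrite mul0n add0n ltn_ord -tnth_nth tnth_map.
    by rewrite mul1n ltnNge leq_addr /= addKn -tnth_nth tnth_map.
  have sz (p : pos e) : (p.2 * e + p.1 < size (halves y))%N.
    rewrite size_cat !size_map size_tuple.
    by case: p => -[j je] [] /=; lia.
  have /eqP := qq'; rewrite !xE nth_uniq // => /eqP.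
  case: q q' {qq' h0 xE} => -[j je] [] [[j' je'] []] /= E.
  - by congr (_, _); apply: val_inj => /=; lia.
  - lia.
  - lia.
  - by congr (_, _); apply: val_inj => /=; lia.
have xN j : vtx x (j, false) != vtx x (j, true).
  have := allP ty (tnth y j) (mem_tnth _ _).
  by rewrite /vtx /x !ffunE.
have epi j j' : [set vtx x (j, false); vtx x (j, true)]%SET =
    [set vtx x (j', false); vtx x (j', true)]%SET -> j = j'.
  have eE i : [set vtx x (i, false); vtx x (i, true)]%SET =
      nth finset.set0 (map (@epair _ d) y) i.
    rewrite -tnth_nth tnth_map /epair /vtx /x !ffunE //.
  rewrite !eE => /eqP; rewrite nth_uniq ?size_map ?size_tuple //.
  by move=> /eqP/val_inj.
rewrite /simple; apply/andP; split; first exact/injectiveP.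
rewrite inE; apply/andP; split.
  by apply/forallP => A; apply/implyP => /imsetP[j _ ->]; rewrite cards2 xN.
apply/forallP => v; apply/eqP.
pose P := [set q | vtx x q == v]%SET.
have -> : d v = #|P|.
  rewrite -card_tag -(card_imset P xi); apply: eq_card => h.
  rewrite inE; apply/idP/imsetP => [hv|[q]]; last by rewrite inE => qv ->.
  by have [q qh] := conf_onto de xi h; exists q => //; rewrite inE /vtx qh.
(* Two positions at [v] that lead to the same vertex lie on the same edge, as there are no double
   edges, and have the same orientation, as there are no loops. *)
have inj : {in P &, injective (fun q => vtx x (flip q))}.
  move=> [j b] [j' b']; rewrite !inE => /eqP jv /eqP jv' E.
  have bE i c : [set vtx x (i, false); vtx x (i, true)]%SET =
      [set vtx x (i, c); vtx x (flip (i, c))]%SET.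
    by case: c => //; rewrite finset.setUC.
  have jj' : j = j'.
    by apply: epi; rewrite (bE j b) (bE j' b') E jv jv'.
  subst j'; congr pair; case: b b' jv jv' {E} => -[] // <- E.
    by have := xN j; rewrite E eqxx.
  by have := xN j; rewrite E eqxx.
rewrite -(card_in_imset inj); apply: eq_card => u; rewrite inE.
apply/(edges_ofP _ _ xN)/imsetP => [[q qv qu]|[q]]; first by exists q; rewrite ?inE ?qv.
by rewrite inE => /eqP qv ->; exists q.
Qed.

Definition dart (x : conf) q := (vtx x q, vtx x (flip q)).

Lemma dart_flip x q : dart x (flip q) = ((dart x q).2, (dart x q).1).
Proof. by rewrite /dart flipK. Qed.

Lemma dart_inj x : simple x -> injective (dart x).
Proof.
move=> xs q q' [qv qu].
have /andP[/injectiveP xi _] := xs; apply: (xi).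
rewrite -!(partnerE _ xi) in qu; rewrite /vtx in qv.
case: (x q) (x q') qv qu => [v i] [v' i'] /= vv'; subst v' => E.
congr existT.
have [+ _] := partners_perm v xs => up.
have nE (a : 'I_(d v)) : nth v (partners x v) a = partner x (Tagged (fun v => 'I_(d v)) a).
  by rewrite (nth_map a) ?size_enum_ord // nth_ord_enum.
apply/val_inj/eqP => /=.
by rewrite -(nth_uniq v _ _ up) ?size_partners // !nE; apply/eqP; exact: E.
Qed.

Lemma dartP (x : conf) u v : simple x ->
  reflect (exists q, dart x q = (u, v)) (edge (edges_of x) u v).
Proof.
move=> /andP[_ xE]; apply: (iffP (edges_ofP _ _ (fun j => edges_of_neq j xE))).
  by move=> [q qu qv]; exists q; rewrite /dart qu qv.
by move=> [q [qu qv]]; exists q.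
Qed.

Definition fiber G := [set x : conf | simple x & edges_of x == G]%SET.

(** Edges are oriented from the smaller to the larger end, and the half-edge of [v] towards [u] gets
    the rank of [u] in [gnb G v]. The degree sum makes the number of edges equal to [e]. *)
Lemma ex_fiber G : G \in graphs d -> exists x, x \in fiber G.
Proof.
move=> GG; have GG' := GG; move: GG'; rewrite inE => /andP[/forallP G2 /forallP Gd].
pose A := [set p : 'I_n.+1 * 'I_n.+1 | edge G p.1 p.2 & (p.1 < p.2)%N]%SET.
have cA : #|A| = e.
  have S : (\sum_v d v = #|[set p : 'I_n.+1 * 'I_n.+1 | edge G p.1 p.2]%SET|)%N.
    rewrite -sum1_card (eq_bigl (fun p => edge G p.1 p.2)) => [|p]; last by rewrite inE.
    rewrite -(pair_big_dep predT (edge G) (fun _ _ => 1%N)) /=; apply: eq_bigr => v _.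
    by rewrite -(eqP (Gd v)) sum1_card; apply: eq_card => u; rewrite inE.
  have swi : injective (fun p : 'I_n.+1 * 'I_n.+1 => (p.2, p.1)) by move=> [a b] [a' b'] [-> ->].
  apply: double_inj; rewrite -de S -addnn -[X in (_ + X)%N](card_imset _ swi).
  rewrite -cardsUI [X in (_ + #|pred_of_set X|)%N](_ : _ = finset.set0) ?cards0 ?addn0; last first.
    apply/setP => -[a b]; rewrite !inE; apply/negP => /andP[/andP[_ /= ab]].
    by move=> /imsetP[[a' b']]; rewrite inE /= => /andP[_ ab'] [aE bE]; subst; lia.
  apply: eq_card => -[a b]; rewrite !inE /=; apply/orP/idP.
    move=> [/andP[]//|/imsetP[[a' b']]].
    by rewrite inE /= => /andP[ab' _] [-> ->]; rewrite edge_sym.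
  move=> ab; have [lt|gt|/val_inj E] := ltngtP a b; first by left; rewrite ab.
    by right; apply/imsetP; exists (b, a) => //; rewrite inE /= edge_sym ab.
  by move: ab; rewrite E edge_irr.
pose en (j : 'I_e) : 'I_n.+1 * 'I_n.+1 := enum_val (cast_ord (esym cA) j).
have enA j : edge G (en j).1 (en j).2 && ((en j).1 < (en j).2)%N.
  by have := enum_valP (cast_ord (esym cA) j); rewrite inE.
pose dt (q : pos e) := if q.2 then ((en q.1).2, (en q.1).1) else en q.1.
have dte q : edge G (dt q).1 (dt q).2.
  by have /andP[+ _] := enA q.1; rewrite /dt; case: q.2 => //=; rewrite edge_sym.
have [x xP] : exists x : pos e -> half, forall q, tag (x q) = (dt q).1 /\
    val (tagged (x q)) = index (dt q).2 (gnb G (dt q).1).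
  apply: (fin_all_exists (U := fun=> half) (P := fun q (h : half) => tag h = (dt q).1 /\
    val (tagged h) = index (dt q).2 (gnb G (dt q).1))) => q.
  have iq : (index (dt q).2 (gnb G (dt q).1) < d (dt q).1)%N.
    by rewrite -(size_gnb (dt q).1 GG) index_mem mem_enum inE.
  by exists (Tagged (fun v => 'I_(d v)) (Ordinal iq)).
pose y : conf := [ffun q => x q]; exists y.
have vy q : vtx y q = (dt q).1 by rewrite /vtx ffunE (xP q).1.
have dtf q : dt (flip q) = ((dt q).2, (dt q).1).
  by rewrite /dt /flip; case: q => j [] //=; case: (en j).
have eG : edges_of y = G.
  rewrite edges_ofE; apply/setP => B; apply/imsetP/idP => [[q _ ->]|BG].
    by rewrite !vy dtf /=; have /andP[] := dte q.
  have /cards2P[a [b [ab BE]]] := implyP (G2 B) BG.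
  have eab : edge G a b by rewrite /edge ab -BE.
  have [q qE] : exists q, dt q = (a, b).
    have [lt|gt|/val_inj E] := ltngtP a b; last by move: ab; rewrite E eqxx.
      have inA : (a, b) \in A by rewrite inE eab.
      exists (cast_ord cA (enum_rank_in inA (a, b)), false).
      by rewrite /dt /en /= cast_ordK enum_rankK_in.
    have inA : (b, a) \in A by rewrite inE edge_sym eab.
    exists (cast_ord cA (enum_rank_in inA (b, a)), true).
    by rewrite /dt /en /= cast_ordK enum_rankK_in.
  by exists q => //; rewrite !vy dtf qE BE.
rewrite inE eG eqxx andbT /simple eG GG andbT; apply/injectiveP => q q'.
rewrite !ffunE => qq'.
have [t1 i1] := xP q; have [t2 i2] := xP q'.
rewrite qq' t2 in t1; rewrite qq' i2 -t1 in i1.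
have m1 : (dt q).2 \in gnb G (dt q).1 by rewrite mem_enum inE.
have m2 : (dt q').2 \in gnb G (dt q).1 by rewrite -t1 mem_enum inE.
have e2 : (dt q).2 = (dt q').2.
  by rewrite -(nth_index ord0 m1) -(nth_index ord0 m2) -t1 -i1.
have E : dt q = dt q' by rewrite [LHS]surjective_pairing -t1 e2 -surjective_pairing.
case: q q' E {qq' t1 i1 t2 i2 m1 m2 e2} => j b [j' b'] E.
have /andP[_ o1] := enA j; have /andP[_ o2] := enA j'.
have bb' : b = b'.
  move: E; rewrite /dt /=; case: b b' => -[] // E; exfalso.
    by move: o2; rewrite -E /=; lia.
  by move: o1; rewrite E /=; lia.
subst b'; congr pair.
have : en j = en j'.
  by move: E; rewrite /dt /=; case: b => //; case: (en j) => ? ?; case: (en j') => ? ? [-> ->].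
by move=> /enum_val_inj /cast_ord_inj.
Qed.

(* Two configurations of the same simple graph differ by a permutation and
   reorientation [rho] of its edges and a permutation [kappa] of the half-edges
   at every vertex; both may be applied to a configuration of another graph. *)
Lemma card_fiber_le G G' : G' \in graphs d -> (#|fiber G| <= #|fiber G'|)%N.
Proof.
move=> GG'; have [->|/set0Pn[x0 x0G]] := eqVneq (fiber G) finset.set0.
  by rewrite cards0.
have [y0 y0G] := ex_fiber GG'.
move: x0G; rewrite inE => /andP[x0s /eqP x0E].
move: y0G; rewrite inE => /andP[y0s /eqP y0E].
have /andP[/injectiveP x0i _] := x0s; have /andP[/injectiveP y0i _] := y0s.
pose rho (x : conf) q := odflt q [pick q' | dart x0 q' == dart x q].
have rhoP x q : x \in fiber G -> dart x0 (rho x q) = dart x q.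
  rewrite inE => /andP[xs /eqP xE]; rewrite /rho; case: pickP => [q' /eqP //|no].
  have : edge (edges_of x0) (dart x q).1 (dart x q).2.
    by rewrite x0E -xE; apply/dartP => //; exists q.
  by move=> /(dartP _ _ x0s)[q' q'E]; have := no q'; rewrite q'E -surjective_pairing eqxx.
have rhoI x : x \in fiber G -> injective (rho x).
  move=> xG q q' /(congr1 (dart x0)); rewrite !rhoP //.
  by move: xG; rewrite inE => /andP[xs _]; exact: dart_inj.
have rhoF x q : x \in fiber G -> rho x (flip q) = flip (rho x q).
  by move=> xG; apply: (dart_inj x0s); rewrite rhoP // !dart_flip rhoP.
have rho_onto x p : x \in fiber G -> exists q, rho x q = p.
  by move=> /rhoI/injF_bij[r _ rK]; exists (r p).
pose kap (x : conf) h := if [pick q | x0 (rho x q) == h] is Some q then x q else h.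
have kapP x q : x \in fiber G -> kap x (x0 (rho x q)) = x q.
  move=> xG; rewrite /kap; case: pickP => [q' /eqP/x0i/(rhoI _ xG) -> //|/(_ q)].
  by rewrite eqxx.
have ontoR x h : x \in fiber G -> exists q, x0 (rho x q) = h.
  move=> xG; have [p <-] := conf_onto de x0i h.
  by have [q <-] := rho_onto _ p xG; exists q.
pose F (x : conf) : conf := [ffun q => kap x (y0 (rho x q))].
have vF x q : x \in fiber G -> vtx (F x) q = vtx y0 (rho x q).
  move=> xG; rewrite /vtx ffunE; have [p <-] := ontoR x (y0 (rho x q)) xG.
  by rewrite kapP //; have [+ _] := rhoP x p xG; rewrite /vtx.
have dF x q : x \in fiber G -> dart (F x) q = dart y0 (rho x q).
  by move=> xG; rewrite /dart !vF // rhoF.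
have Fi : {in fiber G &, injective F}.
  move=> x x' xG x'G xx'.
  have rr q : rho x q = rho x' q by apply: (dart_inj y0s); rewrite -!dF // xx'.
  apply/ffunP => q.
  have [p pE] : exists p, y0 (rho x p) = x0 (rho x q).
    have [p0 p0E] := conf_onto de y0i (x0 (rho x q)).
    by have [p pE] := rho_onto x p0 xG; exists p; rewrite pE.
  have /ffunP/(_ p) := xx'; rewrite !ffunE -rr pE kapP //.
  by rewrite rr kapP.
rewrite -(card_in_imset Fi); apply: subset_leq_card.
apply/fintype.subsetP => _ /imsetP[x xG ->].
have FE : edges_of (F x) = G'.
  rewrite -y0E !edges_ofE; apply/setP => B; apply/imsetP/imsetP => -[q _ ->].
    by exists (rho x q) => //; rewrite !vF // rhoF.
  by have [p <-] := rho_onto x q xG; exists p => //; rewrite !vF // rhoF.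
rewrite inE FE eqxx andbT /simple FE GG' andbT; apply/injectiveP => q q'.
rewrite !ffunE.
have [p pE] := ontoR x (y0 (rho x q)) xG; have [p' p'E] := ontoR x (y0 (rho x q')) xG.
rewrite -pE -p'E !kapP // => xpp.
have xi : injective x by move: xG; rewrite inE => /andP[/andP[/injectiveP]].
move/xi in xpp; subst p'.
by apply: (rhoI _ xG); apply: y0i; rewrite -pE -p'E.
Qed.

(** All fibres of [edges_of] over [graphs d] have the same size, which the case of the constant
    function 1 eliminates. Thus averages over simple configurations are averages over graphs. *)
Lemma sum_simple (F : {set {set 'I_n.+1}} -> nat) :
  ((\sum_(x : conf | simple x) F (edges_of x)) * #|graphs d| =
   #|[set x : conf | simple x]%SET| * \sum_(G in graphs d) F G)%N.
Proof.
have [->|/set0Pn[G0 G0G]] := eqVneq (graphs d) finset.set0.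
  by rewrite cards0 big_set0 !muln0.
have part (F' : {set {set 'I_n.+1}} -> nat) : (\sum_(x : conf | simple x) F' (edges_of x) =
    #|fiber G0| * \sum_(G in graphs d) F' G)%N.
  rewrite (partition_big (@edges_of _ _ d) (mem (graphs d))) /= => [|x /andP[] //].
  rewrite big_distrr /=; apply: eq_bigr => G GG.
  rewrite (eq_bigr (fun=> F' G)) => [|x /andP[_ /eqP -> //]].
  have -> : #|fiber G0| = #|fiber G|.
    by apply/eqP; rewrite eqn_leq !card_fiber_le.
  by rewrite -sum_nat_const; apply: eq_bigl => x; rewrite inE.
rewrite part; have := part (fun=> 1%N); rewrite !sum1_card.
have -> : #|[pred x : conf | simple x]| = #|[set x : conf | simple x]%SET|.
  by apply: eq_card => x; rewrite inE.
by move=> ->; rewrite mulnAC.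
Qed.

End simple_configurations.

(** * Entropies of laws of plane trees *)

Section entropy.
Variable R : realType.

Definition ent (T : finType) (q : T -> R) : R := - \sum_t q t * ln (q t).

Definition push (T U : finType) (h : T -> U) (q : T -> R) (u : U) : R :=
  \sum_(t | h t == u) q t.

Lemma push_ge0 (T U : finType) (h : T -> U) (q : T -> R) u :
  (forall t, 0 <= q t) -> 0 <= push h q u.
Proof. by move=> q0; apply: sumr_ge0. Qed.

Lemma sum_push (T U : finType) (h : T -> U) (q : T -> R) (g : U -> R) :
  \sum_u push h q u * g u = \sum_t q t * g (h t).
Proof.
rewrite [RHS](partition_big h predT) //=; apply: eq_bigr => u _.
by rewrite mulr_suml; apply: eq_bigr => t /eqP ->.
Qed.

Lemma sum_push1 (T U : finType) (h : T -> U) (q : T -> R) :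
  \sum_u push h q u = \sum_t q t.
Proof. by rewrite [RHS](partition_big h predT). Qed.

Lemma push_gt0 (T U : finType) (h : T -> U) (q : T -> R) t :
  (forall t, 0 <= q t) -> 0 < q t -> 0 < push h q (h t).
Proof.
move=> q0 qt; apply: lt_le_trans qt _.
by rewrite /push (bigD1 t) //= lerDl sumr_ge0.
Qed.

Lemma ln_le_sub1 (x : R) : 0 < x -> ln x <= x - 1.
Proof. by move=> x0; rewrite lerBrDl -{2}(lnK x0); exact: expR_ge1Dx. Qed.

Lemma ln_prod (I : Type) (r : seq I) (P : pred I) (f : I -> R) :
  (forall i, 0 < f i) -> ln (\prod_(i <- r | P i) f i) = \sum_(i <- r | P i) ln (f i).
Proof.
move=> f0; elim: r => [|i r IH]; first by rewrite !big_nil ln1.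
rewrite !big_cons; case: (P i) => //; rewrite lnM ?posrE ?IH //.
exact: prodr_gt0.
Qed.

(** Termwise, [q ln (w / q) <= w - q]. Any [w] of no larger mass is allowed; the applications use
    products of conditional laws, whose mass may drop where a denominator vanishes. *)
Lemma gibbs (T : finType) (q w : T -> R) :
  (forall t, 0 <= q t) -> (forall t, 0 <= w t) ->
  (forall t, 0 < q t -> 0 < w t) -> \sum_t w t <= \sum_t q t ->
  \sum_t q t * ln (w t) <= \sum_t q t * ln (q t).
Proof.
move=> q0 w0 qw wq; rewrite -subr_le0 -sumrB.
apply: (@le_trans _ _ (\sum_t (w t - q t))); last by rewrite sumrB subr_le0.
apply: ler_sum => t _; have [qt|qt] := ltP 0 (q t); last first.
  have -> : q t = 0 by apply/eqP; rewrite eq_le qt q0.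
  by rewrite !mul0r !subr0.
have wt := qw _ qt.
rewrite -mulrBr -ln_div //.
apply: (@le_trans _ _ (q t * (w t / q t - 1))).
  by rewrite ler_wpM2l // ln_le_sub1 // divr_gt0.
by rewrite mulrBr mulr1 mulrC divfK // gt_eqF.
Qed.

End entropy.

Section ball_laws.
Variables (R : realType) (M : finType) (m0 : M) (D : nat).
Local Notation pt := (ptree M D).
Local Notation pt0 := (pt0 D m0).

Definition canon_inv k (q : pt k -> R) := forall P Q, canon P = canon Q -> q P = q Q.

Lemma sum_ptree k c m (F : nat -> pt k -> R) : (m <= D)%N ->
  \sum_(P : pt k.+1 | (rootc P == c) && (size (kids P) == m))
    \prod_(i < m) F i (nth (pt0 k) (kids P) i) = \prod_(i < m) \sum_x F i x.
Proof.
move=> mD; rewrite -(sum_bseq (pt0 k) F mD).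
rewrite -(pair_big_dep (fun c' => c' == c) (fun c' (l : {bseq D of pt k}) => size l == m)
  (fun c' (l : {bseq D of pt k}) => \prod_(i < m) F i (nth (pt0 k) l i))) /=.
by rewrite big_pred1_eq.
Qed.

Lemma sum_etype k (P : pt k.+1) (g : pt k * pt k -> R) :
  \sum_(i < size (kids P)) g (etype m0 P i) = \sum_t (edge_count m0 P t)%:R * g t.
Proof.
rewrite -(big_mkord xpredT (fun i => g (etype m0 P i))) /index_iota subn0.
rewrite (partition_big (etype m0 P) predT) //=; apply: eq_bigr => t _.
rewrite (eq_bigr (fun=> g t)) => [|i /eqP -> //].
by rewrite big_const_seq iter_addr_0 mulr_natl /edge_count.
Qed.

Section one_level.
Variables (k : nat) (d : R) (q : pt k.+1 -> R).
Hypotheses (q0 : forall P, 0 <= q P) (d0 : 0 < d).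

Definition ordlaw := push (@ord M D k) q.

(** For [d] the mean degree of the root: the law of the type of a uniform edge at the root of the
    size-biased tree. *)
Definition plaw (t : pt k * pt k) : R := d^-1 * \sum_P q P * (edge_count m0 P t)%:R.

(* The law of the labeled ball around the edge from the root to its first
   child; [plaw] is the law of its two unlabeled halves. *)
Definition llaw (t : pt k * pt k) : R :=
  d^-1 * \sum_(P | (0 < size (kids P))%N && ((side P 0, nth (pt0 k) (kids P) 0) == t))
     q P * (size (kids P))%:R.

Lemma plaw_ge0 t : 0 <= plaw t.
Proof.
apply: mulr_ge0; first by rewrite invr_ge0 ltW.
by apply: sumr_ge0 => P _; rewrite mulr_ge0.
Qed.

Lemma sum_plaw (g : pt k * pt k -> R) :
  \sum_P q P * \sum_(i < size (kids P)) g (etype m0 P i) = d * \sum_t plaw t * g t.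
Proof.
under eq_bigr do rewrite sum_etype mulr_sumr.
rewrite exchange_big mulr_sumr /=; apply: eq_bigr => t _.
rewrite /plaw 2!mulrA mulfV ?gt_eqF // mul1r mulr_suml.
by apply: eq_bigr => P _; rewrite mulrA.
Qed.

Lemma plaw_gt0 P i : (i < size (kids P))%N -> 0 < q P -> 0 < plaw (etype m0 P i).
Proof.
move=> iP qP; rewrite /plaw mulr_gt0 ?invr_gt0 // (bigD1 P) //=.
apply: ltr_pwDl; last by apply: sumr_ge0 => Q _; rewrite mulr_ge0.
rewrite mulr_gt0 // ltr0n /edge_count -has_count; apply/hasP; exists i => //.
by rewrite mem_iota.
Qed.

(** The number of labelings of an unlabeled tree, that is, the size of its class of plane trees;
    zero when [t] is not in canonical form. *)
Definition ncanon j (t : pt j) : R := #|[set x : pt j | canon x == t]%SET|%:R.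

Lemma ncanon_gt0 j (t : pt j) : 0 < ncanon (canon t).
Proof. by rewrite ltr0n; apply/card_gt0P; exists t; rewrite inE. Qed.

Hypothesis qinv : canon_inv q.

Lemma ord_canon_eq (P Q : pt k.+1) : ord P = ord Q -> canon P = canon Q.
Proof. by move=> PQ; rewrite -(canon_ord P) PQ canon_ord. Qed.

(** [q] is constant on isomorphism classes, and the trees with the same [ord] as [P] arise by
    reordering inside each branch independently. *)
Lemma ordlawE P :
  ordlaw (ord P) = q P * \prod_(i < size (kids P)) ncanon (etype m0 P i).2.
Proof.
rewrite /ordlaw /push (eq_bigr (fun=> q P)) => [|Q /eqP/ord_canon_eq/qinv //].
pose m := size (kids P).
pose F i x : R := (canon x == canon (nth (pt0 k) (kids P) i))%:R.
rewrite (_ : \prod_(i < _) _ = \prod_(i < m) \sum_x F i x); last first.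
  apply: eq_bigr => i _; rewrite /ncanon /= /F -natr_sum; congr (_%:R).
  rewrite -sum1_card big_mkcond /=; apply: eq_bigr => x _; rewrite inE.
  by case: (_ == _).
rewrite -(sum_ptree (rootc P)) ?size_kids // mulr_sumr [LHS]big_mkcond [RHS]big_mkcond /=.
apply: eq_bigr => Q _.
case: ifP => [/eqP QP|QP].
  have cQP : rootc Q = rootc P := congr1 (@rootc _ _ _) QP; have kQP := congr1 (@kids _ _ _) QP.
  rewrite !kids_ord in kQP.
  have sQP : size (kids Q) = m by have := congr1 size kQP; rewrite !size_map.
  rewrite cQP eqxx sQP eqxx /= big1 ?mulr1 // => i _.
  have : nth (pt0 k) (map (@canon _ _ _) (kids Q)) i = nth (pt0 k) (map (@canon _ _ _) (kids P)) i.
    by rewrite kQP.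
  by rewrite !(nth_map (pt0 k)) ?sQP // => E; rewrite /F E eqxx.
case: ifP => // /andP[/eqP cQP /eqP sQP].
have [all1|] := boolP [forall i : 'I_m, canon (nth (pt0 k) (kids Q) i) ==
   canon (nth (pt0 k) (kids P) i)].
  exfalso; move: QP => /eqP; apply; apply: ptree_eqP; first exact: cQP.
  rewrite !kids_ord; apply: (@eq_from_nth _ (pt0 k)); rewrite !size_map ?sQP //.
  move=> i im; rewrite !(nth_map (pt0 k)) ?sQP //.
  exact/eqP/(forallP all1 (Ordinal im)).
rewrite negb_forall => /existsP[i ni]; rewrite (bigD1 i) //=.
by rewrite /F (negbTE ni) mul0r mulr0.
Qed.

Lemma ent_ordlaw :
  ent q = ent ordlaw + d * \sum_t plaw t * ln (ncanon t.2).
Proof.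
rewrite /ent -(sum_plaw (fun t => ln (ncanon t.2))).
rewrite (sum_push _ _ (fun o => ln (ordlaw o))) -!sumrN -big_split /=.
apply: eq_bigr => P _; have [->|qP] := eqVneq (q P) 0; first by rewrite !mul0r; lra.
have qP0 : 0 < q P by rewrite lt_neqAle eq_sym qP q0.
rewrite ordlawE lnM ?posrE //; last first.
  by apply: prodr_gt0 => i _; exact: ncanon_gt0.
rewrite ln_prod => [|i]; last exact: ncanon_gt0.
by lra.
Qed.

End one_level.
End ball_laws.

Section labeled_entropy.
Variables (R : realType) (M : finType) (m0 : M) (D : nat).
Local Notation pt := (ptree M D).
Local Notation pt0 := (pt0 D m0).

(* An isomorphism between two truncated trees extends to the trees that they
   truncate. *)
Lemma tr_coupling k (A A' : pt k) : canon A = canon A' ->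
  exists b : pt k.+1 -> pt k.+1,
    (forall P Q, tr P = A -> tr Q = A -> b P = b Q -> P = Q) /\
    (forall P, tr P = A -> tr (b P) = A' /\ canon (b P) = canon P).
Proof.
elim: k A A' => [|k IH] A A' AA'; first by exists id; move: AA' => /= ->; split.
move: AA' => /canon_eqP[cAA' pAA'].
move: pAA'; rewrite perm_sym => /(perm_iotaP (pt0 k))[Is].
rewrite size_map; set n := size (kids A) => pIs E.
have sIs : size Is = n by rewrite (perm_size pIs) size_iota.
have sA' : size (kids A') = n by have := congr1 size E; rewrite !size_map sIs.
have Isn j : (j < n)%N -> (nth 0%N Is j < n)%N.
  move=> jn; have : nth 0%N Is j \in iota 0 n by rewrite -(perm_mem pIs) mem_nth ?sIs.
  by rewrite mem_iota.
have EE j : (j < n)%N ->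
    canon (nth (pt0 k) (kids A) (nth 0%N Is j)) = canon (nth (pt0 k) (kids A') j).
  move=> jn; have := congr1 (fun s => nth (pt0 k) s j) E.
  rewrite (nth_map (pt0 k)) ?sA' // (nth_map 0%N) ?sIs // => ->.
  by rewrite (nth_map (pt0 k)) ?Isn.
have /choice[b bP] : forall j : nat, exists b : pt k.+1 -> pt k.+1, (j < n)%N ->
   (forall P Q, tr P = nth (pt0 k) (kids A) (nth 0%N Is j) ->
      tr Q = nth (pt0 k) (kids A) (nth 0%N Is j) -> b P = b Q -> P = Q) /\
   (forall P, tr P = nth (pt0 k) (kids A) (nth 0%N Is j) ->
      tr (b P) = nth (pt0 k) (kids A') j /\ canon (b P) = canon P).
  move=> j; have [jn|jn] := ltnP j n; last by exists id.
  by have [b ?] := IH _ _ (EE j jn); exists b.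
(* Child [j] of the image comes from child [nth 0 Is j] of [P], where [Is] matches the children of
   [A'] with isomorphic children of [A]. *)
pose B (P : pt k.+2) : pt k.+2 :=
  node (rootc P) [seq b j (nth (pt0 k.+1) (kids P) (nth 0%N Is j)) | j <- iota 0 n].
have nD : (n <= D)%N by exact: size_kids.
have kB P : kids (B P) =
    [seq b j (nth (pt0 k.+1) (kids P) (nth 0%N Is j)) | j <- iota 0 n].
  by rewrite kids_nodeT // size_map size_iota.
have trk P j : tr P = A -> (j < n)%N -> size (kids P) = n /\
    tr (nth (pt0 k.+1) (kids P) j) = nth (pt0 k) (kids A) j.
  move=> PA jn; have := kids_tr P; rewrite PA => kA.
  have sP : size (kids P) = n by rewrite /n kA size_map.
  by split => //; rewrite kA (nth_map (pt0 k.+1)) ?sP.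
exists B; split=> [P Q PA QA BPQ|P PA].
  apply: ptree_eqP.
    by have := congr1 (@rootc _ _ _) BPQ.
  have [n0|n0] := posnP n.
    have := congr1 size (kids_tr P); rewrite PA size_map -/n n0 => /esym/size0nil ->.
    by have := congr1 size (kids_tr Q); rewrite QA size_map -/n n0 => /esym/size0nil ->.
  have [sP _] := trk P _ PA n0; have [sQ _] := trk Q _ QA n0.
  apply: (@eq_from_nth _ (pt0 k.+1)); rewrite ?sP ?sQ // => i ij.
  have iIs : i \in Is by rewrite (perm_mem pIs) mem_iota.
  have jn : (index i Is < n)%N by rewrite -sIs index_mem.
  have := congr1 (fun s => nth (pt0 k.+1) s (index i Is)) (kB P).
  rewrite BPQ kB !(nth_map 0%N) ?size_iota // !nth_iota // add0n nth_index // => Eb.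
  have [+ _] := bP _ jn; rewrite nth_index //; apply => //.
  - by have [_ ->] := trk P _ PA ij.
  - by have [_ ->] := trk Q _ QA ij.
split.
  apply: ptree_eqP; first by rewrite rootc_tr /= -cAA' -PA.
  rewrite kids_tr kB; apply: (@eq_from_nth _ (pt0 k)).
    by rewrite !size_map size_iota sA'.
  rewrite !size_map size_iota => j jn.
  rewrite (nth_map (pt0 k.+1)) ?size_map ?size_iota // (nth_map 0%N) ?size_iota //.
  rewrite nth_iota // add0n.
  have [_ H] := bP j jn; have [] // := H (nth (pt0 k.+1) (kids P) (nth 0%N Is j)).
  by have [_ ->] := trk P _ PA (Isn _ jn).
apply/canon_eqP; split => //; rewrite kB.
apply/(perm_iotaP (pt0 k.+1)); exists Is.
  have [n0|n0] := posnP n; last by have [sP _] := trk P _ PA n0; rewrite size_map sP.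
  have := congr1 size (kids_tr P); rewrite PA size_map -/n n0 => /esym/size0nil -> /=.
  by move: pIs; rewrite n0.
apply: (@eq_from_nth _ (pt0 k.+1)); rewrite !size_map size_iota ?sIs // => j jn.
have [sP _] := trk P _ PA jn.
rewrite (nth_map (pt0 k.+1)) ?size_map ?size_iota // (nth_map 0%N) ?size_iota //.
rewrite (nth_map 0%N) ?sIs // (nth_map (pt0 k.+1)) ?sP ?Isn // nth_iota // add0n.
have [_ H] := bP j jn; have [] // := H (nth (pt0 k.+1) (kids P) (nth 0%N Is j)).
by have [_ ->] := trk P _ PA (Isn _ jn).
Qed.

(** The map of [tr_coupling] injects the extensions of [A] into those of [A'] without changing [w];
    the roles of [A] and [A'] can be exchanged. *)
Lemma push_tr_inv k (w : pt k.+1 -> R) : (forall P, 0 <= w P) -> canon_inv w ->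
  canon_inv (push (@tr M D k) w).
Proof.
move=> w0 wi.
suff H A A' : canon A = canon A' -> push (@tr M D k) w A <= push (@tr M D k) w A'.
  by move=> A A' AA'; apply/eqP; rewrite eq_le !H.
move=> /tr_coupling[b [binj bP]]; rewrite /push.
pose S := [set P | tr P == A]%SET; pose S' := [set P | tr P == A']%SET.
rewrite (eq_bigl (fun P => P \in S)) => [|P]; last by rewrite !inE.
rewrite [leRHS](eq_bigl (fun P => P \in S')) => [|P]; last by rewrite !inE.
rewrite [leLHS](eq_bigr (fun P => w (b P))) => [|P]; last first.
  by rewrite inE => /eqP PA; have [_ E] := bP _ PA; rewrite (wi _ _ E).
rewrite -(@big_imset _ _ _ _ _ b (mem S) w) /=; last first.
  by move=> P Q; rewrite !inE => /eqP PA /eqP; exact: binj.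
rewrite [leRHS](big_setID (b @: S)%SET) /= (finset.setIidPr _) ?lerDl ?sumr_ge0 //.
by apply/fintype.subsetP => _ /imsetP[P + ->]; rewrite !inE => /eqP PA; have [-> _] := bP _ PA.
Qed.

Section one_level.
Variables (k : nat) (d : R) (q : pt k.+1 -> R).
Hypotheses (q0 : forall P, 0 <= q P) (d0 : 0 < d) (qinv : canon_inv q).
Local Notation plaw := (plaw m0 d q).
Local Notation llaw := (llaw m0 d q).
Local Notation ncanon := (ncanon R).

Lemma llaw_inv (A A' B B' : pt k) : canon A = canon A' -> canon B = canon B' ->
  llaw (A, B) = llaw (A', B').
Proof.
(* Putting [B] back as first child writes [llaw (A, B)] as a pushforward under [tr]. Roots with [D]
   children get weight 0, since [node] cannot hold one more. *)
pose w (B : pt k) (Q : pt k.+1) := if (size (kids Q) < D)%N then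
  q (node (rootc Q) (B :: kids Q)) * (size (kids Q)).+1%:R else 0.
have lE A1 B1 : llaw (A1, B1) = d^-1 * push (@tr M D k) (w B1) A1.
  rewrite /llaw /push; congr (_ * _).
  rewrite (reindex_onto (fun Q : pt k.+1 => node (rootc Q) (B1 :: kids Q))
     (fun P => node (rootc P) (behead (kids P)))) /=; last first.
    move=> P /andP[P0 /eqP[_ PB]]; apply: ptree_eqP => //=.
    have sb : (size (behead (kids P)) <= D)%N.
      by rewrite size_behead; apply: leq_trans (leq_pred _) (size_kids _).
    rewrite kids_node kids_nodeT // -PB; case: (kids P) (size_kids P) P0 => //= a l.
    by move=> ->.
  rewrite [LHS]big_mkcond [RHS]big_mkcond; apply: eq_bigr => Q _.
  rewrite /w kids_node /=; have [sQ|sQ] := boolP (size (kids Q) < D)%N; last first.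
    by rewrite /= if_same.
  rewrite /= /side kids_nodeT //= /delnth take0 drop1 /= nodeK eqxx andbT.
  by rewrite xpair_eqE eqxx andbT.
move=> AA' BB'; rewrite !lE; congr (_ * _).
rewrite (@push_tr_inv _ _ _ _ _ _ AA').
- apply: eq_bigr => Q _; rewrite /w; case: ifP => // _; congr (_ * _).
  by apply: qinv; apply: canon_node; rewrite /= BB'.
- by move=> P; rewrite /w; case: ifP => // _; rewrite mulr_ge0.
move=> P Q PQ; rewrite /w.
have sPQ : size (kids P) = size (kids Q).
  by rewrite -size_kids_canon PQ size_kids_canon.
rewrite sPQ; case: ifP => // _; congr (_ * _); apply: qinv.
have /canon_eqP[-> pPQ] := PQ; apply: canon_node.
by rewrite /= perm_cons.
Qed.

(** Moving the [i]-th branch to the front is injective on plane trees and stays in the isomorphism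
    class, so it preserves [q]. *)
Lemma etype_exchangeable t i :
  \sum_(P | (i < size (kids P))%N && (etype m0 P i == t)) q P =
  \sum_(P | (i < size (kids P))%N && (etype m0 P 0 == t)) q P.
Proof.
pose mv (P : pt k.+1) : pt k.+1 := if (i < size (kids P))%N then
  node (rootc P) (nth (pt0 k) (kids P) i :: delnth i (kids P)) else P.
have kmv P : (i < size (kids P))%N ->
    kids (mv P) = nth (pt0 k) (kids P) i :: delnth i (kids P).
  move=> iP; rewrite /mv iP kids_nodeT //= size_delnth //.
  by rewrite prednK ?size_kids // (leq_trans _ iP).
have smv P : size (kids (mv P)) = size (kids P).
  have [iP|iP] := boolP (i < size (kids P))%N; last by rewrite /mv (negbTE iP).
  by rewrite kmv //= size_delnth // prednK // (leq_trans _ iP).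
have rmv P : rootc (mv P) = rootc P by rewrite /mv; case: ifP.
have inj : injective mv.
  move=> P Q PQ; have sPQ : size (kids P) = size (kids Q) by rewrite -smv PQ smv.
  have [iP|iP] := boolP (i < size (kids P))%N; last first.
    by move: PQ; rewrite /mv -sPQ (negbTE iP).
  have iQ : (i < size (kids Q))%N by rewrite -sPQ.
  apply: ptree_eqP; first by rewrite -rmv PQ rmv.
  have := congr1 (@kids _ _ _) PQ; rewrite !kmv // => -[nPQ].
  rewrite /delnth => /eqP; rewrite eqseq_cat ?size_take ?sPQ // => /andP[/eqP tPQ /eqP dPQ].
  rewrite -(cat_take_drop i (kids P)) -(cat_take_drop i (kids Q)) tPQ.
  by rewrite (drop_nth (pt0 k) iP) (drop_nth (pt0 k) iQ) nPQ dPQ.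
rewrite [RHS](reindex_inj inj) /= [LHS]big_mkcond [RHS]big_mkcond.
apply: eq_bigr => P _; rewrite smv; case: (boolP (i < _)%N) => //= iP.
have -> : etype m0 (mv P) 0 = etype m0 P i.
  by rewrite /etype /side rmv kmv //= /delnth take0 drop1.
case: ifP => // _; apply: qinv; apply/canon_eqP; rewrite rmv kmv //; split => //.
by apply: perm_map; exact: delnth_perm.
Qed.

Definition canon2 (x : pt k * pt k) := (canon x.1, canon x.2).

(** The size bias counts the edges at the root. By exchangeability, each of these copies of the
    first edge may stand for a different edge, and their sum is [edge_count]. *)
Lemma push_llaw t : push canon2 llaw t = plaw t.
Proof.
rewrite /push /llaw /plaw -mulr_sumr; congr (_ * _).
transitivity (\sum_(P | (0 < size (kids P))%N && (etype m0 P 0 == t)) q P * (size (kids P))%:R).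
  rewrite (exchange_big_dep (fun P => (0 < size (kids P))%N && (etype m0 P 0 == t))) /=.
    apply: eq_bigr => P /andP[sP /eqP Pt].
    rewrite (big_pred1 (side P 0, nth (pt0 k) (kids P) 0)) // => x /=.
    rewrite sP /= [RHS]eq_sym; apply: andb_idl => /eqP <-.
    by rewrite /canon2 -Pt.
  by move=> x P /eqP <- /andP[-> /eqP <-] /=.
transitivity (\sum_(i < D) \sum_(P | (i < size (kids P))%N && (etype m0 P 0 == t)) q P).
  rewrite (exchange_big_dep (fun P => (0 < size (kids P))%N && (etype m0 P 0 == t))) /=.
    apply: eq_bigr => P /andP[sP Pt].
    rewrite (eq_bigl (fun i : 'I_D => (i < size (kids P))%N)) => [|i]; last by rewrite Pt andbT.
    rewrite -(big_ord_widen D (fun=> q P)) ?size_kids //.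
    by rewrite sumr_const card_ord mulr_natr.
  by move=> i P _ /andP[iP ->]; rewrite andbT (leq_ltn_trans _ iP).
under eq_bigr do rewrite -etype_exchangeable.
rewrite (exchange_big_dep predT) //=; apply: eq_bigr => P _.
pose f i := if etype m0 P i == t then q P else 0.
rewrite (eq_bigl (fun i : 'I_D => (i < size (kids P))%N && (etype m0 P i == t))) //.
rewrite big_mkcondr /=.
rewrite -(big_ord_widen D f) ?size_kids // -(big_mkord xpredT f) /f -big_mkcond /=.
by rewrite big_const_seq iter_addr_0 mulr_natr /index_iota subn0.
Qed.

Lemma llaw_plaw x : llaw x * (ncanon (canon x.1) * ncanon (canon x.2)) = plaw (canon2 x).
Proof.
rewrite -push_llaw /push (eq_bigr (fun=> llaw x)) => [|y /eqP[y1 y2]]; last first.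
  by case: x y y1 y2 => [A B] [A' B'] /= y1 y2; exact: llaw_inv.
rewrite sumr_const -mulr_natr; congr (_ * _).
rewrite /ncanon -natrM -cardsX; congr (_%:R); apply: eq_card => y.
by rewrite !inE.
Qed.

Lemma llaw_ge0 x : 0 <= llaw x.
Proof.
apply: mulr_ge0; first by rewrite invr_ge0 ltW.
by apply: sumr_ge0 => P _; rewrite mulr_ge0.
Qed.

Lemma ent_llaw : ent llaw =
  ent plaw + \sum_t plaw t * (ln (ncanon t.1) + ln (ncanon t.2)).
Proof.
rewrite /ent.
under [X in _ = - X + _]eq_bigr do rewrite -push_llaw.
under [X in _ = _ + X]eq_bigr do rewrite -push_llaw.
rewrite (sum_push _ _ (fun t => ln (push canon2 llaw t))).
rewrite (sum_push _ _ (fun t => ln (ncanon t.1) + ln (ncanon t.2))).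
rewrite -!sumrN -big_split /=; apply: eq_bigr => x _.
have [->|lx] := eqVneq (llaw x) 0; first by rewrite !mul0r; lra.
have lx0 : 0 < llaw x by rewrite lt_neqAle eq_sym lx llaw_ge0.
have n1 : 0 < ncanon (canon x.1) :> R := ncanon_gt0 _ _.
have n2 : 0 < ncanon (canon x.2) :> R := ncanon_gt0 _ _.
rewrite push_llaw -llaw_plaw; move: (llaw x) lx0 {lx} => l l0.
by rewrite !lnM ?posrE ?mulr_gt0 //; lra.
Qed.

(* Labels are uniform given the unlabeled type, and the number of labelings
   factorizes along the edges at the root. *)
Lemma labeled_entropy : (forall t, plaw (swap t) = plaw t) ->
  ent q - d / 2 * ent llaw = ent (ordlaw q) - d / 2 * ent plaw.
Proof.
move=> psym; rewrite (ent_ordlaw m0 q0 d0 qinv) ent_llaw.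
have E : \sum_t plaw t * ln (ncanon t.1) = \sum_t plaw t * ln (ncanon t.2) :> R.
  rewrite (reindex_inj (inv_inj (@swapK (pt k)))) /=.
  by apply: eq_bigr => t _; rewrite psym.
have -> : \sum_t plaw t * (ln (ncanon t.1) + ln (ncanon t.2)) =
    \sum_t plaw t * ln (ncanon t.1) + \sum_t plaw t * ln (ncanon t.2) :> R.
  by rewrite -big_split /=; apply: eq_bigr => t _; rewrite mulrDr.
by rewrite E; lra.
Qed.

End one_level.
End labeled_entropy.

(** * Monotonicity of the annealed entropy in the radius *)

Section entropy_decreases.
Variables (R : realType) (M : finType) (m0 : M) (D k : nat).
Local Notation pt := (ptree M D).
Local Notation pt0 := (pt0 D m0).
Variables (d : R) (q : pt k.+2 -> R).
Hypotheses (q0 : forall P, 0 <= q P) (d0 : 0 < d).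

Definition ctr j (x : pt j.+1) : pt j := canon (tr x).

Let u2 (t : pt k.+1 * pt k.+1) : pt k * pt k := (ctr t.1, ctr t.2).
(** What the smaller ball shows of an edge at the root: all of the root's side, which [side] has
    truncated already, but not the last level of the branch. *)
Let h (t : pt k.+1 * pt k.+1) : pt k.+1 * pt k := (t.1, ctr t.2).
Let h2 (t : pt k.+1 * pt k.+1) : pt k * pt k.+1 := (ctr t.1, t.2).

Lemma etype_tr (P : pt k.+2) i : (i < size (kids P))%N ->
  etype m0 (tr P) i = u2 (etype m0 P i).
Proof.
move=> iP.
have -> : u2 (etype m0 P i) =
    (canon (tr (side P i)), canon (tr (nth (pt0 k.+1) (kids P) i))).
  by congr pair; exact: canon_tr_canon.
by rewrite /etype /side rootc_tr kids_tr -map_delnth -tr_node (nth_map (pt0 k.+1)).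
Qed.

Lemma edge_count_tr (P : pt k.+2) t0 :
  (edge_count m0 (tr P) t0 = \sum_(t | u2 t == t0) edge_count m0 P t)%N.
Proof.
rewrite /edge_count kids_tr size_map.
rewrite (@eq_in_count _ _ (fun i => u2 (etype m0 P i) == t0)); last first.
  by move=> i; rewrite mem_iota /= add0n => iP; rewrite etype_tr.
rewrite -sum1_count (partition_big (etype m0 P) (fun t => u2 t == t0)) //=.
apply: eq_bigr => t /eqP tt0; rewrite -sum1_count; apply: eq_bigl => i.
by apply: andb_idl => /eqP ->; rewrite tt0.
Qed.

Local Notation p' := (plaw m0 d q).
Local Notation q1 := (push (@tr M D k.+1) q).

Lemma plaw_tr t0 : plaw m0 d q1 t0 = push u2 p' t0.
Proof.
rewrite /push /plaw (sum_push _ _ (fun P => (edge_count m0 P t0)%:R)) -mulr_sumr.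
congr (_ * _); rewrite exchange_big /=; apply: eq_bigr => P _.
by rewrite edge_count_tr natr_sum mulr_sumr.
Qed.

Let pm := push h p'.

Lemma ord_tr_ord (P : pt k.+2) : ord (tr (ord P)) = ord (tr P).
Proof.
apply: ptree_eqP => //; rewrite !kids_ord !kids_tr kids_ord -!map_comp.
by apply: eq_map => x /=; rewrite canon_tr_canon.
Qed.

(** The conditional law of the branch given [h]. Where [pm] vanishes, division by zero gives 0, so
    the sums stay at most 1. *)
Let kappa (t : pt k.+1 * pt k.+1) : R := p' t / pm (h t).

(* The ball of radius k.+1 is sampled first, and the leaves of every branch at
   the root are then drawn independently given the edge type seen so far. *)
Let w (o : pt k.+2) : R := ordlaw q1 (ord (tr o)) *
  \prod_(i < size (kids o)) kappa (canon (side o i), nth (pt0 k.+1) (kids o) i).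

Let w_ord (P : pt k.+2) : w (ord P) = ordlaw q1 (ord (tr P)) *
  \prod_(i < size (kids P)) kappa (etype m0 P i).
Proof.
rewrite /w ord_tr_ord kids_ord size_map; congr (_ * _); apply: eq_bigr => i _.
have E : canon (side (ord P) i) = (etype m0 P i).1 :> pt k.+1.
  by rewrite -(etype_ord m0 (ltn_ord i)).
by rewrite E (nth_map (pt0 k.+1)).
Qed.

Let p0 t : 0 <= p' t. Proof. exact: plaw_ge0. Qed.
Let pm0 t : 0 <= pm t. Proof. exact: push_ge0. Qed.
Let kappa0 t : 0 <= kappa t. Proof. by rewrite divr_ge0. Qed.

Let w0 o : 0 <= w o.
Proof.
apply: mulr_ge0; last by apply: prodr_ge0.
by apply: push_ge0 => P; exact: push_ge0.
Qed.

Let kappa_gt0 P i : (i < size (kids P))%N -> 0 < q P -> 0 < kappa (etype m0 P i).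
Proof.
by move=> iP qP; have pP := plaw_gt0 m0 q0 d0 iP qP; rewrite divr_gt0 // push_gt0.
Qed.

Let mu1_gt0 P : 0 < q P -> 0 < ordlaw q1 (ord (tr P)).
Proof.
move=> qP; apply: push_gt0; first by move=> Q; exact: push_ge0.
exact: push_gt0.
Qed.

Let sum_kappa (a : pt k.+1) (b : pt k) :
  \sum_x (ctr x == b)%:R * kappa (a, x) <= 1.
Proof.
have -> : \sum_x (ctr x == b)%:R * kappa (a, x) = pm (a, b) / pm (a, b).
  rewrite {1}/pm /push mulr_suml.
  rewrite (eq_bigl (fun t => (a == t.1) && (ctr t.2 == b))) => [|t]; last first.
    by rewrite /h xpair_eqE eq_sym.
  rewrite -(pair_big_dep (fun a' => a == a') (fun _ x => ctr x == b)
    (fun a' x => p' (a', x) / pm (a, b))) /=.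
  rewrite [RHS](big_pred1 a) => [|a']; last by rewrite /= eq_sym.
  rewrite [RHS]big_mkcond; apply: eq_bigr => x _.
  rewrite /kappa /h /=; case: eqP => [->|_]; by rewrite ?mul1r ?mul0r.
have [->|pab] := eqVneq (pm (a, b)) 0; first by rewrite mul0r.
by rewrite mulfV.
Qed.

Let sum_w : \sum_o w o <= \sum_P q P.
Proof.
rewrite (partition_big (fun o => ord (tr o)) predT) //.
apply: (@le_trans _ _ (\sum_o ordlaw q1 o)); last by rewrite !sum_push1.
apply: ler_sum => o _; have mu0 : 0 <= ordlaw q1 o.
  by apply: push_ge0 => P; exact: push_ge0.
rewrite /w (eq_bigr (fun x : pt k.+2 => ordlaw q1 o *
  \prod_(i < size (kids x)) kappa (canon (side x i), nth (pt0 k.+1) (kids x) i)));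
  last by move=> x /eqP ->.
rewrite -mulr_sumr -[leRHS]mulr1 ler_wpM2l //.
pose m := size (kids o).
(* The root's side of edge [i] is a function of the truncated tree [o], the same for all [x] above
   [o]; hence the sum over [x] factorizes along the edges. *)
pose a i := canon (node (rootc o) (delnth i (kids o))).
pose F i x : R := (ctr x == nth (pt0 k) (kids o) i)%:R * kappa (a i, x).
have F0 i x : 0 <= F i x by rewrite mulr_ge0.
apply: (@le_trans _ _ (\prod_(i < m) \sum_x F i x)); last first.
  by apply: prodr_ile1 => i; rewrite sumr_ge0 //= sum_kappa.
rewrite -(sum_ptree m0 (rootc o)) ?size_kids // [leLHS]big_mkcond [leRHS]big_mkcond.
apply: ler_sum => x _; case: (ord (tr x) =P o) => [xo|_]; last first.
  by case: ifP => // _; apply: prodr_ge0.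
have cxo : rootc x = rootc o by have := congr1 (@rootc _ _ _) xo.
have kxo : map (@ctr k) (kids x) = kids o.
  by rewrite -xo kids_ord kids_tr -map_comp.
have sxo : size (kids x) = m by rewrite /m -kxo size_map.
rewrite cxo eqxx sxo eqxx /= le_eqVlt; apply/orP; left; apply/eqP.
apply: eq_bigr => i _; rewrite /F -kxo (nth_map (pt0 k.+1)) ?sxo // eqxx mul1r.
congr kappa; congr pair; rewrite /side tr_node cxo /a; apply: canon_node.
rewrite -kxo -map_delnth -!map_comp.
by rewrite (@eq_map _ _ (@canon M D k \o @ctr k) (@canon M D k \o @tr M D k)) //
   => y /=; rewrite canon_idem.
Qed.

Lemma push_pos (T U : finType) (f : T -> U) (r : T -> R) u :
  (forall t, 0 <= r t) -> 0 < push f r u -> exists2 t, f t = u & 0 < r t.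
Proof.
move=> r0 pu; have pu0 : push f r u <> 0 by apply/eqP; rewrite gt_eqF.
have [|t /andP[/eqP tu rt]] := psumr_neq0P _ pu0; first by move=> t _; exact: r0.
by exists t.
Qed.

(** Gibbs' inequality against [w]: given the smaller ball, the new level adds at most the
    conditional entropy [ent p' - ent pm] for each edge at the root, and there are [d] of them on
    average. *)
Let ent_step : ent (ordlaw q) <= ent (ordlaw q1) + d * (ent p' - ent pm).
Proof.
have H : \sum_o ordlaw q o * ln (w o) <= \sum_o ordlaw q o * ln (ordlaw q o).
  apply: gibbs => //; last by rewrite [leRHS]sum_push1 sum_w.
  - by move=> o; exact: push_ge0.
  - move=> o /(push_pos q0)[P <- qP]; rewrite w_ord mulr_gt0 ?mu1_gt0 //.
    by apply: prodr_gt0 => i _; exact: kappa_gt0.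
rewrite [leLHS](sum_push _ _ (fun o => ln (w o))) in H.
have E : \sum_P q P * ln (w (ord P)) =
    \sum_P q P * ln (ordlaw q1 (ord (tr P))) +
    \sum_P q P * \sum_(i < size (kids P)) (fun t => ln (kappa t)) (etype m0 P i).
  suff EP (P : pt k.+2) : q P * ln (w (ord P)) = q P * ln (ordlaw q1 (ord (tr P))) +
      q P * \sum_(i < size (kids P)) (fun t => ln (kappa t)) (etype m0 P i).
    by rewrite -big_split; apply: eq_bigr => P _; exact: EP.
  rewrite -mulrDr.
  have [->|qP] := eqVneq (q P) 0; first by rewrite !mul0r.
  have qP0 : 0 < q P by rewrite lt_neqAle eq_sym qP q0.
  have k0 (i : 'I_(size (kids P))) : 0 < kappa (etype m0 P i) by exact: kappa_gt0.
  rewrite w_ord lnM ?posrE ?mu1_gt0 //; last exact: prodr_gt0.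
  by rewrite ln_prod.
rewrite E (sum_plaw m0 q d0 (fun t => ln (kappa t))) in H.
rewrite -(sum_push (@tr M D k.+1) q (fun P => ln (ordlaw q1 (ord P)))) in H.
rewrite -(sum_push (@ord M D k) q1 (fun o => ln (ordlaw q1 o))) in H.
have E2 : \sum_t p' t * ln (kappa t) =
    \sum_t p' t * ln (p' t) - \sum_t p' t * ln (pm (h t)).
  rewrite -sumrB; apply: eq_bigr => t _.
  have [->|pt'] := eqVneq (p' t) 0; first by rewrite !mul0r subr0.
  have pt0 : 0 < p' t by rewrite lt_neqAle eq_sym pt' p0.
  by rewrite -mulrBr /kappa ln_div ?posrE // push_gt0.
rewrite E2 -(sum_push h p' (fun u => ln (pm u))) -/pm in H.
by rewrite /ent; move: H; set a := \sum_o _; set b := \sum_o _; lra.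
Qed.

Hypothesis psym : forall t, p' (swap t) = p' t.

(* Strong subadditivity: the pair (t.1, t.2) is compared with the law under
   which its two parts are independent given their truncations. *)
Let submod : ent p' + ent (push u2 p') <= 2 * ent pm.
Proof.
pose pm2 := push h2 p'; pose p2 := push u2 p'.
have pm20 t : 0 <= pm2 t by exact: push_ge0.
have p20 t : 0 <= p2 t by exact: push_ge0.
have H : \sum_t p' t * ln (pm (h t) * pm2 (h2 t) / p2 (u2 t)) <= \sum_t p' t * ln (p' t).
  apply: gibbs => //.
  - by move=> t; rewrite divr_ge0 ?mulr_ge0.
  - by move=> t pt'; rewrite divr_gt0 ?mulr_gt0 // push_gt0.
  rewrite -(sum_push1 u2 p') (partition_big u2 predT) //=; apply: ler_sum => -[a0 b0] _.
  have -> : \sum_(t | u2 t == (a0, b0)) pm (h t) * pm2 (h2 t) / p2 (u2 t) =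
     (\sum_(a | ctr a == a0) pm (a, b0)) * (\sum_(b | ctr b == b0) pm2 (a0, b)) / p2 (a0, b0).
    rewrite big_distrlr /= pair_big_dep /= mulr_suml; apply: eq_big => [[a b]|[a b]] /=.
      by rewrite /u2 xpair_eqE.
    by move=> /eqP[<- <-].
  have -> : \sum_(a | ctr a == a0) pm (a, b0) = p2 (a0, b0).
    rewrite /p2 /push (partition_big h (fun u => (ctr u.1 == a0) && (u.2 == b0))) /=.
      rewrite -(pair_big_dep (fun a => ctr a == a0) (fun _ b => b == b0)
        (fun a b => \sum_(t | (u2 t == (a0, b0)) && (h t == (a, b))) p' t)) /=.
      apply: eq_bigr => a /eqP aE; rewrite big_pred1_eq /pm /push.
      apply: eq_bigl => t; apply/esym/andb_idl => /eqP ht.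
      have t1 : t.1 = a := congr1 fst ht; have t2 : ctr t.2 = b0 := congr1 snd ht.
      by rewrite /u2 t1 t2 aE.
    move=> t /eqP ut; have u1 : ctr t.1 = a0 := congr1 fst ut.
    have u22 : ctr t.2 = b0 := congr1 snd ut.
    by rewrite /h u1 u22 !eqxx.
  have -> : \sum_(b | ctr b == b0) pm2 (a0, b) = p2 (a0, b0).
    rewrite /p2 /push (partition_big h2 (fun u => (u.1 == a0) && (ctr u.2 == b0))) /=.
      rewrite -(pair_big_dep (fun a => a == a0) (fun _ b => ctr b == b0)
        (fun a b => \sum_(t | (u2 t == (a0, b0)) && (h2 t == (a, b))) p' t)) /=.
      rewrite big_pred1_eq; apply: eq_bigr => b /eqP bE; rewrite /pm2 /push.
      apply: eq_bigl => t; apply/esym/andb_idl => /eqP ht.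
      have t1 : ctr t.1 = a0 := congr1 fst ht; have t2 : t.2 = b := congr1 snd ht.
      by rewrite /u2 t1 t2 bE.
    move=> t /eqP ut; have u1 : ctr t.1 = a0 := congr1 fst ut.
    have u22 : ctr t.2 = b0 := congr1 snd ut.
    by rewrite /h2 u1 u22 !eqxx.
  have [->|pn] := eqVneq (p2 (a0, b0)) 0; first by rewrite !mul0r.
  by rewrite mulfK.
have E : \sum_t p' t * ln (pm (h t) * pm2 (h2 t) / p2 (u2 t)) =
   \sum_t p' t * ln (pm (h t)) + \sum_t p' t * ln (pm2 (h2 t)) -
   \sum_t p' t * ln (p2 (u2 t)).
  suff Et t : p' t * ln (pm (h t) * pm2 (h2 t) / p2 (u2 t)) =
      p' t * ln (pm (h t)) + p' t * ln (pm2 (h2 t)) - p' t * ln (p2 (u2 t)).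
    by rewrite -big_split -sumrB; apply: eq_bigr => t _; exact: Et.
  have [->|pt'] := eqVneq (p' t) 0; first by rewrite !mul0r subr0 addr0.
  have pt0 : 0 < p' t by rewrite lt_neqAle eq_sym pt' p0.
  rewrite -mulrDr -mulrBr ln_div ?posrE ?mulr_gt0 ?push_gt0 //.
  by rewrite lnM ?posrE ?push_gt0.
(* The symmetry of [p'] exchanges the two one-sided truncations. *)
have E2 : \sum_t p' t * ln (pm2 (h2 t)) = \sum_t p' t * ln (pm (h t)).
  rewrite (reindex_inj (inv_inj (@swapK _))) /=; apply: eq_bigr => t _.
  rewrite psym; congr (_ * ln _); rewrite /pm2 /pm /push.
  rewrite (reindex_inj (inv_inj (@swapK _))) /=; apply: eq_big => x; last by rewrite psym.
  by case: x t => x y [a b]; rewrite /h2 /h /swap /= !xpair_eqE andbC.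
rewrite E E2 in H.
rewrite -(sum_push h p' (fun u => ln (pm u))) -/pm in H.
rewrite -(sum_push u2 p' (fun u => ln (p2 u))) -/p2 in H.
by rewrite /ent; move: H; set a := \sum_u _; set b := \sum_t _; set c := \sum_u _; lra.
Qed.

(** [ent_step] leaves [d / 2 * (ent p' - 2 * ent pm)], and [submod] bounds this by [- (d / 2)] times
    the entropy of the law truncated on both sides. *)
Lemma entropy_decreases :
  ent (ordlaw q) - d / 2 * ent p' <=
  ent (ordlaw q1) - d / 2 * ent (plaw m0 d q1).
Proof.
have -> : ent (plaw m0 d q1) = ent (push u2 p').
  by rewrite /ent; congr (- _); apply: eq_bigr => t _; rewrite plaw_tr.
have H : d / 2 * (ent p' + ent (push u2 p')) <= d / 2 * (2 * ent pm).
  by rewrite ler_wpM2l // divr_ge0 // ltW.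
apply: le_trans (lerB ent_step (lexx _)) _.
by move: H; set a := ent p'; set b := ent (push u2 p'); set c := ent pm; lra.
Qed.

End entropy_decreases.

(** * Random labelings of trees *)

Section swap_invariance.
Variables (M : finType) (D : nat) (X : Type).
Local Notation pt := (ptree M D).

(** Invariance under transposing two adjacent siblings anywhere in the tree; the second clause
    reaches below the root by fixing everything outside one branch. *)
Fixpoint swap_inv k : (pt k -> X) -> Prop :=
  match k return (pt k -> X) -> Prop with
  | 0 => fun _ => True
  | k'.+1 => fun F =>
     (forall c l1 x y l2, (size (l1 ++ [:: x, y & l2]) <= D)%N ->
        F (node c (l1 ++ [:: x, y & l2])) = F (node c (l1 ++ [:: y, x & l2]))) /\
     (forall c l1 l2, (size l1 + size l2 < D)%N ->
        @swap_inv k' (fun x => F (node c (l1 ++ x :: l2))))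
  end.

Lemma swap_inv_perm k (F : pt k.+1 -> X) c (l0 l l' : seq (pt k)) :
  swap_inv F -> (size (l0 ++ l) <= D)%N -> perm_eq l l' ->
  F (node c (l0 ++ l)) = F (node c (l0 ++ l')).
Proof.
move=> [FS _]; elim: l l0 l' => [|x l IH] l0 l' sl ll'.
  by have /perm_size/esym/size0nil -> := ll'.
have xl' : x \in l' by rewrite -(perm_mem ll') mem_head.
case/splitPr: xl' ll' => a b ll'.
have mv (a' b' : seq (pt k)) : (size (l0 ++ a' ++ x :: b') <= D)%N ->
    F (node c (l0 ++ a' ++ x :: b')) = F (node c (l0 ++ x :: a' ++ b')).
  elim/last_ind: a' b' => [//|a' y IHa] b' sab.
  rewrite cat_rcons catA FS -?catA ?IHa //; last by move: sab; rewrite cat_rcons.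
    by rewrite cat_rcons.
  by move: sab; rewrite cat_rcons !size_cat /=.
have ss := perm_size ll'.
rewrite mv; last by move: sl; rewrite !size_cat ss size_cat.
rewrite -[in LHS]cat_rcons (IH _ (a ++ b)) ?cat_rcons //.
by rewrite -(perm_cons x) (permPl ll') -cat1s perm_catCA.
Qed.

(** Adjacent transpositions first bring the children of the root into the order in which their
    canonical forms agree with those of [Q]; then the children are replaced one at a time by
    induction. *)
Lemma swap_inv_canon k (F : pt k -> X) : swap_inv F ->
  forall P Q, canon P = canon Q -> F P = F Q.
Proof.
elim: k F => [|k IH] F FS P Q; first by move=> /= ->.
move=> /canon_eqP[cPQ]; rewrite perm_sym => PQ.
have [pt0 _|nk] := pickP (fun x : pt k => true); last first.
  have nil (l : seq (pt k)) : l = [::] by case: l => // x; have := nk x.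
  by congr F; apply: ptree_eqP => //; rewrite [LHS]nil [RHS]nil.
move: PQ => /(perm_iotaP pt0)[Is]; rewrite size_map => pIs E.
pose l := map (nth pt0 (kids P)) Is.
have lP : perm_eq (kids P) l by rewrite perm_sym; apply/(perm_iotaP pt0); exists Is.
have lQ : map (@canon M D k) l = map (@canon M D k) (kids Q).
  rewrite E /l -map_comp; apply/eq_in_map => i.
  by rewrite (perm_mem pIs) mem_iota add0n /= => iP; rewrite (nth_map pt0).
have sP : (size ([::] ++ kids P) <= D)%N by exact: size_kids.
rewrite -(nodeK P) -(nodeK Q) -cPQ.
have := @swap_inv_perm k F (rootc P) [::] (kids P) l FS sP lP; rewrite !cat0s => ->.
rewrite -[l]cat0s -[kids Q]cat0s.
have ctx l0 (u u' : seq (pt k)) : (size (l0 ++ u) <= D)%N ->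
    map (@canon M D k) u = map (@canon M D k) u' ->
    F (node (rootc P) (l0 ++ u)) = F (node (rootc P) (l0 ++ u')).
  elim: u l0 u' => [|x u IHu] l0 [|x' u'] //= sx [xx' uu'].
  rewrite -[in RHS]cat_rcons -(IHu _ _ _ uu'); last first.
    by move: sx; rewrite !size_cat size_rcons /=; lia.
  rewrite cat_rcons; case: FS => _ /(_ (rootc P) l0 u) FS.
  apply: (IH (fun x => F (node (rootc P) (l0 ++ x :: u)))) => //; apply: FS.
  by move: sx; rewrite size_cat /=; lia.
by apply: ctx => //; rewrite cat0s -(perm_size lP) size_kids.
Qed.

End swap_invariance.

Lemma swap_inv_ext (M : finType) D X k (F G : ptree M D k -> X) :
  F =1 G -> swap_inv F -> swap_inv G.
Proof. by move=> /funext ->. Qed.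

Lemma swap_inv_sum (M : finType) D k (I : Type) (r : seq I)
    (F : I -> ptree M D k -> nat) :
  (forall i, swap_inv (F i)) -> swap_inv (fun x => \sum_(i <- r) F i x)%N.
Proof.
elim: k F => [//|k IH] F FS; split=> [c l1 x y l2 sl|c l1 l2 sl].
  by apply: eq_bigr => i _; have [H _] := FS i; exact: H.
by apply: (IH (fun i x => F i (node c (l1 ++ x :: l2)))) => i;
  have [_ H] := FS i; exact: H.
Qed.

(** * Breadth-first search and exchanges of siblings *)

Section bfs_facts.
Variables (T : eqType) (e : rel T) (V : seq T) (v : T).
Hypotheses (uV : uniq V) (vV : v \in V).
Local Notation s := (explored e V v).

Lemma bfs_uniq k : uniq (unzip1 (bfs e V v k)) /\ {subset unzip1 (bfs e V v k) <= V}.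
Proof.
elim: k => [|k [IHu IHs]] /=; first by split => // y; rewrite inE => /eqP ->.
case: (onth _ k) => [[x w]|] //; set ys := [seq y <- _ | _].
rewrite /unzip1 map_cat -!/(unzip1 _) unzip1_zip ?size_map ?size_iota //; split.
  rewrite cat_uniq IHu filter_uniq // andbT /=; apply/hasPn => y.
  by rewrite mem_filter => /andP[/andP[]].
move=> y; rewrite mem_cat => /orP[/IHs //|].
by rewrite mem_filter => /andP[].
Qed.

Lemma size_explored : (size s <= size V)%N.
Proof.
have [u1 s1] := bfs_uniq (size V).
by rewrite -(size_map fst s); exact: uniq_leq_size.
Qed.

Lemma explored_uniq2 : uniq (unzip2 s).
Proof.
have [A _ _ _] := bfsP e V v (size V).
apply: sorted_uniq A; first exact: explore_lt_trans.
by move=> x; rewrite /explore_lt eqxx.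
Qed.

Lemma explored_root : (v, [::]) \in s.
Proof.
by rewrite /explored; have [_ [s' ->] _ _] := bfsP e V v (size V); exact: mem_head.
Qed.

Lemma explored_inj1 p q : p \in s -> q \in s -> p.1 = q.1 -> p = q.
Proof.
move=> ps qs pq; have [u1 _] := bfs_uniq (size V).
rewrite -(nth_index p ps) -(nth_index p qs); congr nth; apply/eqP.
rewrite -(nth_uniq v _ _ u1) ?size_map ?index_mem //.
by rewrite !(nth_map p) ?index_mem // !nth_index // pq.
Qed.

Lemma explored_inj2 p q : p \in s -> q \in s -> p.2 = q.2 -> p = q.
Proof.
move=> ps qs pq; have u2 := explored_uniq2.
rewrite -(nth_index p ps) -(nth_index p qs); congr nth; apply/eqP.
rewrite -(nth_uniq [::] _ _ u2) ?size_map ?index_mem //.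
by rewrite !(nth_map p) ?index_mem // !nth_index // pq.
Qed.

Lemma explored_closed p y : p \in s -> y \in V -> e p.1 y -> y \in unzip1 s.
Proof.
move=> ps yV py; have [_ _ C _] := bfsP e V v (size V).
apply: (C (index p s) y) => //; rewrite ?nth_index ?index_mem //.
by apply: leq_trans size_explored; rewrite index_mem.
Qed.

End bfs_facts.

Section bfs_graph_facts.
Variables (T : eqType) (M : finType) (e : rel T) (e_sym : symmetric e)
  (e_irr : irreflexive e) (V : seq T) (f : T -> M) (v : T).
Hypotheses (uV : uniq V) (vV : v \in V).
Local Notation s := (explored e V v).
Local Notation h := (bfs_graph e_sym e_irr V f v).

Lemma color_bfs x w : (x, w) \in s -> color h w = Some (f x).
Proof.
move=> xs /=; case E : [seq p <- s | p.2 == w] => [|p l].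
  have : (x, w) \in [seq p <- s | p.2 == w] by rewrite mem_filter /= eqxx.
  by rewrite E.
have : p \in [seq p <- s | p.2 == w] by rewrite E mem_head.
rewrite mem_filter => /andP[/eqP pw ps] /=.
by rewrite (explored_inj2 ps xs pw).
Qed.

Lemma vert_bfs w : vert h w <-> exists x, (x, w) \in s.
Proof.
split=> [|[x xs]]; last by rewrite /vert /mkset (color_bfs xs).
rewrite /vert /mkset /=; case E : [seq p <- s | p.2 == w] => [//|[x w'] l] _.
have : (x, w') \in [seq p <- s | p.2 == w] by rewrite E mem_head.
by rewrite mem_filter /= => /andP[/eqP <- ps]; exists x.
Qed.

Lemma adj_bfs x w x' w' : (x, w) \in s -> (x', w') \in s -> adj h w w' = e x x'.
Proof.
move=> xs xs'; apply/hasP/idP => [[p ps /hasP[q qs /and3P[/eqP pw /eqP qw]]]|ex].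
  by rewrite (explored_inj2 ps xs pw) (explored_inj2 qs xs' qw).
by exists (x, w) => //; apply/hasP; exists (x', w') => //=; rewrite !eqxx.
Qed.

End bfs_graph_facts.

Lemma parentP (x y : label) : reflect (exists j, y = rcons x j) (parent x y).
Proof.
apply: (iffP andP) => [[/prefixP[s ->]]|[j ->]].
  rewrite size_cat -addn1 eqn_add2l; case: s => [//|j [|//]] _.
  by exists j; rewrite cats1.
by rewrite size_rcons -cats1 prefix_prefix.
Qed.

Lemma parent_uniq (x x' y : label) : parent x y -> parent x' y -> x = x'.
Proof. by move=> /parentP[j ->] /parentP[j' /rcons_inj[]]. Qed.

Lemma parent_prefix (x y z : label) : parent x y -> prefix y z -> prefix x z /\ z != x.
Proof.
move=> /parentP[j ->] /prefixP[s ->]; rewrite cat_rcons prefix_prefix; split => //.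
by apply/eqP => /(congr1 size); rewrite size_cat /=; lia.
Qed.

Lemma prefix_same_size (y y' z : label) : size y = size y' -> prefix y z ->
  prefix y' z -> y = y'.
Proof.
by move=> s; rewrite !prefixE => /eqP E /eqP E'; rewrite -E s E'.
Qed.

Lemma parent_size (x y : label) : parent x y -> size y = (size x).+1.
Proof. by move=> /andP[_ /eqP]. Qed.

Section sibling_swap.
Variables (M : finType) (D : nat) (f : label -> M).
Local Notation pt := (ptree M D).

(** The plane tree read by a breadth-first search of a tree when [s] breaks the ties. *)
Fixpoint pls k (s : seq label) (x : label) : pt k :=
  match k return pt k with
  | 0 => f x
  | k'.+1 => node (f x) [seq pls k' s y | y <- s & parent x y]
  end.

Definition sw (u u' t : label) := if t == u then u' else if t == u' then u else t.

Lemma swK u u' : involutive (sw u u').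
Proof.
move=> t; rewrite /sw; case: (eqVneq t u) => [->|tu].
  by rewrite eqxx; case: eqVneq.
by case: (eqVneq t u') => [->|tu']; rewrite ?eqxx // (negbTE tu) (negbTE tu').
Qed.

(** Exchanges two consecutive children of [z] in the order [s]. It is an involution on orders and
    transposes two siblings in the plane tree; when [j] is out of range, it does nothing. *)
Definition swapch z j (s : seq label) :=
  let c := [seq y <- s | parent z y] in
  if (j.+1 < size c)%N then map (sw (nth [::] c j) (nth [::] c j.+1)) s else s.

Lemma swapch_perm z j s : uniq s -> perm_eq (swapch z j s) s.
Proof.
move=> us; rewrite /swapch; case: ifP => // jc; set c := [seq _ <- _ | _] in jc *.
have cs i : (i < size c)%N -> nth [::] c i \in s.
  by move=> /(mem_nth [::]); rewrite mem_filter => /andP[].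
have sws t : t \in s -> sw (nth [::] c j) (nth [::] c j.+1) t \in s.
  move=> ts; rewrite /sw; case: ifP => _; first exact: cs.
  by case: ifP => _ //; apply: cs; exact: ltnW.
apply: uniq_perm => //; first by rewrite (map_inj_uniq (inv_inj (@swK _ _))).
move=> t; apply/mapP/idP => [[u us' ->]|ts]; first exact: sws.
by exists (sw (nth [::] c j) (nth [::] c j.+1) t); [exact: sws|rewrite swK].
Qed.

Lemma filter_swapch x z j s : x != z ->
  [seq y <- swapch z j s | parent x y] = [seq y <- s | parent x y].
Proof.
move=> xz; rewrite /swapch; case: ifP => // jc; set c := [seq _ <- _ | _] in jc *.
have nx i : (i < size c)%N -> parent x (nth [::] c i) = false.
  move=> /(mem_nth [::]); rewrite mem_filter => /andP[zc _].
  by apply/negP => /parent_uniq/(_ zc)/eqP; exact/negP.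
have n1 := nx _ jc; have n0 := nx _ (ltnW jc).
rewrite filter_map (@eq_filter _ _ (parent x)) => [|t /=]; last first.
  rewrite /sw; case: eqVneq => [->|_]; first by rewrite n0 n1.
  by case: eqVneq => [->|_] //; rewrite n0 n1.
rewrite -[RHS]map_id; apply/eq_in_map => t; rewrite mem_filter => /andP[xt _].
rewrite /sw; case: eqP => [tE|_]; first by move: xt; rewrite tE n0.
by case: eqP => [tE|_] //; move: xt; rewrite tE n1.
Qed.

Lemma filter_swapch_same z s c1 u u' c2 : uniq s ->
  [seq y <- s | parent z y] = c1 ++ [:: u, u' & c2] ->
  [seq y <- swapch z (size c1) s | parent z y] = c1 ++ [:: u', u & c2].
Proof.
move=> us cE.
have n0 : nth [::] (c1 ++ [:: u, u' & c2]) (size c1) = u by rewrite nth_cat ltnn subnn.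
have n1 : nth [::] (c1 ++ [:: u, u' & c2]) (size c1).+1 = u'.
  by rewrite nth_cat ltnNge leqnSn /= subSnn.
rewrite /swapch cE n0 n1 ifT; last by rewrite size_cat /=; lia.
have uc : uniq (c1 ++ [:: u, u' & c2]) by rewrite -cE filter_uniq.
have pc t : t \in c1 ++ [:: u, u' & c2] -> parent z t.
  by rewrite -cE mem_filter => /andP[].
have pu : parent z u by apply: pc; rewrite mem_cat inE eqxx orbT.
have pu' : parent z u' by apply: pc; rewrite mem_cat !inE eqxx !orbT.
rewrite filter_map (@eq_filter _ _ (parent z)) => [|t /=]; last first.
  by rewrite /sw; case: eqVneq => [->|_]; [rewrite pu pu'|case: eqVneq => [->|_] //; rewrite pu pu'].
rewrite cE map_cat /=.
move: uc; rewrite cat_uniq => /and3P[_ /hasPn hc /= /and3P[]].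
rewrite inE negb_or => /andP[uu' uc2] u'c2 _.
have uc1 : u \notin c1 by apply: hc; rewrite inE eqxx.
have u'c1 : u' \notin c1 by apply: hc; rewrite !inE eqxx orbT.
have fixl (l : seq label) : u \notin l -> u' \notin l -> map (sw u u') l = l.
  move=> ul u'l; rewrite -[RHS]map_id; apply/eq_in_map => t tl; rewrite /sw.
  case: eqP => [tE|_]; first by move: ul; rewrite -tE tl.
  by case: eqP => [tE|_] //; move: u'l; rewrite -tE tl.
by rewrite !fixl // /sw eqxx eq_sym (negbTE uu') eqxx.
Qed.

Lemma swapchK z j s : uniq s -> swapch z j (swapch z j s) = s.
Proof.
move=> us; have [jc|jc] := boolP (j.+1 < size [seq y <- s | parent z y])%N; last first.
  by rewrite /swapch (negbTE jc) (negbTE jc).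
set c := [seq _ <- _ | _] in jc.
pose u := nth [::] c j; pose u' := nth [::] c j.+1.
have cE : c = take j c ++ [:: u, u' & drop j.+2 c].
  by rewrite -!drop_nth ?cat_take_drop // ltnW.
have sj : size (take j c) = j by rewrite size_take ltnW.
have E := filter_swapch_same us cE; rewrite sj in E.
rewrite {1}/swapch E ifT; last first.
  have := congr1 size cE; rewrite !size_cat /= => sE; by move: jc; rewrite sE.
have n0 : nth [::] (take j c ++ [:: u', u & drop j.+2 c]) j = u'.
  by rewrite nth_cat sj ltnn subnn.
have n1 : nth [::] (take j c ++ [:: u', u & drop j.+2 c]) j.+1 = u.
  by rewrite nth_cat sj ltnNge leqnSn /= subSnn.
rewrite n0 n1.
rewrite /swapch -/c jc -/u -/u' -map_comp -[RHS]map_id.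
apply/eq_in_map => t _ /=; rewrite -[RHS](swK u u').
by rewrite /sw; case: (eqVneq _ u') => [->|tu']; case: (eqVneq _ u) => // ->.
Qed.

Lemma pls_swapch k s y z j : ~~ prefix y z -> pls k (swapch z j s) y = pls k s y.
Proof.
elim: k y => [//|k IH] y yz /=.
have yz' : y != z by apply: contraNneq yz => ->; exact: prefix_refl.
rewrite filter_swapch //; congr node; apply/eq_in_map => t.
rewrite mem_filter => /andP[yt _]; apply: IH; apply: contra yz => tz.
by have [] := parent_prefix yt tz.
Qed.

Lemma node_eqE k a (m : seq (pt k)) c l : (0 < size l <= D)%N ->
  (node a m == node c l) = [&& a == c, (size m <= D)%N & m == l].
Proof.
move=> /andP[l0 lD]; apply/eqP/and3P => [E|[/eqP -> _ /eqP ->] //].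
have aE : a = c := congr1 (@rootc _ _ _) E.
have := congr1 (@kids _ _ _) E; rewrite [RHS]kids_nodeT // kids_node.
by case: ifP => [_ ->|_ lE]; [rewrite aE|move: l0; rewrite -lE].
Qed.

Lemma count_inj (L : seq (seq label)) (a b : pred (seq label)) g : uniq L ->
  (forall s, s \in L -> a s -> (g s \in L) && b (g s)) ->
  {in L &, injective g} -> (count a L <= count b L)%N.
Proof.
move=> uL ab gi; rewrite -!size_filter -(size_map g).
apply: uniq_leq_size; last first.
  move=> _ /mapP[s + ->]; rewrite mem_filter => /andP[sa sL].
  by rewrite mem_filter andbC ab.
rewrite map_inj_in_uniq ?filter_uniq // => s s'; rewrite !mem_filter.
by move=> /andP[_ sL] /andP[_ s'L]; exact: gi.
Qed.

Variable V : seq label.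
Hypothesis uV : uniq V.

(** [Sc] carries the conditions on the rest of the tree and only has to survive exchanges inside the
    subtree of [x]; this generality makes the induction work. At [x] itself [swapch] maps one set of
    orders injectively into the other; deeper, the count is split by the child of [x] that fills the
    hole. *)
Lemma count_pls_swap_inv k x (Sc : pred (seq label)) :
  (forall z j s, perm_eq s V -> prefix x z -> Sc (swapch z j s) = Sc s) ->
  swap_inv (fun P : pt k => count (fun s => Sc s && (pls k s x == P)) (permutations V)).
Proof.
elim: k x Sc => [//|k IH] x Sc ScJ; split=> [c l1 X Y l2 sl|c l1 l2 sl].
  have half X' Y' : (size (l1 ++ [:: X', Y' & l2]) <= D)%N ->
    (count (fun s => Sc s && (pls k.+1 s x == node c (l1 ++ [:: X', Y' & l2]))) (permutations V)
    <= count (fun s => Sc s && (pls k.+1 s x == node c (l1 ++ [:: Y', X' & l2]))) (permutations V))%N.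
    move=> sl'; have szp A B : (0 < size (l1 ++ [:: A, B & l2]) <= D)%N.
      by move: sl'; rewrite !size_cat /= addnS.
    apply: (@count_inj _ _ _ (swapch x (size l1))).
    - exact: permutations_uniq.
    - move=> s; rewrite mem_permutations => sV; have us : uniq s by rewrite (perm_uniq sV).
      move=> /andP[Scs]; rewrite /= !node_eqE //.
      rewrite !size_map => /and3P[fx sc /eqP chE].
      rewrite mem_permutations (perm_trans (swapch_perm _ _ us) sV) ScJ ?prefix_refl // Scs fx /=.
      set ch := [seq _ <- _ | _] in chE sc.
      have sch : size ch = (size l1 + (size l2).+2)%N by rewrite -(size_map (pls k s)) chE size_cat.
      have [c1 [u [u' [c2 [chc sc1]]]]] : exists c1 u u' c2,
          ch = c1 ++ [:: u, u' & c2] /\ size c1 = size l1.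
        exists (take (size l1) ch), (nth [::] ch (size l1)), (nth [::] ch (size l1).+1),
          (drop (size l1).+2 ch); rewrite size_take sch.
        by rewrite -!drop_nth ?sch ?cat_take_drop; try lia; split => //; rewrite ifT //; lia.
      rewrite -sc1 (filter_swapch_same us chc).
      have -> : size (c1 ++ [:: u', u & c2]) = size ch by rewrite chc !size_cat.
      rewrite sc /=.
      have E t : t \in ch -> pls k (swapch x (size c1) s) t = pls k s t.
        rewrite mem_filter => /andP[xt _]; apply: pls_swapch.
        by apply/negP => /(parent_prefix xt)[_]; rewrite eqxx.
      rewrite (@eq_in_map _ _ _ (pls k s) _).1; last first.
        move=> t tc; apply: E; rewrite chc; move: tc; rewrite !mem_cat !inE.
        by case/or4P => -> //; rewrite ?orbT.
      move: chE; rewrite chc !map_cat /= => /eqP; rewrite !eqseq_cat ?size_map // !eqseq_cons.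
      by move=> /andP[-> /and3P[-> -> ->]].
    - move=> s s'; rewrite !mem_permutations => sV s'V E.
      rewrite -(@swapchK x (size l1) s) ?(perm_uniq sV) // E swapchK //.
      by rewrite (perm_uniq s'V).
  apply/eqP; rewrite eqn_leq half // half //.
  by move: sl; rewrite !size_cat.
pose ch s := [seq y <- s | parent x y].
(* The hole of the context is filled by [y], and the siblings of [y] have the subtrees [l1] and
   [l2]. *)
pose Sy y s := [&& Sc s, f x == c, (size (ch s) <= D)%N, (size l1 < size (ch s))%N &
  [&& nth [::] (ch s) (size l1) == y, map (pls k s) (take (size l1) (ch s)) == l1 &
      map (pls k s) (drop (size l1).+1 (ch s)) == l2]].
apply: (@swap_inv_ext _ _ _ _ (fun X => \sum_(y <- V)
   count (fun s => Sy y s && (pls k s y == X)) (permutations V))%N); last first.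
  apply: swap_inv_sum => y; apply: IH => z j s sV yz.
  have [xy|nxy] := boolP (parent x y); last first.
    suff H s' : Sy y s' = false by rewrite !H.
    apply/negP => /and5P[_ _ _ sc /and3P[/eqP nE _ _]].
    by move: (mem_nth [::] sc); rewrite nE mem_filter (negbTE nxy).
  have [xz zx] := parent_prefix xy yz.
  rewrite eq_sym in zx; rewrite /Sy /ch ScJ // filter_swapch // -/(ch s).
  have uch : uniq (ch s) by rewrite filter_uniq // (perm_uniq sV).
  case: (Sc s) => //=; case: (f x == c) => //=; case: (_ <= D)%N => //=.
  case: ltnP => //= sc; case: (nth [::] (ch s) (size l1) =P y) => //= nE.
  have E t : t \in ch s -> t != y -> pls k (swapch z j s) t = pls k s t.
    rewrite mem_filter => /andP[xt _] ty; apply: pls_swapch; apply: contra ty => tz.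
    by apply/eqP/(prefix_same_size _ tz yz); rewrite (parent_size xt) (parent_size xy).
  have uch' : uniq (take (size l1) (ch s) ++ y :: drop (size l1).+1 (ch s)).
    by rewrite -nE -drop_nth // cat_take_drop.
  move: uch'; rewrite cat_uniq /= negb_or => /and3P[_ /andP[yt _] /andP[yd _]].
  rewrite (@eq_in_map _ _ (pls k (swapch z j s)) (pls k s) (take _ _)).1; last first.
    by move=> t tt; apply: E; [exact: mem_take tt|apply: contraNneq yt => <-].
  rewrite (@eq_in_map _ _ (pls k (swapch z j s)) (pls k s) (drop _ _)).1 //.
  by move=> t tt; apply: E; [exact: mem_drop tt|apply: contraNneq yd => <-].
move=> X; rewrite -[RHS]sum1_count [RHS]big_mkcond /=.
under eq_bigr do rewrite -sum1_count big_mkcond /=.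
rewrite exchange_big /= big_seq [RHS]big_seq; apply: eq_bigr => s.
rewrite mem_permutations => sV.
rewrite node_eqE; last by rewrite size_cat /= addnS.
rewrite size_map -/(ch s).
have [sc|sc] := ltnP (size l1) (size (ch s)); last first.
  rewrite big1 => [|y _]; last by rewrite /Sy ltnNge sc /= !andbF.
  case: ifP => // /andP[_ /and3P[_ _ /eqP /(congr1 size)]].
  by rewrite size_map size_cat /=; lia.
pose y0 := nth [::] (ch s) (size l1).
have y0V : y0 \in V.
  by rewrite -(perm_mem sV); have := mem_nth [::] sc; rewrite mem_filter => /andP[].
rewrite (bigD1_seq y0) //= big1 ?addn0; last first.
  by move=> y; rewrite eq_sym => yy0; rewrite /Sy -/y0 (negbTE yy0) /= !andbF.
rewrite /Sy -/y0 eqxx sc /= -!andbA; congr (if _ then _ else _).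
have -> : ([seq pls k s y | y <- ch s] == l1 ++ X :: l2) =
   [&& map (pls k s) (take (size l1) (ch s)) == l1, pls k s y0 == X &
       map (pls k s) (drop (size l1).+1 (ch s)) == l2].
  rewrite -{1}(cat_take_drop (size l1) (ch s)) (drop_nth [::] sc) map_cat /=.
  by rewrite eqseq_cat ?size_map ?size_take ?sc // eqseq_cons.
by do 5 (case: (X in X && _) => //=); rewrite andbC.
Qed.

Lemma count_pls_canon k x (P Q : pt k) : canon P = canon Q ->
  count (fun s => pls k s x == P) (permutations V) =
  count (fun s => pls k s x == Q) (permutations V).
Proof.
move=> PQ; have := @count_pls_swap_inv k x predT (fun _ _ _ _ _ => erefl).
by move=> /swap_inv_canon/(_ _ _ PQ).
Qed.

End sibling_swap.

(** * Labeled trees as plane trees *)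

Section labeled_trees.
Variables (M : pfinType) (D : nat).
Local Notation pt := (ptree M D).
Implicit Types g : lgraph M.

Definition gcol (g : cgraph M) (x : label) : M := odflt point (color g x).

Definition gnbs g (x : label) : seq label := enum_fset (fset_set [set y | adj g x y]).

Lemma mem_gnbs g x y : (y \in gnbs g x) = adj g x y.
Proof.
have := in_fset_set (bfs_fin (lgraphP g) x) y => /= ->.
by apply/idP/idP; rewrite inE.
Qed.

Lemma gnbs_uniq g x : uniq (gnbs g x).
Proof. exact: fset_uniq. Qed.

Lemma adj_vert g x y : adj g x y -> vert g y.
Proof. by move=> xy; apply: (bfs_vert (lgraphP g)); rewrite (bfs_sym (lgraphP g)); exact: xy. Qed.

Definition nchild g x : nat := count (parent x) (gnbs g x).

(** A finite set of positive integers closed under predecessors down to 1 is an initial segment: the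
    no-gap axiom of labelings becomes a number of children. *)
Lemma mem_initial (js : seq nat) : uniq js -> (forall j, j \in js -> (0 < j)%N) ->
  (forall j, j.+2 \in js -> j.+1 \in js) ->
  forall j, (j \in js) = (0 < j <= size js)%N.
Proof.
move=> ujs j0 jd.
have mP (l : seq nat) j : j \in l -> (j <= foldr maxn 0 l)%N.
  elim: l => //= i l IH; rewrite inE leq_max => /orP[/eqP ->|/IH ->].
    by rewrite leqnn.
  by rewrite orbT.
have mjs (l : seq nat) : (0 < foldr maxn 0 l)%N -> foldr maxn 0%N l \in l.
  elim: l => [//|i l IH] /=; case: (leqP (foldr maxn 0%N l) i) => il _.
    by rewrite inE eqxx.
  by rewrite inE IH ?orbT // (leq_ltn_trans _ il).
pose m := foldr maxn 0%N js.
have down i : (0 < m - i)%N -> (m - i)%N \in js.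
  elim: i => [|i IH] mi; first by by move: mi; rewrite subn0 => /mjs.
  have := IH; case E : (m - i)%N => [|[|j]]; [lia|lia|].
  by move=> /(_ isT)/jd; rewrite (_ : (m - i.+1)%N = j.+1) //; lia.
have E : js =i iota 1 m.
  move=> j; rewrite mem_iota; apply/idP/idP => [jj|jm]; first by rewrite j0 //= add1n ltnS mP.
  by have := down (m - j)%N; rewrite subKn; [apply; lia|lia].
have sm : size js = m.
  by rewrite -(size_iota 1 m); apply/eqP; rewrite -uniq_size_uniq ?iota_uniq // => j; rewrite E.
by move=> j; rewrite E mem_iota sm add1n ltnS.
Qed.

Lemma vert_child g x j : vert g (rcons x j) <-> (0 < j <= nchild g x)%N.
Proof.
pose js := [seq last 0%N y | y <- gnbs g x & parent x y].
have inj : {in [seq y <- gnbs g x | parent x y] &, injective (last 0%N)}.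
  move=> y y'; rewrite !mem_filter => /andP[/parentP[i ->] _] /andP[/parentP[i' ->] _].
  by rewrite !last_rcons => ->.
have jsP i : (i \in js) <-> vert g (rcons x i).
  split=> [/mapP[y + ->]|gi].
    rewrite mem_filter mem_gnbs => /andP[/parentP[i' ->]]; rewrite last_rcons.
    exact: adj_vert.
  have [_ xi] := bfs_parent (lgraphP g) gi.
  apply/mapP; exists (rcons x i); rewrite ?last_rcons // mem_filter mem_gnbs xi andbT.
  by apply/parentP; exists i.
have sjs : size js = nchild g x by rewrite size_map size_filter.
rewrite -sjs -mem_initial //.
- by apply: iff_sym; exact: jsP.
- by rewrite map_inj_in_uniq // filter_uniq // gnbs_uniq.
- by move=> i /jsP gi; have [] := bfs_parent (lgraphP g) gi.
- by move=> i /jsP gi; apply/jsP; exact: (bfs_sibling (lgraphP g) gi).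
Qed.

Lemma nchild_eq g x m : (forall j, vert g (rcons x j) <-> (0 < j <= m)%N) ->
  nchild g x = m.
Proof.
move=> H; have E j : (0 < j <= nchild g x)%N = (0 < j <= m)%N.
  by apply/idP/idP => [/vert_child/H|/H/vert_child].
by have := E m; have := E (nchild g x); lia.
Qed.

Lemma children_perm g x :
  perm_eq [seq y <- gnbs g x | parent x y] [seq rcons x j | j <- iota 1 (nchild g x)].
Proof.
apply: uniq_perm; first by rewrite filter_uniq // gnbs_uniq.
  by rewrite map_inj_uniq ?iota_uniq //; exact: rcons_injr.
move=> y; rewrite mem_filter mem_gnbs; apply/andP/mapP => [[/parentP[j ->] xj]|[j jn ->]].
  exists j => //; have /vert_child := adj_vert xj.
  by rewrite mem_iota add1n ltnS.
split; first by apply/parentP; exists j.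
have gj : vert g (rcons x j) by apply/vert_child; move: jn; rewrite mem_iota add1n ltnS.
by have [] := bfs_parent (lgraphP g) gj.
Qed.

(** The plane tree displayed by the labels. It ignores the edges that do not join a label to its
    offspring, so it describes the ball only when [g] is [treelike] there. *)
Fixpoint plg k g (x : label) : pt k :=
  match k return pt k with
  | 0 => gcol g x
  | k'.+1 => node (gcol g x) [seq plg k' g (rcons x j) | j <- iota 1 (nchild g x)]
  end.

Lemma tr_plg k g x : tr (plg k.+1 g x) = plg k g x.
Proof.
elim: k x => [//|k IH] x.
have -> : plg k.+2 g x =
  node (gcol g x) [seq plg k.+1 g (rcons x j) | j <- iota 1 (nchild g x)] by [].
by rewrite tr_node -map_comp; congr node; apply: eq_map => j; exact: IH.
Qed.

Definition treelike r g := forall x y, (size x <= r)%N -> (size y <= r)%N ->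
  adj g x y -> parent x y \/ parent y x.

Definition lpar (x : label) : option label :=
  if x == [::] then None else Some (take (size x).-1 x).

Lemma lpar_rcons x j : lpar (rcons x j) = Some x.
Proof.
rewrite /lpar; case: eqP => [/(congr1 size)|_]; first by rewrite size_rcons.
by rewrite size_rcons /= -cats1 take_size_cat.
Qed.

Lemma lparP x y : lpar x = Some y <-> parent y x.
Proof.
split=> [|/parentP[j ->]]; last exact: lpar_rcons.
by case/lastP: x => [//|x j]; rewrite lpar_rcons => -[->]; apply/parentP; exists j.
Qed.

Definition lutype k g x y : pt k := utype D (gnbs g) (gcol g) k x y.

(** In a tree-like ball the neighbours of [x] are its parent and its offspring, so a walk that may
    not step to the parent goes down. *)
Lemma canon_plg k r g x : treelike r g -> (size x + k <= r)%N -> vert g x ->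
  canon (plg k g x) = lutype k g x (lpar x).
Proof.
move=> gt; elim: k x => [//|k IH] x xr gx.
apply: canon_node.
have E : [seq y <- gnbs g x | Some y != lpar x] = [seq y <- gnbs g x | parent x y].
  apply: eq_in_filter => y; rewrite mem_gnbs => xy.
  have [||xpy|ypx] := gt x y _ _ xy.
  - by lia.
  - by have := adj_size xy; lia.
  - rewrite xpy; apply/eqP => /esym/lparP ypx.
    by have := parent_size xpy; have := parent_size ypx; lia.
  - have /lparP -> := ypx; rewrite eqxx; apply/esym/negP => xpy.
    by have := parent_size xpy; have := parent_size ypx; lia.
rewrite E.
have -> : map (@canon M D k) [seq plg k g (rcons x j) | j <- iota 1 (nchild g x)] =
    [seq lutype k g z (Some x) | z <- [seq rcons x j | j <- iota 1 (nchild g x)]].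
  rewrite -!map_comp; apply/eq_in_map => j; rewrite mem_iota add1n ltnS => jn /=.
  rewrite IH ?lpar_rcons //; first by rewrite size_rcons; lia.
  exact/vert_child.
have -> : forall l : seq label, map (@canon M D k) [seq gtree D (gnbs g) (gcol g) k z (Some x) | z <- l] =
   [seq lutype k g z (Some x) | z <- l] by move=> l; rewrite -map_comp.
by rewrite perm_sym; apply: perm_map; exact: children_perm.
Qed.

End labeled_trees.

Section bfs_types.
Variables (T : eqType) (M : pfinType) (D : nat) (e : rel T) (e_sym : symmetric e)
  (e_irr : irreflexive e) (V : seq T) (f : T -> M) (v : T) (nb : T -> seq T).
Hypotheses (uV : uniq V) (vV : v \in V) (eV : forall x y, e x y -> y \in V)
  (unb : forall x, uniq (nb x)) (mem_nb : forall x y, (y \in nb x) = e x y).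
Local Notation s := (explored e V v).
Local Notation h := (bfs_graph e_sym e_irr V f v).

(** Sending a label to its vertex is an isomorphism onto the component of [v], whatever the order
    [V]. So the type of the root does not see how ties are broken. *)
Lemma lutype_bfs k : lutype D k h [::] None = utype D nb f k v None.
Proof.
pose phi w := if [seq p <- s | p.2 == w] is p :: _ then p.1 else v.
have phiP x w : (x, w) \in s -> phi w = x.
  move=> xs; rewrite /phi; case E : [seq p <- s | p.2 == w] => [|p l].
    have : (x, w) \in [seq p <- s | p.2 == w] by rewrite mem_filter /= eqxx.
    by rewrite E.
  have : p \in [seq p <- s | p.2 == w] by rewrite E mem_head.
  by rewrite mem_filter => /andP[/eqP pw ps]; rewrite (explored_inj2 ps xs pw).
have vE : phi [::] = v by apply: phiP; exact: explored_root.
suff : utype D nb f k (phi [::]) (omap phi None) = utype D (gnbs h) (gcol h) k [::] None.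
  by rewrite vE.
apply: (@utype_iso M D _ _ (gnbs h) nb (gcol h) f phi (fun w => vert h w)
  (fun _ w => vert h w)) => //.
- move=> w w' /vert_bfs[x xw] /vert_bfs[x' xw'].
  rewrite (phiP _ _ xw) (phiP _ _ xw') => xx'.
  by have := explored_inj1 uV vV xw xw' xx' => -[].
- by move=> _ w /vert_bfs[x xw]; rewrite (phiP _ _ xw) /gcol (color_bfs _ _ _ xw).
- move=> _ w /vert_bfs[x xw]; rewrite (phiP _ _ xw); split; last first.
    by move=> z; rewrite mem_gnbs; exact: adj_vert.
  apply: uniq_perm => //.
    rewrite map_inj_in_uniq ?gnbs_uniq // => w1 w2; rewrite !mem_gnbs.
    move=> /adj_vert/vert_bfs[x1 xw1] /adj_vert/vert_bfs[x2 xw2].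
    rewrite (phiP _ _ xw1) (phiP _ _ xw2) => xx.
    by have := explored_inj1 uV vV xw1 xw2 xx => -[].
  move=> y; rewrite mem_nb; apply/mapP/idP => [[w' + ->]|xy].
    rewrite mem_gnbs => ww'; have /vert_bfs[x' xw'] := adj_vert ww'.
    by rewrite (phiP _ _ xw') -(adj_bfs e_sym e_irr f xw xw').
  have /mapP[[y' w'] yw' /= yE] := explored_closed uV vV xw (eV xy) xy; subst y'.
  exists w'; last by rewrite (phiP _ _ yw').
  by rewrite mem_gnbs (adj_bfs e_sym e_irr f xw yw').
- exact: bfs_root (lgraphP h).
Qed.

End bfs_types.

Section bfs_of_tree.
Variables (M : pfinType) (D : nat) (b : lgraph M) (V s : seq label).
Hypotheses (bt : forall x y, adj b x y -> parent x y \/ parent y x)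
  (uV : uniq V) (VP : forall x, x \in V <-> vert b x) (sV : perm_eq s V).
Local Notation h := (bfs_graph (bfs_sym (lgraphP b)) (bfs_irr (lgraphP b)) s
  (fun x => odflt point (color b x)) [::]).

Let us : uniq s. Proof. by rewrite (perm_uniq sV). Qed.
Let sP x : x \in s <-> vert b x. Proof. by rewrite (perm_mem sV). Qed.
Let rs : [::] \in s. Proof. by apply/sP; exact: bfs_root (lgraphP b). Qed.
Let x0 : label * label := ([::], [::]).
Let ch x := [seq y <- s | parent x y].

Let ch_adj x y : y \in ch x -> adj b x y.
Proof.
rewrite mem_filter => /andP[/parentP[j ->]] /sP yb.
by have [] := bfs_parent (lgraphP b) yb.
Qed.

(** In a tree the undiscovered neighbours of the explored vertex [x] are exactly its offspring: its
    parent was discovered before it, and its offspring can be discovered from [x] only. Hence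
    siblings are numbered in the order [s]. *)
Lemma bfs_tree_inv k : let sk := bfs (adj b) s [::] k in
  (forall m j, (m < k)%N -> (m < size sk)%N -> (j < size (ch (nth x0 sk m).1))%N ->
     (nth [::] (ch (nth x0 sk m).1) j, rcons (nth x0 sk m).2 j.+1) \in sk) /\
  (forall p, p \in sk -> p.1 = [::] \/ exists m j,
     [/\ (m < k)%N, (m < size sk)%N, (j < size (ch (nth x0 sk m).1))%N &
      p = (nth [::] (ch (nth x0 sk m).1) j, rcons (nth x0 sk m).2 j.+1)]).
Proof.
elim: k => [|k [IH1 IH2]] /=; first by split => // p; rewrite inE => /eqP ->; left.
set sk := bfs _ _ _ _ in IH1 IH2 *.
have [usk sks] : uniq (unzip1 sk) /\ {subset unzip1 sk <= s} by exact: bfs_uniq.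
case E : (onth sk k) => [[x w]|]; last first.
  have ks : (size sk <= k)%N by rewrite leqNgt -onthTE E.
  split=> [m j _ ms|p /IH2[->|[m [j [mk ms jm ->]]]]]; first by apply: IH1 => //; exact: leq_trans ms ks.
    by left.
  by right; exists m, j; rewrite ltnS ltnW.
have ks : (k < size sk)%N by rewrite -onthTE E.
have xwE : nth x0 sk k = (x, w) by apply: onth_nth; exact: E.
have xk : x \in unzip1 sk by apply/mapP; exists (x, w); rewrite // -xwE mem_nth.
set ys := [seq y <- s | _].
have disc p : p \in sk -> p.1 != [::] -> exists2 m, (m < k)%N &
    (m < size sk)%N /\ parent (nth x0 sk m).1 p.1.
  move=> /IH2[-> //|[m [j [mk ms jm ->]]]] _; exists m => //; split => //.
  by have := mem_nth [::] jm; rewrite mem_filter => /andP[].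
have ysE : ys = ch x.
  apply: eq_in_filter => y ys'; have [xy|nxy] := boolP (adj b x y); last first.
    rewrite /=; apply/esym/negP => pxy; move/negP: nxy; apply; apply: ch_adj.
    by rewrite mem_filter pxy.
  have [pxy|pyx] := bt xy.
    rewrite pxy /=; apply/mapP => -[p psk yp].
    have [|m mk [ms pm]] := disc p psk.
      by rewrite -yp; apply/eqP => y0; have := parent_size pxy; rewrite y0.
    rewrite -yp in pm; have xm := parent_uniq pm pxy.
    have /eqP : nth [::] (unzip1 sk) m = nth [::] (unzip1 sk) k.
      by rewrite !(nth_map x0) // xm xwE.
    by rewrite nth_uniq ?size_map // => /eqP mk'; move: mk; rewrite mk' ltnn.
  have -> : parent x y = false.
    by apply/negP => pxy; move: (parent_size pxy) (parent_size pyx) => ->; move: (size x) => a; lia.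
  rewrite /=; apply/negbF; move: xk => /mapP[p psk xp].
  have [|m mk [ms pm]] := disc p psk.
    by rewrite -xp; apply/eqP => xe; have := parent_size pyx; rewrite xe.
  rewrite -xp in pm; rewrite (parent_uniq pyx pm).
  by apply/mapP; exists (nth x0 sk m) => //; exact: mem_nth.
rewrite ysE; set new := zip _ _.
have sz : size [seq rcons w j | j <- iota 1 (size (ch x))] = size (ch x).
  by rewrite size_map size_iota.
have newP j : (j < size (ch x))%N -> (nth [::] (ch x) j, rcons w j.+1) \in new.
  move=> jx; have -> : (nth [::] (ch x) j, rcons w j.+1) = nth x0 new j.
    by rewrite /new /x0 nth_zip ?sz // (nth_map 0%N) ?size_iota // nth_iota.
  by apply: mem_nth; rewrite size_zip sz minnn.
have inS i : (i < size sk)%N -> nth x0 (sk ++ new) i = nth x0 sk i.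
  by move=> si; rewrite nth_cat si.
split=> [m j|p].
  rewrite ltnS leq_eqVlt => /orP[/eqP -> _|mk _].
    by rewrite inS // xwE mem_cat => /newP ->; rewrite orbT.
  have ms := ltn_trans mk ks; rewrite inS // => jm.
  by rewrite mem_cat IH1.
rewrite mem_cat => /orP[/IH2[->|[m [j [mk ms jm ->]]]]|pn]; first by left.
  right; exists m, j; rewrite inS // size_cat; split => //; first by rewrite ltnS ltnW.
  by rewrite (leq_trans ms) // leq_addr.
right; exists k, (index p new); have pi : (index p new < size new)%N by rewrite index_mem.
have sn : size new = size (ch x) by rewrite size_zip sz minnn.
rewrite sn in pi; rewrite inS // xwE size_cat; split => //.
  by rewrite (leq_trans ks) // leq_addr.
rewrite -[LHS](nth_index x0 pn) /new /x0 nth_zip ?sz //.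
by rewrite (nth_map 0%N) ?size_iota // nth_iota.
Qed.

Local Notation ex := (explored (adj b) s [::]).

Lemma explored_child x w j : (x, w) \in ex -> (j < size (ch x))%N ->
  (nth [::] (ch x) j, rcons w j.+1) \in ex.
Proof.
move=> xw jx; have [H _] := bfs_tree_inv (size s); have i0 := xw.
rewrite -index_mem in i0.
have is' : (index (x, w) ex < size s)%N.
  by apply: leq_trans i0 _; exact: size_explored.
by have := H _ j is' i0; rewrite nth_index //=; apply.
Qed.

Lemma explored_inv y w : (y, w) \in ex -> y = [::] \/ exists x w' j,
  [/\ (x, w') \in ex, (j < size (ch x))%N, y = nth [::] (ch x) j & w = rcons w' j.+1].
Proof.
have [_ H] := bfs_tree_inv (size s); move=> /H[/= ->|[m [j [_ ms jm [-> ->]]]]]; first by left.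
right; exists (nth x0 ex m).1, (nth x0 ex m).2, j; split => //.
by rewrite -surjective_pairing mem_nth.
Qed.

Lemma nchild_bfs x w : (x, w) \in ex -> nchild h w = size (ch x).
Proof.
move=> xw; apply: nchild_eq => j; split.
  move=> /vert_bfs[y yw]; have [y0|[x' [w' [i [xw' ix yE wE]]]]] := explored_inv yw.
    have := explored_inj1 us rs yw (explored_root _ _ _) y0 => -[_ /(congr1 size)].
    by rewrite size_rcons.
  have [ww' ->] := rcons_inj wE; have := explored_inj2 xw xw' ww' => -[->].
  by rewrite ltnS leq0n.
case: j => [//|j] jx; apply/vert_bfs; exists (nth [::] (ch x) j).
exact: explored_child.
Qed.

Lemma plg_bfs k x w : (x, w) \in ex ->
  plg D k h w = pls D (fun x => odflt point (color b x)) k s x.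
Proof.
have cE y u : (y, u) \in ex -> gcol h u = odflt point (color b y).
  by move=> yu; rewrite /gcol (color_bfs (bfs_sym (lgraphP b)) (bfs_irr (lgraphP b)) _ yu).
elim: k x w => [|k IH] x w xw /=; rewrite (cE _ _ xw) //.
rewrite (nchild_bfs xw); congr node.
apply: (@eq_from_nth _ (pls D (fun x => odflt point (color b x)) k s [::])).
  by rewrite !size_map size_iota.
rewrite size_map size_iota => j jx; rewrite (nth_map 0%N) ?size_iota //.
rewrite (nth_map [::]) // nth_iota // add1n.
by apply: IH; exact: explored_child.
Qed.

Lemma nchild_bfs_le n w : (forall x, vert b x -> (nchild b x <= n)%N) ->
  vert h w -> (nchild h w <= n)%N.
Proof.
move=> bn /vert_bfs[x xw]; rewrite (nchild_bfs xw).
have bx : vert b x.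
  by apply/sP; have [_] := bfs_uniq (adj b) us rs (size s); apply; apply/mapP; exists (x, w).
apply: leq_trans (bn _ bx); rewrite /nchild -size_filter; apply: uniq_leq_size.
  by rewrite filter_uniq.
move=> y yx; rewrite mem_filter mem_gnbs ch_adj // andbT.
by move: yx; rewrite mem_filter => /andP[].
Qed.

Lemma bfs_treelike w w' : adj h w w' -> parent w w' \/ parent w' w.
Proof.
move=> ww'; have /vert_bfs[x xw] := bfs_vert (lgraphP h) ww'.
have /vert_bfs[x' xw'] := adj_vert ww'.
have H y v y' v' : (y, v) \in ex -> (y', v') \in ex -> parent y y' -> parent v v'.
  move=> yv yv' yy'.
  have [y0|[x1 [w1 [i [xw1 ix yE ->]]]]] := explored_inv yv'.
    by have := parent_size yy'; rewrite y0.
  have x1y' : parent x1 y' by have := mem_nth [::] ix; rewrite -yE mem_filter => /andP[].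
  have := explored_inj1 us rs yv xw1 (parent_uniq yy' x1y') => -[_ ->].
  by apply/parentP; exists i.+1.
move: ww'; rewrite (adj_bfs _ _ _ xw xw') => /bt[xx'|x'x].
  by left; exact: H xw xw' xx'.
by right; exact: H xw' xw x'x.
Qed.

End bfs_of_tree.

(** * Recovering labeled balls from plane trees *)

Section decoding.
Variables (M : pfinType) (D : nat).
Local Notation pt := (ptree M D).
Local Notation pt0 := (pt0 D (point : M)).
Local Notation plg := (plg D).
Implicit Types g h : lgraph M.

Definition tcol k : pt k -> M :=
  match k return pt k -> M with 0 => id | k'.+1 => @rootc M D k' end.

(** The coloring of labels that [P] encodes. It determines [P], which turns the entropy of a labeled
    ball into that of its plane tree. *)
Fixpoint colP k (P : pt k) (x : label) {struct x} : option M :=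
  if x is j :: x' then
    match k return pt k -> option M with
    | 0 => fun=> None
    | k'.+1 => fun P => if (0 < j <= size (kids P))%N
                        then colP (nth (pt0 k') (kids P) j.-1) x' else None
    end P
  else Some (tcol P).

Definition tadj (c : label -> option M) (x y : label) : bool :=
  [&& isSome (c x), isSome (c y) & parent x y || parent y x].

Definition tgraph (c : label -> option M) : cgraph M := CGraph c (tadj c).

Lemma colP_long k (P : pt k) x : (k < size x)%N -> colP P x = None.
Proof.
by elim: k P x => [|k IH] P [|j x] //= kx; case: ifP => // _; exact: IH.
Qed.

Lemma colP_inj k : injective (@colP k).
Proof.
elim: k => [|k IH] P Q PQ; have E x : colP P x = colP Q x by rewrite PQ.
  by have := E [::] => -[].
have sPQ : size (kids P) = size (kids Q).
  have H j : (0 < j <= size (kids P))%N = (0 < j <= size (kids Q))%N.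
    by have := E [:: j] => /=; case: ifP; case: ifP.
  by have := H (size (kids P)); have := H (size (kids Q)); lia.
apply: ptree_eqP; first by have := E [::] => -[].
apply: (@eq_from_nth _ (pt0 k)) => // i iP; apply: IH; apply/funext => x.
by have := E (i.+1 :: x); rewrite /= -sPQ iP.
Qed.

Lemma colP_tr k (P : pt k.+1) x : (size x <= k)%N -> colP (tr P) x = colP P x.
Proof.
elim: k P x => [|k IH] P [|j x] // xk.
rewrite /= -/ptree -/(tr P) kids_tr size_map; case: ifP => // /andP[j0 jP].
by rewrite (nth_map (pt0 k.+1)) ?prednK //; exact: IH.
Qed.

Lemma tcol_side k (Q : pt k.+1) : tcol (side Q 0) = rootc Q.
Proof.
case: k Q => [|k] Q; first by [].
by rewrite /side -[tcol _]/(rootc (tr (node (rootc Q) (delnth 0 (kids Q))))) rootc_tr.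
Qed.

(* In the ball around the edge (o,1), the subtree of the first child keeps the
   label 1, while the other children of the root were renumbered by [side]. *)
Definition edge_col k (t : pt k * pt k) (x : label) : option M :=
  match x with
  | [::] => Some (tcol t.1)
  | 0%N :: _ => None
  | 1%N :: y => colP t.2 y
  | j.+2 :: y => colP t.1 (j.+1 :: y)
  end.

Lemma edge_col_inj k : injective (@edge_col k).
Proof.
move=> [A B] [A' B'] E; have {}E x : edge_col (A, B) x = edge_col (A', B') x by rewrite E.
congr pair; apply: colP_inj; apply/funext => x; last exact: E (1%N :: x).
case: x => [|[|j] x]; [exact: E [::]| |exact: E (j.+2 :: x)].
by case: k A A' {B B' E}.
Qed.

Lemma tgraph_inj : injective tgraph.
Proof. by move=> c c' []. Qed.

Lemma vert_cat g x y : vert g (x ++ y) -> vert g x.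
Proof.
elim/last_ind: y => [|y j IH]; first by rewrite cats0.
rewrite -rcons_cat => /(bfs_parent (lgraphP g))[_ xy].
by apply: IH; exact: (bfs_vert (lgraphP g) xy).
Qed.

Lemma parent_adj g x y : vert g y -> parent x y -> adj g x y.
Proof. by move=> gy /parentP[j yE]; rewrite yE in gy *; have [] := bfs_parent (lgraphP g) gy. Qed.

Definition small_degrees r g := forall x, vert g x -> (size x < r)%N -> (nchild g x <= D)%N.

Lemma color_plg r g k x y : small_degrees r g -> vert g x ->
  (size x + k <= r)%N -> (size y <= k)%N -> color g (x ++ y) = colP (plg k g x) y.
Proof.
move=> gd; elim: k x y => [|k IH] x [|j y] // gx xr yk.
- by rewrite cats0 /= /gcol; move: gx; rewrite /vert /mkset; case: (color g x).
- by rewrite cats0 /= /gcol; move: gx; rewrite /vert /mkset; case: (color g x).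
have gdx : (nchild g x <= D)%N by apply: gd => //; lia.
have kE : kids (plg k.+1 g x) = [seq plg k g (rcons x j) | j <- iota 1 (nchild g x)].
  by rewrite kids_nodeT // size_map size_iota.
have -> : colP (plg k.+1 g x) (j :: y) = if (0 < j <= nchild g x)%N
    then colP (nth (pt0 k) (kids (plg k.+1 g x)) j.-1) y else None.
  by rewrite /= -/(plg k.+1 g x) kE size_map size_iota.
rewrite -cat_rcons; case: ifPn => [jx|njx].
  rewrite kE (nth_map 0%N) ?size_iota; last by lia.
  have -> : nth 0%N (iota 1 (nchild g x)) j.-1 = j by rewrite nth_iota; lia.
  by apply: IH => //; [exact/vert_child|rewrite size_rcons; lia].
have : ~ vert g (rcons x j ++ y) by move=> /vert_cat/vert_child; exact/negP.
by rewrite /vert /mkset; case: (color g _).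
Qed.

Lemma restrP r g : [/\ forall x, color (restr r g) x = if (size x <= r)%N then color g x else None,
  forall x, vert (restr r g) x <-> vert g x /\ (size x <= r)%N &
  forall x y, adj (restr r g) x y = [&& adj g x y, (size x <= r)%N & (size y <= r)%N]].
Proof.
have cE x : color (restr r g) x = if (size x <= r)%N then color g x else None.
  rewrite /= nball_root; case: asboolP => [[_ ->] //|ngx].
  case: ifP => // xr; case E : (color g x) => //; exfalso; apply: ngx.
  by split => //; rewrite /vert /mkset E.
split => //; first by move=> x; rewrite /vert /mkset cE; case: ifP => _; split => // -[].
move=> x y; rewrite /= nball_root; apply/and3P/and3P => [[/asboolP[_ ?] /asboolP[_ ?] ?]|].
  by [].
move=> [xy xr yr]; split => //; apply/asboolP; split => //.
  exact: bfs_vert (lgraphP g) _ _ xy.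
exact: adj_vert xy.
Qed.

Lemma vertex_ball_dec r g : treelike r g -> small_degrees r g ->
  vertex_ball g r = tgraph (colP (plg r g [::])).
Proof.
move=> gt gd; rewrite -[vertex_ball g r]/(lgraph_val (restr r g)).
have [cE _ aE] := restrP r g.
have cE' : color (restr r g) = colP (plg r g [::]).
  apply/funext => x; rewrite cE; case: ifP => xr.
    by rewrite -(color_plg gd (x := [::])) //; exact: bfs_root (lgraphP g).
  by rewrite colP_long // ltnNge xr.
have -> : lgraph_val (restr r g) = CGraph (color (restr r g)) (adj (restr r g)) by [].
rewrite /tgraph -cE'; congr CGraph.
apply/funext => x; apply/funext => y; rewrite aE /tadj !cE.
apply/and3P/and3P => [[xy xr yr]|[]].
  rewrite xr yr; split.
  - exact: bfs_vert (lgraphP g) _ _ xy.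
  - exact: adj_vert xy.
  - by apply/orP; exact: gt.
case: ifP => // xr gx; case: ifP => // yr gy /orP[xy|yx]; split => //.
  exact: parent_adj xy.
by rewrite (bfs_sym (lgraphP g)); exact: parent_adj yx.
Qed.

(** A walk from the label 1 either ends in the subtree of that label, at a depth below it at most
    the length, or has passed through the root and ends at distance less than its length from
    there. *)
Lemma nball_edge k g z : treelike k.+1 g -> vert g [:: 1%N] ->
  nball g [set [::]; [:: 1%N]] k z <->
  vert g z /\ ((size z <= k)%N \/ exists2 w, z = 1%N :: w & (size w <= k)%N).
Proof.
move=> gt g1; split=> [[y [s [ys gy ps sk lz]]]|[gz [zk|[w zE wk]]]].
- have : nball g [set [::]] k z \/ y = [:: 1%N].
    by case: ys => [y0|->]; [left; exists y, s|right].
  case=> [|y1]; first by rewrite nball_root => -[? ?]; split => //; left.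
  subst y z; clear ys.
  have H : forall (t : seq label), path (adj g) [:: 1%N] t -> (size t <= k)%N ->
     vert g (last [:: 1%N] t) /\ ((size (last [:: 1%N] t) <= size t)%N \/
      exists2 w, last [:: 1%N] t = 1%N :: w & (size w <= size t)%N).
    elim/last_ind => [_ _|t x IH]; first by split => //; right; exists [::].
    rewrite rcons_path size_rcons last_rcons => /andP[pt lx] tk.
    have [gl l] := IH pt (ltnW tk); split; first exact: adj_vert lx.
    set u := last _ t in gl l lx.
    have su : (size u <= k)%N by case: l => [|[w -> /=]]; lia.
    have sx := adj_size lx.
    case: l => [ul|[w uE wt]]; first by left; lia.
    have [||/parentP[j ->]|/parentP[j]] := gt u x _ _ lx; [lia|lia| |].
      by right; exists (rcons w j); rewrite ?uE ?size_rcons.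
    rewrite uE; case: x {lx sx} => [|i x] /=; first by left.
    move=> [<- wE]; right; exists x => //.
    by have := congr1 size wE; rewrite size_rcons; lia.
  have [gl l] := H s ps sk; split => //; case: l => [l|[w wE l]]; [left|right].
    exact: leq_trans l sk.
  by exists w => //; exact: leq_trans l sk.
- have : nball g [set [::]] k z by rewrite nball_root.
  by move=> [y [s [ys ? ? ? ?]]]; exists y, s; split => //; left.
subst z; suff [s [ps ss ls]] : exists s, [/\ path (adj g) [:: 1%N] s,
    (size s <= size w)%N & last [:: 1%N] s = 1%N :: w].
  exists [:: 1%N], s; split => //; first by right.
  exact: leq_trans ss wk.
elim/last_ind: w gz {wk} => [|w j IH] gz; first by exists [::].
have gw : vert g (1%N :: w) by apply: (@vert_cat _ _ [:: j]); rewrite /= cats1.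
have [s [ps ss ls]] := IH gw.
exists (rcons s (1%N :: rcons w j)); rewrite last_rcons; split => //; last first.
  by rewrite !size_rcons.
rewrite rcons_path ps ls /=; apply: parent_adj => //.
by apply/parentP; exists j.
Qed.

Lemma edge_ball_dec k g (P := plg k.+1 g [::]) : treelike k.+1 g -> small_degrees k.+1 g ->
  (0 < nchild g [::])%N ->
  edge_ball g k.+1 = tgraph (edge_col (side P 0, nth (pt0 k) (kids P) 0)).
Proof.
move=> gt gd g0.
have gr := bfs_root (lgraphP g).
have g1 : vert g [:: 1%N] by apply/(vert_child g [::] 1).
have gD : (nchild g [::] <= D)%N by exact: gd.
have kE : kids P = [seq plg k g (rcons [::] j) | j <- iota 1 (nchild g [::])].
  by rewrite kids_nodeT // size_map size_iota.
have sP : size (kids P) = nchild g [::] by rewrite kE size_map size_iota.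
(* [side] deletes the first child, so the offspring [j.+2] of the root becomes its child number
   [j.+1]; the truncation is invisible on labels of size at most [k]. *)
have sideE y : (size y <= k)%N -> colP (side P 0) y = colP (node (rootc P) (behead (kids P))) y.
  by move=> yk; rewrite /side colP_tr // /delnth take0 drop1.
set S := nball g [set [::]; [:: 1%N]] k.
have colE x : (if `[< S x >] then color g x else None) =
    edge_col (side P 0, nth (pt0 k) (kids P) 0) x.
  have cx : (size x <= k.+1)%N -> color g x = colP P x.
    by move=> xk; rewrite -(color_plg gd (x := [::])).
  case: asboolP => [/(nball_edge _ gt g1)[gx xk]|nx].
    have xk1 : (size x <= k.+1)%N by case: xk => [|[w ->]] //=; lia.
    rewrite cx //; case: x gx xk xk1 {cx} => [|[|[|j]] x] gx xk xk1.
    - by congr Some; rewrite tcol_side.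
    - by have := vert_cat (x := [:: 0%N]) gx; move=> /(vert_child g [::] 0).
    - by rewrite /= sP g0.
    case: xk => [xk|[w]] //.
    have := sideE (j.+1 :: x) xk; rewrite /edge_col => ->.
    rewrite /= -/(node _ _) kids_nodeT ?size_behead; last by rewrite sP; lia.
    by rewrite sP nth_behead; congr (if _ then _ else _); lia.
  apply/esym; case E : (edge_col _ _) => [a|//]; exfalso; apply: nx.
  apply/(nball_edge _ gt g1).
  case: x cx E => [|[|[|j]] x] cx //.
  - by move=> _; split => //; left.
  - move=> E; have xk : (size x <= k)%N.
      by rewrite leqNgt; apply/negP => /(colP_long (nth (pt0 k) (kids P) 0)); rewrite -[colP _ _]/(edge_col (side P 0, nth (pt0 k) (kids P) 0) (1%N :: x)) E.
    split; last by right; exists x.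
    by rewrite /vert /mkset cx //= sP g0 -[colP _ _]/(edge_col (side P 0, nth (pt0 k) (kids P) 0) (1%N :: x)) E.
  move=> E; have xk : (size (j.+1 :: x) <= k)%N.
    by rewrite leqNgt; apply/negP => /(colP_long (side P 0)); rewrite -[colP _ _]/(edge_col (side P 0, nth (pt0 k) (kids P) 0) (j.+2 :: x)) E.
  split; last by left.
  move: E; rewrite /edge_col sideE // /vert /mkset cx; last exact: ltnW.
  rewrite /= -/(node _ _) kids_nodeT ?size_behead; last by rewrite sP; lia.
  by rewrite sP nth_behead /=; case: ifP => // jg E; rewrite ifT ?E //; lia.
rewrite /edge_ball /induced_graph /tgraph -/S.
have -> : edge_col (side P 0, nth (pt0 k) (kids P) 0) =
   (fun x => if `[< S x >] then color g x else None) by apply/funext => x; rewrite colE.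
congr CGraph; apply/funext => x; apply/funext => y; rewrite /tadj.
have Sv z : S z -> vert g z /\ (size z <= k.+1)%N.
  move=> /(nball_edge _ gt g1)[gz zk]; split => //.
  by case: zk => [|[w -> /=]] //; lia.
case: (asboolP (S x)) => //= Sx; case: (asboolP (S y)) => [/= Sy|]; last by rewrite andbF.
have [gx xk] := Sv _ Sx; have [gy yk] := Sv _ Sy.
move: (gx) (gy); rewrite /vert /mkset => -> ->; rewrite /=.
apply/idP/orP => [|[|]]; first exact: gt.
  exact: parent_adj.
by move=> /(parent_adj gx); rewrite (bfs_sym (lgraphP g)).
Qed.

Lemma nchild_restr r g x : (size x < r)%N -> nchild (restr r g) x = nchild g x.
Proof.
move=> xr; have [_ vE _] := restrP r g; apply: nchild_eq => j; split.
  by move=> /vE[/vert_child].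
by move=> jn; apply/vE; rewrite size_rcons; split => //; exact/vert_child.
Qed.

Lemma gcol_restr r g x : (size x <= r)%N -> gcol (restr r g) x = gcol g x.
Proof. by move=> xr; have [cE _ _] := restrP r g; rewrite /gcol cE xr. Qed.

Lemma plg_restr r g k x : (size x + k <= r)%N -> plg k (restr r g) x = plg k g x.
Proof.
elim: k x => [|k IH] x xr.
  by rewrite [LHS]gcol_restr //; lia.
have -> : plg k.+1 (restr r g) x = node (gcol (restr r g) x)
  [seq plg k (restr r g) (rcons x j) | j <- iota 1 (nchild (restr r g) x)] by [].
rewrite nchild_restr ?gcol_restr; [|lia|lia].
by congr node; apply: eq_map => j; apply: IH; rewrite size_rcons; lia.
Qed.

Lemma lutype_restr r g k x y : vert g x -> (size x + k <= r)%N ->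
  lutype D k (restr r g) x y = lutype D k g x y.
Proof.
move=> gx xr; have [cE vE aE] := restrP r g.
have -> : lutype D k (restr r g) x y = utype D (gnbs (restr r g)) (gcol (restr r g)) k (id x) (omap id y).
  by case: y.
apply: (@utype_iso M D _ _ (gnbs g) (gnbs (restr r g)) (gcol g) (gcol (restr r g)) id
  (fun=> True) (fun j z => vert g z /\ (size z + j <= r)%N)) => //.
- by move=> j z [_ zr]; rewrite gcol_restr //; exact: leq_trans (leq_addr _ _) zr.
move=> j z [gz zr]; have {}zr : (size (z : seq nat) + j.+1 <= r)%N := zr; rewrite map_id; split.
  apply: uniq_perm; rewrite ?gnbs_uniq // => u; rewrite !mem_gnbs aE.
  by case zu : (adj g z u) => //=; have := adj_size zu; lia.
move=> u; rewrite mem_gnbs => zu; split; first exact: adj_vert zu.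
apply: leq_trans zr; rewrite addnS -addSn leq_add2r; exact: adj_size zu.
Qed.

End decoding.

(** * Laws of finite-valued functions *)

Section finite_law.
Context d (T : measurableType d) (R : realType) (mu : probability T R).
Variables (F : finType) (Y : T -> F).
Hypothesis mY : forall t, measurable (Y @^-1` [set t]).

Definition finlaw (t : F) : R := fine (mu (Y @^-1` [set t])).

Lemma fin_num_prob A : measurable A -> mu A \is a fin_num.
Proof. by move=> mA; exact: fin_num_measure. Qed.

Lemma finlaw_ge0 t : 0 <= finlaw t.
Proof. by rewrite /finlaw fine_ge0. Qed.

Lemma finlaw_indic x (phi : F -> R) :
  phi (Y x) = \sum_t phi t * \1_(Y @^-1` [set t]) x.
Proof.
rewrite (bigD1 (Y x)) //= indicE mem_set // mulr1 big1 ?addr0 // => t tY.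
by rewrite indicE memNset ?mulr0 //= => /eqP; rewrite eq_sym (negPf tY).
Qed.

Lemma measurable_finlaw (phi : F -> R) :
  measurable_fun setT (fun x => (phi (Y x))%:E).
Proof.
apply/measurable_EFinP.
have -> : (fun x => phi (Y x)) = (fun x => \sum_t phi t * \1_(Y @^-1` [set t]) x).
  by apply/funext => x; exact: finlaw_indic.
apply: measurable_sum => t; apply: measurable_funM => //.
Qed.

Lemma integral_finlaw (phi : F -> R) :
  (\int[mu]_x (phi (Y x))%:E = (\sum_t phi t * finlaw t)%:E)%E.
Proof.
under eq_integral do rewrite finlaw_indic -sumEFin.
rewrite integral_sum //=; last first.
  move=> t; under eq_fun do rewrite EFinM; apply: integrableZl => //.
  by apply: integrable_indic.
rewrite -sumEFin; apply: eq_bigr => t _.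
under eq_integral do rewrite EFinM.
rewrite integralZl //; last by apply: integrable_indic.
by rewrite integral_indic // setIT EFinM fineK // fin_num_prob.
Qed.

Lemma preimage_finlaw (Q : pred F) : measurable [set x | Q (Y x)].
Proof.
have -> : [set x | Q (Y x)] = \bigcup_(t in [set t | Q t]) Y @^-1` [set t].
  by apply/seteqP; split => [x Qx|x [t Qt]]; [exists (Y x)|rewrite /= => ->].
by apply: fin_bigcup_measurable => //; exact: finite_finset.
Qed.

Lemma prob_finlaw (Q : pred F) :
  mu [set x | Q (Y x)] = (\sum_(t | Q t) finlaw t)%:E.
Proof.
rewrite -[X in mu X](setIT _) -integral_indic //; last exact: preimage_finlaw.
rewrite (eq_integral (fun x => ((Q (Y x))%:R)%:E)); last first.
  move=> x _; rewrite indicE; congr (nat_of_bool _)%:R%:E.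
  by apply/idP/idP; rewrite inE.
rewrite (integral_finlaw (fun t => (Q t)%:R)); congr EFin.
by rewrite [RHS]big_mkcond; apply: eq_bigr => t _; case: (Q t); rewrite ?mul1r ?mul0r.
Qed.

Lemma sum_finlaw : \sum_t finlaw t = 1.
Proof.
have := prob_finlaw xpredT; rewrite [X in mu X](_ : _ = setT); last first.
  by apply/seteqP; split.
by rewrite probability_setT => -[].
Qed.

End finite_law.

Lemma push_finlaw d (T : measurableType d) (R : realType) (mu : probability T R)
  (F G : finType) (Y : T -> F) (h : F -> G) u :
  (forall t, measurable (Y @^-1` [set t])) ->
  finlaw mu (h \o Y) u = push h (finlaw mu Y) u.
Proof.
move=> mY; rewrite /finlaw.
have -> : (h \o Y) @^-1` [set u] = [set x | h (Y x) == u].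
  by apply/seteqP; split => x /=; [move=> ->|move=> /eqP].
by rewrite (prob_finlaw mu mY (fun t => h t == u)).
Qed.

(** * Functions of a ball are continuous *)

Section local_sets.
Variables (R : realType) (M : pfinType).
Local Notation G := (gspace R M).

Definition local_fun (U : Type) r (Y : lgraph M -> U) :=
  forall g, Y (restr r g) = Y g.

(** Graphs at distance less than [2^-1 ^+ r] have the same ball of radius [r], so a function of that
    ball is locally constant. *)
Lemma local_open (U : Type) r (Y : G -> U) (A : set U) :
  local_fun r Y -> open (Y @^-1` A).
Proof.
move=> Yr; rewrite openE => g gA; apply/nbhs_ballP; exists (2^-1 ^+ r).
  by rewrite /= exprn_gt0 // invr_gt0.
move=> h gh; suff : restr r g = restr r h.
  by move=> E; rewrite /preimage /mkset -Yr -E Yr.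
apply: contrapT => /(@gdist_ge R M g h r); rewrite leNgt => /negP; apply; exact: gh.
Qed.

Lemma local_measurable (U : Type) r (Y : G -> U) (A : set U) :
  local_fun r Y -> measurable (Y @^-1` A : set G).
Proof. by move=> Yr; apply: sub_sigma_algebra; exact: local_open Yr. Qed.

Lemma local_measurable_fun r (Y : G -> \bar R) :
  local_fun r Y -> measurable_fun setT Y.
Proof. by move=> Yr _ A _; rewrite setTI; exact: local_measurable Yr. Qed.

Lemma local_continuous r (Y : G -> R) : local_fun r Y -> continuous Y.
Proof. by move=> Yr; apply/continuousP => A _; exact: local_open Yr. Qed.

Lemma local_comp (U V : Type) r (Y : lgraph M -> U) (h : U -> V) :
  local_fun r Y -> local_fun r (h \o Y).
Proof. by move=> Yr g; rewrite /= Yr. Qed.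

Lemma restr_law_local (U : Type) r (Y : G -> U) (A : set U) (nu : probability G R) :
  local_fun r Y -> restr_law nu r (Y @^-1` A) = nu (Y @^-1` A).
Proof.
move=> Yr; rewrite /restr_law /distribution /pushforward /=; congr (nu _).
by apply/seteqP; split => g; rewrite /preimage /mkset /grestr Yr.
Qed.

End local_sets.

(** * Facts on invariant processes *)

Lemma prob_ae_eq d (T : measurableType d) (R : realType) (mu : probability T R)
  (A B : set T) : measurable A -> measurable B ->
  {ae mu, forall x, A x <-> B x} -> mu A = mu B.
Proof.
move=> mA mB AB; rewrite -(setIT A) -(setIT B) -!integral_indic //.
apply: ge0_ae_eq_integral => //.
- by apply/measurable_EFinP; exact: measurable_indic.
- by apply/measurable_EFinP; exact: measurable_indic.
apply: filterS AB => x AB _; rewrite !indicE; congr (nat_of_bool _)%:R%:E.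
by apply/idP/idP; rewrite !inE => /AB.
Qed.

Section unif_values.
Variables (R : realType) (M : pfinType).
Local Notation G := (gspace R M).

Lemma unif_lawE (l : seq G) (l0 : l != [::]) (A : set G) :
  @unif_law _ G R l l0 A = ((count (fun g => g \in A) l)%:R / (size l)%:R)%:E.
Proof.
rewrite /unif_law [RHS]EFinM muleC; congr (_ * _)%E.
rewrite -sum1_count natr_sum -sumEFin [RHS]big_mkcond; apply: eq_bigr => g _.
by rewrite diracE; case: (g \in A).
Qed.

Lemma unif_law_const (l : seq G) (l0 : l != [::]) (A : set G) (c : bool) :
  (forall g, g \in l -> A g <-> c) -> @unif_law _ G R l l0 A = c%:R%:E.
Proof.
move=> lA; rewrite unif_lawE.
have -> : count (fun g => g \in A) l = (c * size l)%N.
  rewrite (@eq_in_count _ _ (fun=> c)); first by case: c {lA}; rewrite ?count_predT ?count_pred0 ?mul1n.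
  by move=> g /lA gc; apply/idP/idP; rewrite inE => /gc.
by rewrite natrM mulfK // pnatr_eq0 size_eq0.
Qed.

Lemma finite_ball (g : lgraph M) r : finite_set [set x | vert g x /\ (size x <= r)%N].
Proof.
elim: r => [|r IH].
  apply: (@sub_finite_set _ _ [set [::]]); last exact: finite_set1.
  by move=> x [_]; rewrite leqn0 size_eq0 => /eqP.
apply: (@sub_finite_set _ _ ([set [::]] `|`
  \bigcup_(x in [set x | vert g x /\ (size x <= r)%N]) [set y | adj g x y])).
  case/lastP => [|x j] [gx xr]; first by left.
  have [_ xj] := bfs_parent (lgraphP g) gx.
  right; exists x => //; split; first exact: (bfs_vert (lgraphP g) xj).
  by move: xr; rewrite size_rcons.
rewrite finite_setU; split; first exact: finite_set1.
by apply: bigcup_finite => // x _; exact: (bfs_fin (lgraphP g)).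
Qed.

Definition vlist (b : lgraph M) : seq label := enum_fset (fset_set (vert b)).

Lemma mem_vlist (g : lgraph M) r x : x \in vlist (restr r g) <-> vert (restr r g) x.
Proof.
have [_ vE _] := restrP r g.
have fb : finite_set (vert (restr r g)).
  by apply: sub_finite_set (finite_ball g r) => y /vE.
have -> : (x \in vlist (restr r g)) = (x \in fset_set (vert (restr r g))) by [].
by rewrite in_fset_set // inE.
Qed.

Definition relabel (b : lgraph M) (s : seq label) : lgraph M :=
  bfs_graph (bfs_sym (lgraphP b)) (bfs_irr (lgraphP b)) s
    (fun x => odflt point (color b x)) [::].

(** For events that hold for all orders of exploration or for none. *)
Lemma ball_distr_const (g : lgraph M) r (A : set G) (c : bool) :
  (forall s, perm_eq s (vlist (restr r g)) -> A (relabel (restr r g) s) <-> c) ->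
  ball_distr R g r A = c%:R%:E.
Proof.
move=> H; apply: unif_law_const => h /mapP[s]; rewrite mem_permutations => sV ->.
exact: H.
Qed.

Lemma ball_distr_count (g : lgraph M) r (A : set G) (a : pred (seq label)) :
  (forall s, perm_eq s (vlist (restr r g)) -> A (relabel (restr r g) s) <-> a s) ->
  ball_distr R g r A =
   ((count a (permutations (vlist (restr r g))))%:R /
    (size (permutations (vlist (restr r g))))%:R)%:E.
Proof.
move=> H; rewrite [LHS]unif_lawE size_map count_map.
congr ((_%:R / _)%:E); apply: eq_in_count => s; rewrite mem_permutations => sV /=.
by apply/idP/idP; rewrite ?inE => /(H _ sV) //; rewrite inE.
Qed.

End unif_values.

Section offspring.
Variables (R : realType) (p : probability nat R) (D : nat).
Hypothesis pD : forall k, (D < k)%N -> p [set k] = 0%E.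

Definition offs (j : nat) : R := fine (p [set j]).

Lemma offs_ge0 j : 0 <= offs j.
Proof. by rewrite /offs fine_ge0. Qed.

Lemma ae_offs : {ae p, forall k, (k <= D)%N}.
Proof.
apply/negligibleP => //.
have -> : ~` [set k | (k <= D)%N] = \bigcup_k [set (D.+1 + k)%N].
  apply/seteqP; split => k /=; first by move=> /negP; rewrite -ltnNge => Dk; exists (k - D.+1)%N => //=; rewrite subnKC.
  by move=> [i _ /= ->]; apply/negP; rewrite -ltnNge; lia.
apply/negligibleP; first by [].
apply: negligible_bigcup => k; apply/negligibleP => //; apply: pD; lia.
Qed.

Lemma integral_offs (phi : nat -> R) :
  (\int[p]_k (phi k)%:E = (\sum_(j < D.+1) offs j * phi j)%:E)%E.
Proof.
(* Capping at [D] changes nothing almost surely and makes the variable finite-valued. *)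
pose Y k : 'I_D.+1 := inord (minn k D).
have YE k : (k <= D)%N -> Y k = k :> nat.
  by move=> kD; rewrite inordK; rewrite (minn_idPl kD).
transitivity (\int[p]_k (phi (Y k))%:E)%E.
  apply: ae_eq_integral => //.
  by apply: filterS ae_offs => k kD _; rewrite YE.
rewrite (integral_finlaw p (Y := Y) (fun _ => I) (fun j => phi j)); congr EFin; apply: eq_bigr => j _.
rewrite mulrC /finlaw /offs; congr (fine _ * _).
apply: prob_ae_eq => //; apply: filterS ae_offs => k kD.
rewrite /preimage /mkset; split => [/(congr1 val)/=|->]; first by rewrite YE.
by apply: val_inj; rewrite /= YE // -ltnS.
Qed.

Lemma sum_offs : \sum_(j < D.+1) offs j = 1.
Proof.
have := integral_offs (fun=> 1); rewrite integral_cst // [X in (_ * X)%E](_ : _ = 1%E); last exact: probability_setT.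
rewrite mul1e => -[->].
by apply: eq_bigr => j _; rewrite mulr1.
Qed.

Lemma mean_offs : fine (mean p) = \sum_(j < D.+1) j%:R * offs j.
Proof.
rewrite /mean (integral_offs (fun j => j%:R)) /=.
by apply: eq_bigr => j _; rewrite mulrC.
Qed.

End offspring.

(** Simple functions below [f] are below [g]. This form covers integrands whose measurability has
    not been established, such as [ball_distr] along [TX]. *)
Lemma ge0_le_integralT d (T : measurableType d) (R : realType) (mu : {measure set T -> \bar R})
    (f g : T -> \bar R) : (forall x, 0 <= f x)%E -> (forall x, f x <= g x)%E ->
  (\int[mu]_x f x <= \int[mu]_x g x)%E.
Proof.
move=> f0 fg; have g0 x : (0 <= g x)%E by exact: le_trans (f0 x) (fg x).
rewrite !ge0_integralTE //; apply: ge_ereal_sup => _ [h hf <-].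
apply: ereal_sup_ubound; exists h => // x.
exact: le_trans (hf x) (fg x).
Qed.

Lemma aeS (R : realType) (M : pfinType) (nu : probability (gspace R M) R)
    (A B : gspace R M -> Prop) : {ae nu, forall g, A g} ->
  (forall g, A g -> B g) -> {ae nu, forall g, B g}.
Proof. by move=> H AB; exact: (@filterS _ _ (ae_filter_ringOfSetsType nu) _ _ AB H). Qed.

Section process.
Variables (R : realType) (M : pfinType) (p : probability nat R) (D : nat).
Hypothesis pD : forall k, (D < k)%N -> p [set k] = 0%E.
Local Notation G := (gspace R M).
Variable mu : probability G R.
Context d (Omega : measurableType d) (P : probability Omega R)
  (N : label -> {mfun Omega >-> nat}) (TX : {mfun Omega >-> gspace R M}).
Hypotheses (gw : gw_offspring p P N)
  (tree : forall w, vert (TX w) = [set x | in_tree (N^~ w) x] /\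
                    adj (TX w) = tree_adj (N^~ w))
  (uni : unimodular (distribution P TX))
  (mu_ball : forall r A, measurable A ->
     restr_law mu r A = (\int[P]_w ball_distr R (TX w) r A)%E).
Local Notation plg := (plg D).
Local Notation lutype := (lutype D).

Lemma mu_local (U : Type) r (Y : lgraph M -> U) (A : set U) : local_fun r Y ->
  mu (Y @^-1` A) = (\int[P]_w ball_distr R (TX w) r (Y @^-1` A))%E.
Proof.
move=> Yr; rewrite -(restr_law_local A mu Yr) mu_ball //.
exact: local_measurable Yr.
Qed.

Lemma TX_parent w x y : adj (TX w) x y -> parent x y \/ parent y x.
Proof. by have [_ ->] := tree w; case/and3P => _ _ /orP. Qed.

Lemma in_tree_rcons (n : label -> nat) x j :
  in_tree n (rcons x j) = in_tree n x && (0 < j <= n x)%N.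
Proof.
rewrite /in_tree size_rcons -[(size x).+1]addn1 iotaD all_cat /= add0n andbT nth_rcons ltnn eqxx.
rewrite -cats1 take_size_cat //; congr (_ && _).
apply: eq_in_all => m; rewrite mem_iota /= => mx.
by rewrite nth_cat mx takel_cat // ltnW.
Qed.

Lemma nchild_TX w x : vert (TX w) x -> nchild (TX w) x = N x w.
Proof.
move=> gx; apply: nchild_eq => j; move: gx; have [-> _] := tree w.
by rewrite /mkset in_tree_rcons => ->.
Qed.

Section ball.
Variables (w : Omega) (r : nat) (s : seq label).
Let b := restr r (TX w).
Hypothesis sV : perm_eq s (vlist b).
Local Notation h := (relabel b s).

Lemma ball_parent x y : adj b x y -> parent x y \/ parent y x.
Proof. by have [_ _ ->] := restrP r (TX w); case/and3P => /TX_parent. Qed.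

Let uV : uniq (vlist b). Proof. exact: fset_uniq. Qed.
Let VP x : x \in vlist b <-> vert b x. Proof. exact: mem_vlist. Qed.

Lemma relabel_treelike k : treelike k h.
Proof. by move=> x y _ _; exact: (bfs_treelike ball_parent uV VP sV). Qed.

Lemma relabel_plg k : plg k h [::] =
  pls D (fun x => odflt point (color b x)) k s [::].
Proof. by apply: (plg_bfs D ball_parent uV VP sV); exact: explored_root. Qed.

Lemma relabel_lutype k : lutype k h [::] None = lutype k b [::] None.
Proof.
apply: (@lutype_bfs _ _ D (adj b)).
- by rewrite (perm_uniq sV).
- by rewrite (perm_mem sV); apply/VP; exact: bfs_root (lgraphP b).
- by move=> x y xy; rewrite (perm_mem sV); apply/VP; exact: adj_vert xy.
- exact: gnbs_uniq.
- exact: mem_gnbs.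
Qed.

Lemma relabel_small : (forall x, (N x w <= D)%N) -> small_degrees D r h.
Proof.
move=> ND x hx _; apply: (nchild_bfs_le ball_parent uV VP sV _ hx) => y bY.
have [_ vE _] := restrP r (TX w); have [gy yr] := (vE y).1 bY.
apply: leq_trans (ND y); rewrite -(nchild_TX gy).
apply: leq_trans (_ : (count (parent y) (gnbs b y) <= _)%N); first by [].
rewrite /nchild -!size_filter; apply: uniq_leq_size; first by rewrite filter_uniq // gnbs_uniq.
move=> z; rewrite !mem_filter !mem_gnbs => /andP[->].
by have [_ _ ->] := restrP r (TX w); case/and3P.
Qed.

Lemma relabel_root : (0 < r)%N -> nchild h [::] = N [::] w.
Proof.
move=> r0; have [_ vE _] := restrP r (TX w).
have <- : nchild (TX w) [::] = N [::] w by apply: nchild_TX; exact: bfs_root (lgraphP _).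
rewrite -(nchild_restr (TX w) (x := [::]) r0).
rewrite (nchild_bfs ball_parent uV VP sV (explored_root _ _ _)).
rewrite /nchild -size_filter; apply: perm_size; apply: uniq_perm.
- by rewrite filter_uniq // (perm_uniq sV).
- by rewrite filter_uniq // gnbs_uniq.
move=> y; rewrite !mem_filter (perm_mem sV) mem_gnbs; case E : (parent [::] y); last by [].
apply/andP/andP => -[_ b0]; split=> //; last by apply/VP; exact: adj_vert b0.
move/VP: b0 => bY.
exact: parent_adj bY E.
Qed.

End ball.

Lemma treelike_local r : local_fun r (@treelike M r).
Proof.
move=> g; have [_ _ aE] := restrP r g; apply/propext; split=> gt x y xr yr xy.
  by apply: gt => //; rewrite aE xy xr yr.
by apply: gt => //; move: xy; rewrite aE => /and3P[].
Qed.

Lemma small_degrees_local r : local_fun r (@small_degrees M D r).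
Proof.
move=> g; have [_ vE _] := restrP r g; apply/propext; split=> gs x gx xr.
  by rewrite -(nchild_restr g xr); apply: gs => //; apply/vE; split => //; exact: ltnW.
by rewrite nchild_restr //; apply: gs => //; move/vE: gx => [].
Qed.

Lemma ae_treelike r : {ae mu, forall g, treelike r g}.
Proof.
have E : ~` [set g : G | treelike r g] = treelike r @^-1` [set Q | ~ Q] by [].
apply/negligibleP; rewrite E; first exact: local_measurable (@treelike_local r).
rewrite [LHS](mu_local _ (@treelike_local r)) -(integral0 P setT).
apply: eq_integral => w _; apply: (@ball_distr_const R M _ _ _ false) => s sV.
by split=> // nt; exfalso; apply: nt; exact: relabel_treelike sV _.
Qed.

Lemma size_biased_large k : (D <= k)%N -> size_biased p k = 0.
Proof. by move=> Dk; rewrite /size_biased pD // /= mulr0 mul0r. Qed.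

Lemma ae_offspring : {ae P, forall w x, (N x w <= D)%N}.
Proof.
have H x : P.-negligible [set w | (D < N x w)%N].
  have -> : [set w | (D < N x w)%N] = \bigcup_k (N x @^-1` [set (D.+1 + k)%N]).
    apply/seteqP; split => w /=; last by move=> [i _ /= ->]; lia.
    by move=> Dk; exists (N x w - D.+1)%N => //=; rewrite subnKC.
  apply: negligible_bigcup => k; apply/negligibleP; first exact: measurable_funPTI.
  rewrite [LHS]gw.1; case: ifP => _; first by apply: pD; lia.
  by rewrite size_biased_large //; lia.
suff : P.-negligible (~` [set w | forall x, (N x w <= D)%N]) by [].
(* There are countably many labels; the exceptional set is a union indexed by their codes. *)
pose B k := if (choice.unpickle k : option label) is Some x then [set w | (D < N x w)%N] else set0.
have nB : P.-negligible (\bigcup_k B k).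
  apply: negligible_bigcup => k; rewrite /B; case: choice.unpickle => [x|]; [exact: H|exact: negligible_set0].
apply: negligibleS nB.
move=> w /= /existsNP[x /negP]; rewrite -ltnNge => Dx.
by exists (choice.pickle x) => //; rewrite /B choice.pickleK.
Qed.

Lemma ae_small_degrees r : {ae mu, forall g, small_degrees D r g}.
Proof.
have E : ~` [set g : G | small_degrees D r g] = small_degrees D r @^-1` [set Q | ~ Q] by [].
apply/negligibleP; rewrite E; first exact: local_measurable (@small_degrees_local r).
rewrite [LHS](mu_local _ (@small_degrees_local r)).
have [B [mB B0 sB]] := ae_offspring.
apply/eqP; rewrite eq_le integral_ge0 ?andbT => [|w _]; last exact: measure_ge0.
have -> : 0%E = (\int[P]_w (\1_B w)%:E)%E by rewrite integral_indic // setIT; apply/esym; exact: B0.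
apply: ge0_le_integralT => w; first exact: measure_ge0.
rewrite indicE; case: (boolP (w \in B)) => wB.
  exact: probability_le1 (local_measurable _ (@small_degrees_local r)).
rewrite (@ball_distr_const R M _ _ _ false) // => s sV; split=> // nt; exfalso; apply: nt.
apply: (relabel_small sV) => x.
have : ~ (~` [set w | forall x, (N x w <= D)%N]) w.
  by move=> /sB Bw; move: wB; rewrite notin_setE => /(_ Bw).
by move=> /contrapT; apply.
Qed.

Lemma plg_local k : local_fun k (fun g : lgraph M => plg k g [::]).
Proof. by move=> g; exact: plg_restr. Qed.

Lemma lutype_local k : local_fun k (fun g : lgraph M => lutype k g [::] None).
Proof. by move=> g; apply: lutype_restr => //; exact: bfs_root (lgraphP g). Qed.

Definition qlaw k : ptree M D k -> R := finlaw mu (fun g : G => plg k g [::]).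

Lemma plg_measurable k t : measurable ((fun g : G => plg k g [::]) @^-1` [set t]).
Proof. exact: local_measurable (@plg_local k). Qed.

Lemma lutype_measurable k t :
  measurable ((fun g : G => lutype k g [::] None) @^-1` [set t]).
Proof. exact: local_measurable (@lutype_local k). Qed.

Lemma qlaw_ge0 k t : 0 <= @qlaw k t. Proof. exact: finlaw_ge0. Qed.

Lemma sum_qlaw k : \sum_t @qlaw k t = 1.
Proof. by apply: sum_finlaw; exact: plg_measurable. Qed.

Lemma push_tr_qlaw k : push (@tr M D k) (@qlaw k.+1) = @qlaw k.
Proof.
apply/funext => t; rewrite /qlaw -push_finlaw; last exact: plg_measurable.
by congr finlaw; apply/funext => g; exact: tr_plg.
Qed.

(** Given the tree, isomorphic plane trees are produced by equally many orders ([count_pls_canon]),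
    and the order is uniform. *)
Lemma qlaw_canon_inv k : canon_inv (@qlaw k).
Proof.
move=> P1 P2 PP; rewrite /qlaw /finlaw !(mu_local _ (@plg_local k)).
congr fine; apply: eq_integral => w _.
have E t : ball_distr R (TX w) k ((fun g : G => plg k g [::]) @^-1` [set t]) =
    ((count (fun s => pls D (fun x => odflt point (color (restr k (TX w)) x)) k s [::] == t)
       (permutations (vlist (restr k (TX w)))))%:R /
     (size (permutations (vlist (restr k (TX w)))))%:R)%:E.
  apply: ball_distr_count => s sV; rewrite /preimage /mkset (relabel_plg sV).
  by split => [->|/eqP].
by rewrite !E (count_pls_canon _ _ _ PP) //; exact: fset_uniq.
Qed.

Lemma law_lutype k t :
  finlaw mu (fun g : G => lutype k g [::] None) t = push (@canon M D k) (@qlaw k) t.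
Proof.
rewrite /qlaw -push_finlaw; last exact: plg_measurable.
congr fine; apply: prob_ae_eq.
- exact: lutype_measurable.
- by apply: local_measurable (local_comp _ (@plg_local k)).
apply: (aeS (ae_treelike k)) => g gt; rewrite /preimage /mkset /=.
by rewrite (canon_plg D gt) //; exact: bfs_root (lgraphP g).
Qed.

(** Random labeling keeps the type of the root, so the law of [TX] and [mu] agree on unlabeled
    balls. This carries unimodularity, stated for [TX], over to [mu]. *)
Lemma law_lutype_TX k t :
  finlaw (distribution P TX) (fun g : G => lutype k g [::] None) t =
  push (@canon M D k) (@qlaw k) t.
Proof.
rewrite -law_lutype /finlaw (mu_local _ (@lutype_local k)); congr fine.
transitivity (P (TX @^-1` ((fun g : G => lutype k g [::] None) @^-1` [set t]))); first by [].
rewrite -[X in P X]setIT -integral_indic //; last first.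
  by apply: measurable_funPTI => //; exact: lutype_measurable.
apply: eq_integral => w _; rewrite indicE.
rewrite (@ball_distr_const R M _ _ _ (lutype k (TX w) [::] None == t)).
  by congr (nat_of_bool _)%:R%:E; apply/idP/eqP; rewrite inE.
move=> s sV; rewrite /preimage /mkset (relabel_lutype sV) lutype_local.
by split => [->|/eqP].
Qed.

Lemma law_nchild j : mu [set g : G | nchild g [::] = j] = p [set j].
Proof.
have nl : local_fun 1 (fun g : lgraph M => nchild g [::]) by move=> g; exact: nchild_restr.
rewrite (mu_local [set j] nl) -[RHS](gw.1 [::] j) -[X in _ = P X]setIT -integral_indic //; last first.
  exact: measurable_funPTI.
apply: eq_integral => w _; rewrite indicE.
rewrite (@ball_distr_const R M _ _ _ (N [::] w == j)).
  by congr (nat_of_bool _)%:R%:E; apply/eqP/idP; rewrite inE.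
move=> s sV; rewrite /preimage /mkset (relabel_root sV) //.
by split => [->|/eqP].
Qed.

Lemma size_kids_plg k (g : lgraph M) : (nchild g [::] <= D)%N ->
  size (kids (plg k.+1 g [::])) = nchild g [::].
Proof. by move=> gD; rewrite kids_nodeT size_map size_iota. Qed.

Lemma law_size k j :
  \sum_(t : ptree M D k.+1 | size (kids t) == j) qlaw t = offs p j.
Proof.
apply: EFin_inj; rewrite /qlaw -(prob_finlaw mu (@plg_measurable k.+1) (fun t => size (kids t) == j)).
rewrite /offs fineK; last by apply: fin_num_prob.
rewrite -law_nchild; apply: prob_ae_eq.
- exact: (preimage_finlaw (@plg_measurable k.+1) (fun t => size (kids t) == j)).
- have nl : local_fun 1 (fun g : lgraph M => nchild g [::]) by move=> g; exact: nchild_restr.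
  exact: local_measurable [set j] nl.
apply: (aeS (ae_small_degrees 1)) => g gs; rewrite /mkset size_kids_plg.
  by split => [/eqP|->].
by apply: gs => //; exact: bfs_root (lgraphP g).
Qed.

Lemma mean_size k : fine (mean p) = \sum_t @qlaw k.+1 t * (size (kids t))%:R.
Proof.
rewrite (mean_offs pD).
rewrite [RHS](partition_big (fun t => inord (size (kids t)) : 'I_D.+1) xpredT) //=.
apply: eq_bigr => j _; rewrite -(law_size k) mulr_sumr; apply: eq_big => t.
  rewrite -[RHS](inj_eq val_inj) /= inordK //; exact: size_kids.
by move=> /eqP <-; rewrite mulrC.
Qed.

Lemma esum_count (A : set label) (l : seq label) (a : pred label) : uniq l ->
  (forall x, a x -> x \in l /\ A x) ->
  (\esum_(x in A) ((a x)%:R : R)%:E = ((count a l)%:R : R)%:E)%E.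
Proof.
move=> ul aP; rewrite esum_mkcond.
have -> : (count a l)%:R%:E = (\esum_(x in [set` l]) ((a x)%:R : R)%:E)%E.
  rewrite esum_fset; [|exact: finite_seq|by move=> i _; rewrite lee_fin].
  rewrite -fsbig_seq // sumEFin -sum1_count natr_sum [in LHS]big_mkcond.
  by congr EFin; apply: eq_bigr => x _; case: (a x).
rewrite [RHS]esum_mkcond; apply: eq_esum => x _.
case E : (a x); first by have [xl Ax] := aP _ E; rewrite !mem_set.
by case: ifP; case: ifP.
Qed.

Local Notation m0 := (point : M).

Definition dart_type k (g : lgraph M) x y : ptree M D k * ptree M D k :=
  (lutype k g x (Some y), lutype k g y (Some x)).

Lemma lutype_iso k (g h : lgraph M) phi x y : isomorphism g h phi ->
  vert g x -> vert g y -> lutype k h (phi x) (Some (phi y)) = lutype k g x (Some y).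
Proof.
move=> [[phiV phiI phiS] phiA phiC] gx gy.
apply: (@utype_iso M D _ _ (gnbs g) (gnbs h) (gcol g) (gcol h) phi
  (fun x => vert g x) (fun _ x => vert g x) _ _ _ _ _ x (Some y)) => //.
- by move=> u u' gu gu'; apply: phiI; rewrite inE.
- by move=> j u gu; rewrite /gcol phiC.
- move=> j u gu; split; last by move=> z; rewrite mem_gnbs; exact: adj_vert.
  apply: uniq_perm; last 1 first.
  + move=> z; rewrite mem_gnbs; apply/mapP/idP => [[u' + ->]|uz].
      by rewrite mem_gnbs => uu'; rewrite phiA //; exact: adj_vert uu'.
    have [u' gu' u'z] := phiS _ (adj_vert uz); exists u' => //.
    by rewrite mem_gnbs -phiA // u'z.
  + rewrite map_inj_in_uniq ?gnbs_uniq // => a b; rewrite !mem_gnbs => ua ub.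
    by apply: phiI; rewrite inE; [exact: adj_vert ua|exact: adj_vert ub].
  + exact: gnbs_uniq.
- by move=> y0 [<-].
Qed.

Definition dart_count k g (t : ptree M D k * ptree M D k) := count (fun y => dart_type k g [::] y == t) (gnbs g [::]).

(** Mass transport: every vertex sends mass 1 along each of its edges of type [t]. The root receives
    mass along the edges that have type [swap t] when seen from the root. *)
Lemma unimodular_darts k (t : ptree M D k * ptree M D k) :
  (\int[distribution P TX]_g ((dart_count g t)%:R : R)%:E =
   \int[distribution P TX]_g ((dart_count g (swap t))%:R : R)%:E)%E.
Proof.
pose F (g : G) x y : \bar R := ((adj g x y && (dart_type k g x y == t))%:R)%:E.
have F0 g x y : (0 <= F g x y)%E by rewrite lee_fin.
have mF x y : measurable_fun [set g : G | vert g x /\ vert g y] (fun g => F g x y).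
  apply: measurable_funTS; pose r := (maxn (size x) (size y) + k)%N.
  apply: (@local_measurable_fun R M r) => g.
  have [_ _ aE] := restrP r g; rewrite /F aE.
  have xr : (size x + k <= r)%N by rewrite leq_add2r leq_maxl.
  have yr : (size y + k <= r)%N by rewrite leq_add2r leq_maxr.
  case xy : (adj g x y) => //=.
  have gx := bfs_vert (lgraphP g) xy; have gy := adj_vert xy.
  rewrite (leq_trans (leq_addr _ _) xr) (leq_trans (leq_addr _ _) yr) /dart_type.
  by rewrite !lutype_restr.
have iF g h phi : isomorphism g h phi ->
    forall x y, vert g x -> vert g y -> F h (phi x) (phi y) = F g x y.
  move=> iso x y gx gy; rewrite /F /dart_type !(lutype_iso _ iso) //.
  by have [_ phiA _] := iso; rewrite phiA.
have := uni F0 mF iF.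
have -> : (fun g : G => (\esum_(x in vert g) F g [::] x)%E) =
    (fun g => ((dart_count g t)%:R : R)%:E).
  apply/funext => g; rewrite (@esum_count _ (gnbs g [::])) ?gnbs_uniq //.
    congr ((_%:R)%:E); apply: eq_in_count => y; rewrite mem_gnbs => -> //.
  by move=> y /andP[oy _]; rewrite mem_gnbs; split => //; exact: adj_vert oy.
have -> : (fun g : G => (\esum_(x in vert g) F g x [::])%E) =
    (fun g => ((dart_count g (swap t))%:R : R)%:E) => //.
apply/funext => g; rewrite (@esum_count _ (gnbs g [::])) ?gnbs_uniq //.
  congr ((_%:R)%:E); apply: eq_in_count => y.
  rewrite mem_gnbs (bfs_sym (lgraphP g)) => -> /=.
  by rewrite /dart_type /swap; case: t {F F0 mF iF} => a b /=; rewrite !xpair_eqE andbC.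
move=> y /andP[yo _]; rewrite mem_gnbs (bfs_sym (lgraphP g)); split => //.
by apply: (bfs_vert (lgraphP g)); exact: yo.
Qed.

Lemma dart_count_local k (t : ptree M D k * ptree M D k) : local_fun k.+1 (fun g : lgraph M => dart_count g t).
Proof.
move=> g; have [_ _ aE] := restrP k.+1 g.
have nbE : perm_eq (gnbs (restr k.+1 g) [::]) (gnbs g [::]).
  apply: uniq_perm; rewrite ?gnbs_uniq // => y; rewrite !mem_gnbs aE.
  by case oy : (adj g [::] y) => //=; exact: leq_trans (adj_size oy) _.
rewrite /dart_count (permP nbE); apply: eq_in_count => y; rewrite mem_gnbs => oy.
have gy := adj_vert oy; have g0 := bfs_root (lgraphP g).
have yk : (size y + k <= k.+1)%N by rewrite -[k.+1]add1n leq_add2r; exact: adj_size oy.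
by rewrite /dart_type !lutype_restr.
Qed.

(** The unfolding shows all neighbours of the root once there are at most [D] of them, which is
    almost sure by the bound on the offspring. *)
Lemma ae_dart_count k : {ae distribution P TX, forall g : G, forall t : ptree M D k * ptree M D k,
  dart_count g t = edge_count m0 (lutype k.+1 g [::] None) t}.
Proof.
pose Q (g : lgraph M) := (size (gnbs g [::]) <= D)%N.
have Q1 : local_fun 1 Q.
  move=> g; rewrite /Q; have [_ _ aE] := restrP 1 g; congr (_ <= D)%N.
  apply: perm_size; apply: uniq_perm; rewrite ?gnbs_uniq // => y; rewrite !mem_gnbs aE.
  by case oy : (adj g [::] y) => //=; exact: adj_size oy.
apply: (@aeS _ _ _ Q).
  suff H : (distribution P TX).-negligible (Q @^-1` [set b | ~ b]) by exact: H.
  apply/negligibleP; first exact: local_measurable Q1.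
  transitivity (P (TX @^-1` (Q @^-1` [set b | ~ b]))); first by [].
  apply/negligibleP; first by apply: measurable_funPTI => //; exact: local_measurable Q1.
  apply: negligibleS ae_offspring => w nQ ND; apply: nQ.
  apply: leq_trans (ND [::]); rewrite -nchild_TX; last exact: bfs_root (lgraphP _).
  rewrite /nchild (@eq_in_count _ _ xpredT) ?count_predT // => y; rewrite mem_gnbs.
  by move=> /TX_parent[->//|/parentP[j]]; case: (y).
move=> g gD t.
have -> : edge_count m0 (lutype k.+1 g [::] None) t = edge_count m0 (gtree D (gnbs g) (gcol g) k.+1 [::] None) t.
  by apply: edge_count_canon; exact: canon_idem.
by rewrite edge_count_gtree ?gnbs_uniq.
Qed.

Lemma plaw_sym k t :
  plaw m0 (fine (mean p)) (@qlaw k.+1) (swap t) = plaw m0 (fine (mean p)) (@qlaw k.+1) t.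
Proof.
have E (s : ptree M D k * ptree M D k) : (\int[distribution P TX]_g ((dart_count g s)%:R : R)%:E =
   (\sum_(Q : ptree M D k.+1) qlaw Q * (edge_count m0 Q s)%:R)%:E)%E.
  transitivity (\int[distribution P TX]_(g in setT)
      ((edge_count m0 (lutype k.+1 g [::] None) s)%:R : R)%:E)%E.
    apply: ae_eq_integral => //.
    - exact: (local_measurable_fun (local_comp (fun n => n%:R%:E) (@dart_count_local k s))).
    - exact: (local_measurable_fun (local_comp (fun u => (edge_count m0 u s)%:R%:E) (@lutype_local k.+1))).
    apply: (aeS (ae_dart_count k)) => g gt _; congr (_%:R%:E); exact: gt.
  rewrite (integral_finlaw _ (Y := fun g : G => lutype k.+1 g [::] None)
    (@lutype_measurable k.+1) (fun u => (edge_count m0 u s)%:R)); congr EFin.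
  under eq_bigr do rewrite law_lutype_TX mulrC.
  rewrite sum_push; apply: eq_bigr => Q _; congr (_ * _%:R).
  by apply: edge_count_canon; exact: canon_idem.
by rewrite /plaw; congr (_ * _); apply: EFin_inj; rewrite -!E -unimodular_darts.
Qed.

End process.

(** * The annealed entropy *)

(** Points outside the range of [xi] have mass 0 and contribute 0 to the entropy. *)
Lemma shannon_fin (R : realType) (T : finType) (U : choiceType) (xi : T -> U) (w : T -> R) :
  injective xi -> (forall t, 0 <= w t <= 1) ->
  shannon (fun b => (\sum_(t | xi t == b) w t)%:E) = (ent w)%:E.
Proof.
move=> inj w01.
have wE t : \sum_(s | xi s == xi t) w s = w t.
  by rewrite (eq_bigl (fun s => s == t)) ?big_pred1_eq // => s; exact: inj_eq.
have -> : (ent w)%:E = (\esum_(t in [set: T]) (- (w t * ln (w t)))%:E)%E.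
  rewrite esum_fset; [|exact: finite_finset|]; last first.
    move=> t _; rewrite lee_fin oppr_ge0; have /andP[w0 w1] := w01 t.
    by rewrite mulr_ge0_le0 // ln_le0.
  have -> : [set: T] = [set` enum T] by apply/seteqP; split => t //= _; rewrite mem_enum.
  by rewrite -fsbig_seq ?enum_uniq // big_enum /= /ent -sumrN sumEFin.
rewrite /shannon.
transitivity (\esum_(b in range xi)
    (- ((\sum_(s | xi s == b) w s) * ln (\sum_(s | xi s == b) w s)))%:E)%E.
  rewrite [RHS]esum_mkcond; apply: eq_esum => b _; case: ifPn => // /negP nb.
  rewrite /= big1 ?mul0r ?oppr0 // => t /eqP tb; exfalso; apply: nb.
  by rewrite inE; exists t.
rewrite (@reindex_esum _ _ _ setT _ xi); last first.
  split; [by move=> t _; exists t|by move=> s t _ _; exact: inj|].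
  by move=> _ [t _ <-]; exists t.
by apply: eq_esum => t _; rewrite wE.
Qed.

(** A walk of length [r] from the root or from the label 1 stays within distance [r.+1] of the
    root. *)
Lemma edge_ball_local (M : pfinType) r (g : lgraph M) :
  edge_ball (restr r.+1 g) r.+1 = edge_ball g r.+1.
Proof.
have [cE vE aE] := restrP r.+1 g; pose a := adj (restr r.+1 g).
have H (t : seq label) : forall y, vert g y -> (size y + size t <= r.+1)%N ->
    path (adj g) y t -> path a y t /\ (size (last y t) <= r.+1)%N.
  elim: t => [|z t IH] y gy yr /=; first by split => //; rewrite addn0 in yr.
  move=> /andP[yz pt]; have sz := adj_size yz.
  have [|p1 p2] := IH z (adj_vert yz) _ pt; first by move: yr; rewrite /= addnS; apply: leq_trans; rewrite -addSn leq_add2r.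
  split => //; rewrite {1}/a aE yz p1 andbT /=; apply/andP; split.
    exact: leq_trans (leq_addr _ _) yr.
  by apply: leq_trans sz _; move: yr; rewrite /= addnS; apply: leq_trans; rewrite ltnS leq_addr.
have nE : nball (restr r.+1 g) [set [::]; [:: 1%N]] r = nball g [set [::]; [:: 1%N]] r.
  apply/seteqP; split => x [y [t [ys gy pt tr lx]]]; exists y, t; split => //.
  - by case/vE: gy.
  - by apply: sub_path pt => u v; rewrite aE => /andP[].
  - by apply/vE; split => //; case: ys => ->.
  - have [] // := H t y gy _ pt.
    by case: ys => -> /=; [exact: leqW|exact: tr].
have nr x : nball g [set [::]; [:: 1%N]] r x -> (size x <= r.+1)%N.
  move=> [y [t [ys gy pt tr <-]]]; have [] // := H t y gy _ pt.
  by case: ys => -> /=; [exact: leqW|exact: tr].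
rewrite /edge_ball /= nE /induced_graph; congr CGraph.
  by apply/funext => x; case: asboolP => // /nr xr; rewrite -[LHS]/(color (restr r.+1 g) x) cE xr.
apply/funext => x; apply/funext => y; case: asboolP => //= /nr xr; case: asboolP => //= /nr yr.
by rewrite -[LHS]/(adj (restr r.+1 g) x y) aE xr yr !andbT.
Qed.

Section annealed.
Variables (R : realType) (M : pfinType) (p : probability nat R) (D : nat).
Hypothesis pD : forall k, (D < k)%N -> p [set k] = 0%E.
Local Notation G := (gspace R M).
Variable mu : probability G R.
Hypothesis mu_inv : invariant_process p mu.
Local Notation plg := (plg D).
Local Notation q k := (@qlaw R M D mu k).
Local Notation m0 := (point : M).
Let d := fine (mean p).
Hypothesis d0 : 0 < d.

Lemma inv_ae_treelike r : {ae mu, forall g, treelike r g}.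
Proof. by case: mu_inv => dd [Om [P [N [TX [gw tree uni mb]]]]]; exact: ae_treelike tree mb r. Qed.

Lemma inv_ae_small_degrees r : {ae mu, forall g, small_degrees D r g}.
Proof. by case: mu_inv => dd [Om [P [N [TX [gw tree uni mb]]]]]; exact: (ae_small_degrees pD gw tree mb). Qed.

Lemma inv_canon_inv k : canon_inv (q k).
Proof. by case: mu_inv => dd [Om [P [N [TX [gw tree uni mb]]]]]; exact: (qlaw_canon_inv tree mb). Qed.

Lemma inv_law_lutype k t :
  finlaw mu (fun g : G => lutype D k g [::] None) t = push (@canon M D k) (q k) t.
Proof. by case: mu_inv => dd [Om [P [N [TX [gw tree uni mb]]]]]; exact: (law_lutype tree mb). Qed.

Lemma inv_law_size k j :
  \sum_(t : ptree M D k.+1 | size (kids t) == j) q k.+1 t = offs p j.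
Proof. by case: mu_inv => dd [Om [P [N [TX [gw tree uni mb]]]]]; exact: (law_size pD gw tree mb). Qed.

Lemma inv_mean_size k : d = \sum_t q k.+1 t * (size (kids t))%:R.
Proof. by case: mu_inv => dd [Om [P [N [TX [gw tree uni mb]]]]]; exact: (mean_size pD gw tree mb). Qed.

Lemma inv_plaw_sym k t : plaw m0 d (q k.+1) (swap t) = plaw m0 d (q k.+1) t.
Proof. by case: mu_inv => dd [Om [P [N [TX [gw tree uni mb]]]]]; exact: (plaw_sym pD gw tree uni mb). Qed.

Lemma qlaw_le1 k t : q k t <= 1.
Proof.
rewrite -(@sum_qlaw R M D mu k) (bigD1 t) //= lerDl.
by apply: sumr_ge0 => s _; exact: qlaw_ge0.
Qed.

Lemma shannon_vertex r : shannon (fun b : cgraph M => mu [set g | vertex_ball g r = b]) = (ent (q r))%:E.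
Proof.
rewrite -(@shannon_fin R _ (cgraph M) (fun t => tgraph (colP (t : ptree M D r)))); last 2 first.
- by move=> s t /tgraph_inj/colP_inj.
- by move=> t; rewrite qlaw_ge0 qlaw_le1.
congr shannon; apply/funext => b.
rewrite -(prob_finlaw mu (@plg_measurable R M D r) (fun t => tgraph (colP t) == b)).
have vl : local_fun r (fun g : lgraph M => vertex_ball g r).
  by move=> g; rewrite -[LHS]/(lgraph_val (restr r (restr r g))) restr_min minnn.
apply: prob_ae_eq.
- exact: local_measurable [set b] vl.
- exact: (preimage_finlaw (@plg_measurable R M D r) (fun t => tgraph (colP t) == b)).
apply: (@aeS _ _ _ (fun g => treelike r g /\ small_degrees D r g)).
  exact: (@filterI _ _ (ae_filter_ringOfSetsType mu) _ _ (inv_ae_treelike r) (inv_ae_small_degrees r)).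
move=> g [gt gs]; rewrite /mkset (vertex_ball_dec gt gs).
by split => [->|/eqP].
Qed.

Let phi k (b : cgraph M) (t : ptree M D k.+1) : R :=
  ((0 < size (kids t))%N &&
   (tgraph (edge_col (side t 0, nth (pt0 D m0 k) (kids t) 0)) == b))%:R * (size (kids t))%:R.

(** The degree in [edge_law] is the size bias in [llaw]. A root without offspring has weight 0 in
    both, so its edge ball is irrelevant. *)
Lemma edge_lawE k b : edge_law p mu [set g | edge_ball g k.+1 = b] =
  (\sum_(t | tgraph (edge_col t) == b) llaw m0 d (q k.+1) t)%:E.
Proof.
have el : local_fun k.+1 (fun g : lgraph M => (edge_ball g k.+1, deg g [::])).
  move=> g; rewrite edge_ball_local; congr pair.
  have [_ _ aE] := restrP k.+1 g; rewrite /deg; congr #|` fset_set _|.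
  apply/funext => y; apply/propext; rewrite /mkset aE; split => [/and3P[]//|oy].
  by rewrite oy /=; exact: leq_trans (adj_size oy) _.
rewrite /edge_law -/d; set A := [set g | _].
have -> : (\int[mu]_(g in A) ((deg g [::])%:R)%:E = \int[mu]_g (phi b (plg k.+1 g [::]))%:E)%E.
  rewrite integral_mkcond.
  have E : (fun g : G => ((deg g [::])%:R : R)%:E) \_ A =
      (fun g : G => ((((edge_ball g k.+1, deg g [::]).1 == b)%:R *
         ((edge_ball g k.+1, deg g [::]).2)%:R) : R)%:E).
    apply/funext => g; rewrite /patch /=; case: ifPn => [|/negP]; rewrite inE => gA.
      by rewrite gA eqxx mul1r.
    by case: eqP => // _; rewrite mul0r.
  rewrite E; apply: ae_eq_integral => //.
  - exact: (local_measurable_fun (local_comp (fun x => ((x.1 == b)%:R * (x.2)%:R : R)%:E) el)).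
  - exact: measurable_finlaw (@plg_measurable R M D k.+1) (phi b).
  apply: (@aeS _ _ _ (fun g => treelike k.+1 g /\ small_degrees D k.+1 g)).
    exact: (@filterI _ _ (ae_filter_ringOfSetsType mu) _ _ (inv_ae_treelike _) (inv_ae_small_degrees _)).
  move=> g [gt gs] _; have gD : (nchild g [::] <= D)%N by apply: gs => //; exact: bfs_root (lgraphP g).
  have -> : deg g [::] = nchild g [::].
    rewrite -[LHS]/(size (gnbs g [::])) /nchild (@eq_in_count _ _ xpredT) ?count_predT // => y.
    rewrite mem_gnbs => oy; have [] // := gt [::] y _ _ oy; first exact: leq_trans (adj_size oy) _.
    by move=> /parentP[j]; case: (y).
  rewrite /phi size_kids_plg //=; congr EFin.
  have [->|n0] := posnP (nchild g [::]); first by rewrite !mulr0.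
  by rewrite (edge_ball_dec gt gs n0).
rewrite (integral_finlaw mu (@plg_measurable R M D k.+1)) -EFinM; congr EFin.
rewrite /llaw -mulr_sumr; congr (_ * _); rewrite (exchange_big_dep xpredT) //=.
apply: eq_bigr => t _; rewrite /phi.
case: (posnP (size (kids t))) => t0 /=; first by rewrite big_pred0 ?mul0r // => s; rewrite andbF.
case: eqP => tb.
  rewrite mul1r mulrC (bigD1 (side t 0, nth (pt0 D m0 k) (kids t) 0)) /=; last by rewrite tb !eqxx.
  by rewrite big1 ?addr0 // => s /andP[/andP[_ /eqP <-]]; rewrite eqxx.
rewrite !mul0r big_pred0 // => s; apply/negP => /andP[/eqP sb /eqP ts].
by apply: tb; rewrite ts.
Qed.

Lemma llaw_le1 k t : llaw m0 d (q k.+1) t <= 1.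
Proof.
rewrite /llaw mulrC ler_pdivrMr // mul1r (inv_mean_size k) big_mkcond /=.
apply: ler_sum => s _; case: ifP => // _.
by rewrite mulr_ge0 // qlaw_ge0.
Qed.

Lemma shannon_edge k :
  shannon (fun b : cgraph M => edge_law p mu [set g | edge_ball g k.+1 = b]) =
  (ent (llaw m0 d (q k.+1)))%:E.
Proof.
rewrite -(@shannon_fin R _ (cgraph M) (fun t => tgraph (edge_col (t : ptree M D k * ptree M D k)))).
- by congr shannon; apply/funext => b; exact: edge_lawE.
- by move=> s t /tgraph_inj/edge_col_inj.
- by move=> t; rewrite llaw_ge0 ?llaw_le1 // => s; exact: qlaw_ge0.
Qed.

Lemma shannon_offs : shannon (fun k => p [set k]) = (ent (fun j : 'I_D.+1 => offs p j))%:E.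
Proof.
rewrite -(@shannon_fin R _ nat (@nat_of_ord D.+1)).
- congr shannon; apply/funext => k; have [kD|Dk] := leqP k D.
    rewrite (eq_bigl (fun j : 'I_D.+1 => j == Ordinal (kD : (k < D.+1)%N))) ?big_pred1_eq //.
    by rewrite /offs fineK //; apply: fin_num_prob.
  rewrite big_pred0 ?pD // => j; apply/negP => /eqP jk.
  by have := ltn_ord j; rewrite jk ltnS leqNgt Dk.
- exact: val_inj.
move=> j; rewrite offs_ge0 /= -(sum_offs pD) (bigD1 j) //= lerDl.
by apply: sumr_ge0 => i _; exact: offs_ge0.
Qed.

(** The value at radius [k.+1], after the entropies of the labelings have cancelled. *)
Definition annealed k : R := ent (ordlaw (q k.+1)) - d / 2 * ent (plaw m0 d (q k.+1)) -
  ent (fun j : 'I_D.+1 => offs p j).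

Lemma Sigma_ballE k : Sigma_ball p mu k.+1 = (annealed k)%:E.
Proof.
rewrite /Sigma_ball shannon_vertex shannon_edge shannon_offs -EFinM -!EFinB; congr EFin.
rewrite /annealed; congr (_ - _); apply: labeled_entropy => //.
- by move=> t; exact: qlaw_ge0.
- exact: inv_canon_inv.
- exact: inv_plaw_sym.
Qed.

Lemma annealed_le k : annealed k.+1 <= annealed k.
Proof.
have := @entropy_decreases R M m0 D k d (q k.+2) (fun t => qlaw_ge0 mu t) d0 (inv_plaw_sym (k := k.+1)).
rewrite (push_tr_qlaw D mu k.+1) /annealed lerD2r; exact.
Qed.

End annealed.

(** * Empirical types of good colorings *)

Section empirical.
Variables (R : realType) (M : pfinType) (D : nat).
Local Notation G := (gspace R M).

(** Each vertex contributes equally many labelings, one per order, all with the type of that vertex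
    at their root; so the list of all labelings weighs the vertices equally. *)
Lemma finlaw_distr k n (E : {set {set 'I_n.+1}}) (f : {ffun 'I_n.+1 -> M}) t :
  finlaw (distr R E f) (fun g : G => lutype D k g [::] None) t =
  #|[set v | utype D (gnb E) f k v None == t]%SET|%:R / n.+1%:R.
Proof.
rewrite /finlaw [X in fine X]unif_lawE /= /rooted_labelings.
have [V VE] : exists V, V = enum 'I_n.+1 by exists (enum 'I_n.+1).
rewrite -!VE.
have sl (v : 'I_n.+1) : size (labelings (edge_sym E) (edge_irr E) V f v) =
    size (permutations V) by rewrite size_map.
set K := size (permutations _) in sl.
have K0 : K%:R != 0 :> R.
  by rewrite pnatr_eq0 -(sl ord0) size_eq0 labelings_neq0.
rewrite size_flatten count_flatten /shape -!map_comp !sumnE !big_map.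
have -> : (\sum_(v <- V) size (labelings (edge_sym E) (edge_irr E) V f v) = n.+1 * K)%N.
  rewrite (eq_bigr (fun=> K)); last by move=> v _; exact: sl.
  by rewrite VE big_enum sum_nat_const card_ord.
rewrite (eq_bigr (fun v => ((utype D (gnb E) f k v None == t) * K)%N)); last first.
  move=> v _ /=; rewrite /labelings count_map.
  rewrite (@eq_in_count _ _ (fun=> utype D (gnb E) f k v None == t)).
    by case: (_ == t); rewrite ?count_predT ?count_pred0 ?mul1n.
  move=> s; rewrite mem_permutations => sE /=.
  have L : lutype D k (bfs_graph (edge_sym E) (edge_irr E) s f v) [::] None =
      utype D (gnb E) f k v None.
    apply: (@lutype_bfs _ _ D (edge E)).
    - by rewrite (perm_uniq sE) VE enum_uniq.
    - by rewrite (perm_mem sE) VE mem_enum.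
    - by move=> x y _; rewrite (perm_mem sE) VE mem_enum.
    - by move=> x; exact: enum_uniq.
    - by move=> x y; rewrite mem_enum finset.in_set.
  by apply/idP/eqP; rewrite inE /preimage /mkset /= L.
rewrite -big_distrl /= VE big_enum -sum1dep_card [in RHS]big_mkcond /= !natrM.
rewrite -mulf_div divff // mulr1; congr (_%:R / _).
Qed.

Definition type_indic k (t : ptree M D k) (g : G) : R := (lutype D k g [::] None == t)%:R.

Lemma type_indic_bc k t : bounded_continuous (@type_indic k t).
Proof.
split; last by exists 1 => g; rewrite /type_indic ger0_norm // lern1; case: (_ == t).
apply: (@local_continuous R M k) => g; rewrite /type_indic; congr (_ == t)%:R.
exact: (@lutype_local M D k).
Qed.

Lemma Rintegral_type (nu : probability G R) k (t : ptree M D k) :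
  \int[nu]_g type_indic t g = finlaw nu (fun g : G => lutype D k g [::] None) t.
Proof.
rewrite /Rintegral (integral_finlaw nu (@lutype_measurable R M D k) (fun s => (s == t)%:R)) /=.
rewrite (bigD1 t) //= eqxx mul1r big1 ?addr0 // => s /negPf ->.
by rewrite mul0r.
Qed.

Lemma finlaw_restr (nu : probability G R) k (t : ptree M D k) :
  finlaw (restr_law nu k) (fun g : G => lutype D k g [::] None) t =
  finlaw nu (fun g : G => lutype D k g [::] None) t.
Proof. by rewrite /finlaw (restr_law_local [set t] nu (@lutype_local M D k)). Qed.

Variable dist : probability G R -> probability G R -> R.
Hypothesis dist_weak : weak_distance dist.

Lemma types_weak_open k (u : ptree M D k -> R) (delta : R) :
  weak_open [set nu : probability G R | forall t,
    `|finlaw nu (fun g : G => lutype D k g [::] None) t - u t| < delta].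
Proof.
move=> nu nuU; pose a t := delta - `|finlaw nu (fun g : G => lutype D k g [::] None) t - u t|.
exists #|{: ptree M D k}|, (fun i => type_indic (enum_val i)), (\big[Num.min/1]_t a t).
split; first by move=> i; exact: type_indic_bc.
  elim/big_ind: _ => // [x y x0 y0|t _]; first by rewrite lt_min x0.
  by rewrite subr_gt0; exact: nuU.
move=> nu' H t; have := H (enum_rank t); rewrite enum_rankK !Rintegral_type => ht.
have : `|finlaw nu' (fun g : G => lutype D k g [::] None) t -
     finlaw nu (fun g : G => lutype D k g [::] None) t| < a t.
  by apply: lt_le_trans ht _; exact: bigmin_le_cond.
rewrite /a ltrBrDr; apply: le_lt_trans; exact: ler_distD.
Qed.

(** [dist] is known only through its topology. Closeness of the finitely many type frequencies is
    weakly open, hence contains a [dist]-ball around [restr_law mu k], whose radius is the same for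
    all [n]. *)
Lemma good_coloring_types (mu : probability G R) k (delta : R) : 0 < delta ->
  exists2 eps0, 0 < eps0 & forall eps, eps <= eps0 ->
  forall n (E : {set {set 'I_n.+1}}) (f : {ffun 'I_n.+1 -> M}),
    f \in good_colorings dist E mu k eps -> forall t,
    `|#|[set v | utype D (gnb E) f k v None == t]%SET|%:R / n.+1%:R -
      finlaw mu (fun g : G => lutype D k g [::] None) t| < delta.
Proof.
move=> delta0; have [_ dsym _ dopen] := dist_weak.
have [e e0 He] := (dopen _).1 (@types_weak_open k (finlaw mu (fun g : G => lutype D k g [::] None)) delta)
  (restr_law mu k) (fun t => ltac:(by rewrite finlaw_restr subrr normr0)).
exists (e / 2); first by rewrite divr_gt0.
move=> eps epse n E f; rewrite finset.in_set => fE t.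
have := He (restr_law (distr R E f) k); rewrite dsym => /(_ _ t).
rewrite finlaw_restr finlaw_distr; apply.
by apply: le_lt_trans fE _; apply: le_lt_trans epse _; lra.
Qed.

End empirical.

(** * Counting good colorings *)

Section count_colorings.
Variables (R : realType) (M : finType) (m0 : M) (D k : nat).
Local Notation pt := (ptree M D).
Local Notation pt0 := (pt0 D m0).
Variables (q : pt k.+1 -> R) (d : R).
Hypotheses (q0 : forall P, 0 <= q P) (q1 : \sum_P q P = 1) (qinv : canon_inv q)
  (d0 : 0 < d) (dE : d = \sum_P q P * (size (kids P))%:R).
Local Notation u := (push (@canon M D k.+1) q).
Local Notation ow := (ordlaw q).
Local Notation pl := (plaw m0 d q).

Lemma ordlaw_canon P : ow (ord P) = ow (canon P).
Proof.
have oc (l : seq (pt k)) : map (@canon M D k) (sort (@rank_le _) (map (@canon M D k) l)) =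
    sort (@rank_le _) (map (@canon M D k) l).
  rewrite -[RHS]map_id; apply/eq_in_map => x.
  by rewrite mem_sort => /mapP[y _ ->]; rewrite canon_idem.
have cE : ord (canon P) = canon P.
  by apply: ptree_eqP; rewrite ?rootc_ord // kids_ord kids_canon oc.
have pE Q : \prod_(i < size (kids Q)) ncanon R (etype m0 Q i).2 =
    \prod_(x <- map (@canon M D k) (kids Q)) ncanon R x.
  by rewrite big_map (big_nth (pt0 k)) big_mkord.
rewrite -[in RHS]cE !(ordlawE m0) // !pE kids_canon oc.
congr (_ * _); first by apply: qinv; rewrite canon_idem.
by apply: perm_big; rewrite perm_sym perm_sort.
Qed.

Lemma ordlaw_ge0 P : 0 <= ow P. Proof. exact: push_ge0. Qed.

Lemma ordlaw_le1 P : ow P <= 1.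
Proof.
rewrite -q1 -(sum_push1 (@ord M D k) q) (bigD1 P) //= lerDl.
by apply: sumr_ge0 => s _; exact: push_ge0.
Qed.

Lemma sum_ordlaw_size j : \sum_(P | size (kids P) == j) ow P =
  \sum_(P | size (kids P) == j) q P.
Proof.
transitivity (\sum_P ow P * (size (kids P) == j)%:R).
  by rewrite big_mkcond; apply: eq_bigr => P _; case: (_ == j); rewrite ?mulr1 ?mulr0.
rewrite (sum_push (@ord M D k) q (fun P => (size (kids P) == j)%:R)) [RHS]big_mkcond.
by apply: eq_bigr => P _; rewrite kids_ord size_map; case: (_ == j); rewrite ?mulr1 ?mulr0.
Qed.

Lemma sum_plaw1 : \sum_t pl t = 1.
Proof.
apply: (mulfI (lt0r_neq0 d0)); rewrite mulr1 [RHS]dE.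
have := sum_plaw m0 q d0 (fun=> 1); under [X in _ = d * X]eq_bigr do rewrite mulr1.
by move=> <-; apply: eq_bigr => P _; rewrite sumr_const card_ord.
Qed.

Section one_graph.
Variables (n e : nat) (dn : 'I_n.+1 -> nat) (delta : R).
Hypotheses (de : (\sum_v dn v = e.*2)%N) (dD : forall v, (dn v <= D)%N).
Let m : R := n.+1%:R.
Let K1 : R := #|{: pt k.+1}|%:R.
Let K2 : R := #|{: pt k * pt k}|%:R.
(** Chosen so that [C0 * (d / 2)] exceeds [1 + D%:R * K1]. The edge counts err by at most
    [delta * K1 * D%:R] per vertex and the average degree by [delta], while the latter is at least
    [d / 2]. *)
Let C0 : R := 1 + 2 * (1 + D%:R * K1) / d.
Let L : R := - ln delta.
Hypotheses (delta0 : 0 < delta) (deltaC : delta * (1 + C0) <= 1)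
  (deltad : delta <= d / 2) (em : `|e.*2%:R / m - d| <= delta).

Let w P : R := ow P + delta.
Let p' t : R := pl t + C0 * delta.

Definition good_types (o : {ffun 'I_n.+1 -> pt k.+1}) : bool :=
  [forall v, ord (o v) == o v] &&
  [forall t, `|#|[set v | canon (o v) == t]%SET|%:R / m - u t| <= delta].

Let m_gt0 : 0 < m. Proof. by rewrite ltr0n. Qed.
Let K1_ge0 : 0 <= K1. Proof. exact: ler0n. Qed.

Let C0_ge1 : 1 <= C0.
Proof. by rewrite lerDl divr_ge0 ?mulr_ge0 ?addr_ge0 ?mulr_ge0 // ltW. Qed.

Let delta_le : delta <= 1.
Proof. by apply: le_trans deltaC; rewrite ler_peMr //; [exact: ltW|have := C0_ge1; lra]. Qed.

(** [deltaC] makes [1 + C0 * delta] at most the inverse of [delta], so [x] lies between [delta] and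
    its inverse. *)
Lemma ln_bound x : delta <= x -> x <= 1 + C0 * delta -> `|ln x| <= L.
Proof.
move=> dx xd; have x0 : 0 < x by exact: lt_le_trans dx.
rewrite ler_norml /L opprK ler_ln ?posrE // dx /=.
rewrite -lnV ?posrE // ler_ln ?posrE ?invr_gt0 //.
apply: le_trans xd _; rewrite -[_^-1]mul1r ler_pdivlMr //.
apply: le_trans deltaC; rewrite mulrC ler_wpM2l ?(ltW delta0) // lerD2l.
by rewrite ler_piMr // (le_trans _ C0_ge1).
Qed.

Lemma good_average o (h : pt k.+1 -> R) H : good_types o -> (forall t, `|h t| <= H) ->
  `|(\sum_v h (canon (o v))) / m - \sum_P q P * h (canon P)| <= delta * K1 * H.
Proof.
move=> /andP[_ /forallP go] hH.
have -> : \sum_v h (canon (o v)) = \sum_t #|[set v | canon (o v) == t]%SET|%:R * h t.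
  rewrite (partition_big (fun v => canon (o v)) xpredT) //; apply: eq_bigr => t _.
  rewrite -sum1dep_card natr_sum mulr_suml; apply: eq_big => v; first by [].
  by move=> /eqP->; rewrite mul1r.
rewrite -(sum_push (@canon M D k.+1) q h) mulr_suml -sumrB.
apply: le_trans (ler_norm_sum _ _ _) _.
apply: (@le_trans _ _ (\sum_(t : pt k.+1) delta * H)); last first.
  by rewrite sumr_const -[X in X <= _]mulr_natr mulrAC.
apply: ler_sum => t _; rewrite mulrAC -mulrBl normrM.
by apply: ler_pM => //; exact: go.
Qed.

(* The weights [w] and [p'] are the limit laws thickened by a multiple of
   [delta], so that their logarithms are bounded by [L]. *)
Lemma good_vertex_weights o : good_types o ->
  expR (m * (- ent ow - delta * K1 * L)) <= \prod_v w (o v).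
Proof.
move=> go; have w0 P : 0 < w P by rewrite ltr_wpDl // ordlaw_ge0.
rewrite -[leRHS]lnK ?posrE ?prodr_gt0 // ler_expR ln_prod //.
have /andP[/forallP oo _] := go.
have -> : \sum_v ln (w (o v)) = \sum_v ln (w (canon (o v))).
  by apply: eq_bigr => v _; rewrite /w -ordlaw_canon (eqP (oo v)).
have Hw t : `|ln (w t)| <= L.
  apply: ln_bound; rewrite /w ?lerDr ?ordlaw_ge0 // lerD ?ordlaw_le1 //.
  by rewrite ler_peMl // ltW.
have := good_average go Hw; rewrite ler_norml => /andP[+ _].
rewrite lerBrDr ler_pdivlMr // mulrC; apply: le_trans.
rewrite ler_pM2l // [leRHS]addrC lerD2r.
have -> : \sum_P q P * ln (w (canon P)) = \sum_P ow P * ln (w P).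
  rewrite (sum_push (@ord M D k) q (fun P => ln (w P))); apply: eq_bigr => P _.
  by rewrite /w ordlaw_canon.
rewrite /ent opprK; apply: ler_sum => P _.
have [->|o0] := eqVneq (ow P) 0; first by rewrite !mul0r.
have op : 0 < ow P by rewrite lt_def o0 ordlaw_ge0.
by rewrite ler_wpM2l ?ordlaw_ge0 // ler_ln ?posrE // lerDl ltW.
Qed.

Lemma ntypeE (o : {ffun 'I_n.+1 -> pt k.+1}) t : (forall v, size (kids (o v)) = dn v) ->
  ntype m0 dn o t = (\sum_v edge_count m0 (o v) t)%N.
Proof.
move=> so; rewrite /ntype -sum1dep_card big_mkcond /=.
rewrite -(sig_big_dep (fun=> true) (fun _ _ => true)
   (fun v (i : 'I_(dn v)) => if etype m0 (o v) i == t then 1%N else 0%N)) /=.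
apply: eq_bigr => v _; rewrite /edge_count so -sum1_count.
have -> : iota 0 (dn v) = index_iota 0 (dn v) by rewrite /index_iota subn0.
by rewrite big_mkord [RHS]big_mkcond.
Qed.

Lemma good_ntype o t : good_types o -> (forall v, size (kids (o v)) = dn v) ->
  `|(ntype m0 dn o t)%:R / m - d * pl t| <= delta * K1 * D%:R.
Proof.
move=> go so; rewrite ntypeE //.
have H s : `|(edge_count m0 s t)%:R : R| <= D%:R by rewrite ger0_norm // ler_nat edge_count_le.
have := good_average go H.
have -> : \sum_v (edge_count m0 (canon (o v)) t)%:R = ((\sum_v edge_count m0 (o v) t)%N)%:R :> R.
  by rewrite natr_sum; apply: eq_bigr => v _; congr _%:R; apply: edge_count_canon; exact: canon_idem.
have -> // : \sum_P q P * (edge_count m0 (canon P) t)%:R = d * pl t.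
rewrite /plaw mulrA divff ?gt_eqF // mul1r; apply: eq_bigr => P _.
by congr (_ * _%:R); apply: edge_count_canon; exact: canon_idem.
Qed.

Lemma good_ntype_le o t : good_types o -> (forall v, size (kids (o v)) = dn v) ->
  (ntype m0 dn o t)%:R <= e.*2%:R * p' t.
Proof.
move=> go so; have := good_ntype t go so; rewrite ler_norml => /andP[_].
rewrite lerBlDr ler_pdivrMr // => h; apply: le_trans h _.
move: em; rewrite ler_norml => /andP[e1 _].
have -> : e.*2%:R * p' t = e.*2%:R / m * p' t * m by rewrite mulrAC divfK // gt_eqF.
rewrite ler_pM2r //.
set a := e.*2%:R / m in e1 *; have ad : d - delta <= a by lra.
have p0 : 0 <= pl t by apply: plaw_ge0.
have p1 : pl t <= 1.
  by rewrite -sum_plaw1 (bigD1 t) //= lerDl; apply: sumr_ge0 => s _; exact: plaw_ge0.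
have ad2 : d / 2 <= a by have := deltad; lra.
have h1 : (d - delta) * pl t <= a * pl t by exact: ler_wpM2r.
have h2 : delta * pl t <= delta by rewrite ler_piMr // ltW.
have h3 : delta * (1 + D%:R * K1) <= a * (C0 * delta).
  rewrite mulrCA mulrA [X in _ <= X]mulrC ler_wpM2l ?(ltW delta0) //.
  apply: (@le_trans _ _ (C0 * (d / 2))); last by rewrite ler_pM2l // (lt_le_trans _ C0_ge1).
  have -> : C0 * (d / 2) = d / 2 + (1 + D%:R * K1).
    rewrite /C0 mulrDl mul1r; congr (_ + _).
    by rewrite -[RHS]mulr1 -[X in _ = _ * X](divff (lt0r_neq0 d0)); lra.
  by rewrite lerDr divr_ge0 // ltW.
rewrite /p' mulrDr; have -> : delta * K1 * D%:R = delta * (1 + D%:R * K1) - delta by lra.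
have -> : d * pl t = (d - delta) * pl t + delta * pl t by lra.
lra.
Qed.

(** The first term pays for the mass added to [pl]; the second for the deviation of the edge counts,
    times the bound [L] on the logarithms. The halves come from the square root. *)
Let beta : R := d / 2 * (K2 * C0 * delta) + delta * K1 * D%:R * K2 * L / 2.

Lemma good_edge_weights o : good_types o -> (forall v, size (kids (o v)) = dn v) ->
  \prod_t Num.sqrt (p' t) ^+ ntype m0 dn o t <= expR (m * (- (d / 2) * ent pl + beta)).
Proof.
move=> go so.
have p0 t : 0 <= pl t by apply: plaw_ge0.
have p1 t : pl t <= 1.
  by rewrite -sum_plaw1 (bigD1 t) //= lerDl; apply: sumr_ge0 => s _; exact: plaw_ge0.
have p'0 t : 0 < p' t by rewrite ltr_wpDl // mulr_gt0 // (lt_le_trans _ C0_ge1).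
have s0 t : 0 < Num.sqrt (p' t) by rewrite sqrtr_gt0.
rewrite -[leLHS]lnK ?posrE ?prodr_gt0 // => [|t _]; last by rewrite exprn_gt0.
rewrite ler_expR ln_prod => [|t]; last by rewrite exprn_gt0.
have E t : ln (Num.sqrt (p' t) ^+ ntype m0 dn o t) = m * ((ntype m0 dn o t)%:R / m * ln (p' t) / 2).
  rewrite lnXn //; have -> : ln (Num.sqrt (p' t)) = ln (p' t) / 2.
    by rewrite -[in RHS](sqr_sqrtr (ltW (p'0 t))) lnXn // mulr2n; lra.
  rewrite -[LHS]mulr_natl; set a := (ntype m0 dn o t)%:R; set l := ln _.
  have {1}-> : a = m * (a / m) by rewrite mulrC divfK // gt_eqF.
  by rewrite -!mulrA.
under eq_bigr do rewrite E.
rewrite -mulr_sumr ler_pM2l //.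
have -> : - (d / 2) * ent pl + beta = \sum_t (d * (pl t * ln (pl t) + C0 * delta) / 2 +
    delta * K1 * D%:R * L / 2).
  have cE (x : R) : \sum_(t : pt k * pt k) x = K2 * x by rewrite sumr_const -mulr_natl.
  rewrite big_split /= cE -mulr_suml -mulr_sumr big_split /= cE /ent /beta.
  set X := \sum_t _; move: K2 K1 C0 L X D%:R => K2' K1' C0' L' X' D'; lra.
apply: ler_sum => t _.
have Hl : `|ln (p' t)| <= L.
  apply: ln_bound; rewrite /p' ?lerD2r //.
  by apply: (@le_trans _ _ (C0 * delta)); rewrite ?ler_peMl ?lerDr // ltW.
have h1 : (ntype m0 dn o t)%:R / m * ln (p' t) <= d * pl t * ln (p' t) + delta * K1 * D%:R * L.
  rewrite -lerBlDl -mulrBl; apply: le_trans (ler_norm _) _; rewrite normrM.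
  by apply: ler_pM => //; exact: good_ntype.
have h2 : pl t * ln (p' t) <= pl t * ln (pl t) + C0 * delta.
  have C0d : 0 <= C0 * delta by rewrite mulr_ge0 ?(le_trans _ C0_ge1) // ltW.
  have [->|pt0] := eqVneq (pl t) 0; first by rewrite !mul0r add0r.
  have ptp : 0 < pl t by rewrite lt_def pt0 p0.
  rewrite -lerBlDl -mulrBr -ln_div ?posrE //.
  apply: le_trans (ler_wpM2l (p0 t) (ln_le_sub1 _)) _; first by rewrite divr_gt0.
  by rewrite mulrBr mulrCA divff // !mulr1 /p' addrAC subrr add0r.
have h3 : d * (pl t * ln (p' t)) <= d * (pl t * ln (pl t) + C0 * delta) by rewrite ler_pM2l.
move: h1 h3; rewrite -[d * pl t * _]mulrA.
move: (_ / m * ln (p' t)) (delta * K1 * D%:R * L) (d * (pl t * ln (p' t))) (d * _) => a b c c'; lra.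
Qed.

Let rho j : R := \sum_(P : pt k.+1 | size (kids P) == j) q P.

(** In this order: the losses in the vertex weights, in the edge weights and in the total mass of
    the thickened edge law. *)
Definition count_error : R := delta * K1 * L + beta + D%:R * (K2 * C0 * delta).

(** Polynomial in [e]: the loss of the type count, times the bound from [npsimple_lower] on the
    inverse proportion of simple configurations. *)
Definition count_factor : R := (expR 1 * (e.*2).+1%:R) ^+ #|{: pt k * pt k}| *
  (e ^ (D.+1 * D) * e.*2 ^ (D.+1 * D).*2)%:R.

(** [card_good_le] for the thickened laws, with the factorial of [e.*2] traded for the number of
    simple configurations. The latter cancels in the average over configurations. *)
Lemma count_good_le (S : {set conf e dn * {ffun 'I_n.+1 -> M}}) :
  (3 * (D.+1 * D) < e)%N ->
  (forall x f, (x, f) \in S -> simple x && good_types (otype D k x f)) ->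
  #|S|%:R <= #|[set x : conf e dn | simple x]%SET|%:R *
    (expR (\sum_v ln (rho (dn v) + K1 * delta) +
       m * (ent ow - d / 2 * ent pl + count_error)) * count_factor).
Proof.
move=> ce HS.
have p0 t : 0 <= pl t by apply: plaw_ge0.
have C0d : 0 <= C0 * delta by rewrite mulr_ge0 ?(le_trans _ C0_ge1) // ltW.
have p'0 t : 0 < p' t by rewrite ltr_wpDl // mulr_gt0 // (lt_le_trans _ C0_ge1).
have w0 P : 0 <= w P by rewrite addr_ge0 ?ordlaw_ge0 // ltW.
have H := @card_good_le R M m0 D k n e dn de dD S good_types w p'
  (expR (m * (- ent ow - delta * K1 * L))) (expR (m * (- (d / 2) * ent pl + beta))) HS w0 p'0 (expR_ge0 _) (expR_ge0 _)
  (fun o go so => And3 (good_vertex_weights go) (fun t => good_ntype_le t go so) (good_edge_weights go so)).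
have hw : \prod_v (\sum_(P | size (kids P) == dn v) w P) <=
    expR (\sum_v ln (rho (dn v) + K1 * delta)).
  have K1d : 0 < K1 * delta.
    by rewrite mulr_gt0 // ltr0n; apply/card_gt0P; exists (pt0 k.+1).
  have r0 j : 0 < rho j + K1 * delta by rewrite ltr_wpDl // sumr_ge0.
  rewrite expR_sum; apply: ler_prod => v _; rewrite sumr_ge0 //= lnK ?posrE //.
  rewrite big_split /= sum_ordlaw_size lerD2l sumr_const -[leLHS]mulr_natl ler_wpM2r ?(ltW delta0) //.
  by rewrite ler_nat max_card.
have hp : (\sum_t p' t) ^+ e <= expR (m * (D%:R * (K2 * C0 * delta))).
  have cE (x : R) : \sum_(t : pt k * pt k) x = K2 * x by rewrite sumr_const -mulr_natl.
  rewrite big_split /= sum_plaw1 cE mulrA.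
  have x0 : 0 <= K2 * C0 * delta by rewrite -mulrA mulr_ge0.
  apply: (@le_trans _ _ (expR (K2 * C0 * delta) ^+ e)).
    by apply: lerXn2r; rewrite ?nnegrE ?expR_ge0 ?addr_ge0 ?expR_ge1Dx.
  rewrite -expRM_natl ler_expR [leRHS]mulrA ler_wpM2r // -natrM ler_nat.
  apply: (@leq_trans (\sum_v dn v)); first by rewrite de -addnn leq_addr.
  by apply: leq_trans (leq_sum _ (fun v _ => dD v)) _; rewrite sum_nat_const card_ord.
have hs : ((e.*2)`!)%:R <= (e ^ (D.+1 * D) * e.*2 ^ (D.+1 * D).*2)%:R *
    #|[set x : conf e dn | simple x]%SET|%:R :> R.
  rewrite -natrM ler_nat; apply: leq_trans (npsimple_lower de dD ce) _.
  by rewrite leq_mul2l (npsimple_le_simple de) orbT.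
set Z := #|[set x : conf e dn | simple x]%SET|%:R in hs *.
rewrite -(ler_pM2r (expR_gt0 (m * (- ent ow - delta * K1 * L)))).
apply: le_trans H _.
apply: (@le_trans _ _ (expR (\sum_v ln (rho (dn v) + K1 * delta)) *
   ((expR 1 * (e.*2).+1%:R) ^+ #|{: pt k * pt k}| * expR (m * (D%:R * (K2 * C0 * delta))) *
    expR (m * (- (d / 2) * ent pl + beta)) *
    ((e ^ (D.+1 * D) * e.*2 ^ (D.+1 * D).*2)%:R * Z)))).
  have c1 : 0 <= (expR 1 * (e.*2).+1%:R) ^+ #|{: pt k * pt k}| :> R.
    by rewrite exprn_ge0 // mulr_ge0 ?expR_ge0.
  have sp : 0 <= (\sum_t p' t) ^+ e by rewrite exprn_ge0 // sumr_ge0 // => t _; exact: ltW.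
  apply: ler_pM => //; first by rewrite prodr_ge0 // => v _; exact: sumr_ge0.
    by rewrite !mulr_ge0 ?expR_ge0.
  apply: ler_pM => //; first by rewrite !mulr_ge0 ?expR_ge0.
  by rewrite ler_wpM2r ?expR_ge0 // ler_wpM2l.
rewrite /count_factor le_eqVlt; apply/orP; left; apply/eqP.
have -> : expR (\sum_v ln (rho (dn v) + K1 * delta) + m * (ent ow - d / 2 * ent pl + count_error)) =
   expR (\sum_v ln (rho (dn v) + K1 * delta)) * expR (m * (D%:R * (K2 * C0 * delta))) *
   expR (m * (- (d / 2) * ent pl + beta)) / expR (m * (- ent ow - delta * K1 * L)).
  rewrite -expRN -!expRD /count_error; congr expR.
  move: (\sum_v _) beta (D%:R * _) (delta * K1 * L) (ent ow) (ent pl) => a1 a2 a3 a4 a5 a6.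
  move: m => m'; lra.
have := expR_gt0 (m * (- ent ow - delta * K1 * L)); set Q := expR _ => Q0.
set A := expR (\sum_v _); set B := expR (m * (D%:R * _)); set C := expR (m * (- _ * _ + _)).
set F := _ ^+ _; set G := (_ * _)%:R.
have -> : Z * (A * B * C / Q * (F * G)) * Q = Z * (A * B * C * (F * G)) * (Q^-1 * Q).
  by move: (Q^-1) (Q) A B C F G (Z) => qi Q' A' B' C' F' G' Z'; lra.
rewrite mulVf ?gt_eqF // mulr1.
by move: A B C F G (Z) => A' B' C' F' G' Z'; lra.
Qed.

End one_graph.
End count_colorings.

(** * Upper bound on the entropy quantiles *)

Lemma ord_star (M : finType) (D : nat) (T : eqType) (nb : T -> seq T) (col : T -> M) k x l :
  ord (star D nb col k x l) = star D nb col k x l.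
Proof.
apply: ptree_eqP; rewrite ?rootc_ord // kids_ord /star kids_node; case: ifP => // _.
by rewrite -map_comp; apply: eq_map => y; exact: canon_idem.
Qed.

Section markov.
Variables (R : realType) (M : pfinType) (p : probability nat R) (D : nat).
Hypothesis pD : forall k, (D < k)%N -> p [set k] = 0%E.
Local Notation G := (gspace R M).
Variables (dist : probability G R -> probability G R -> R)
  (mu : probability G R) (dn : forall n : nat, 'I_n.+1 -> nat).
Arguments dn {n}.
Hypothesis mu_inv : invariant_process p mu.
Local Notation m0 := (point : M).
Local Notation q k := (@qlaw R M D mu k).
Let d := fine (mean p).
Hypothesis d0 : 0 < d.
Variables (k n e : nat) (delta eps alpha : R).
Hypotheses (de : (\sum_(v < n.+1) dn v = e.*2)%N) (dD : forall v : 'I_n.+1, (dn v <= D)%N).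
Let m : R := n.+1%:R.
Let K1 : R := #|{: ptree M D k.+1}|%:R.
Let C0 : R := 1 + 2 * (1 + D%:R * K1) / d.
Hypotheses (delta0 : 0 < delta) (deltaC : delta * (1 + C0) <= 1)
  (deltad : delta <= d / 2) (em : `|e.*2%:R / m - d| <= delta)
  (ce : (3 * (D.+1 * D) < e)%N) (alpha0 : 0 < alpha).
Hypothesis close : forall (E : {set {set 'I_n.+1}}) (f : {ffun 'I_n.+1 -> M}),
    f \in good_colorings dist E mu k.+1 eps -> forall t,
    `|#|[set v | utype D (gnb E) f k.+1 v None == t]%SET|%:R / n.+1%:R -
      finlaw mu (fun g : G => lutype D k.+1 g [::] None) t| < delta.

Definition quantile_bound : R :=
  n.+1%:R^-1 * (\sum_(v < n.+1) ln (offs p (dn v) + K1 * delta)) +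
  (ent (ordlaw (q k.+1)) - d / 2 * ent (plaw m0 d (q k.+1)) + count_error M D k d delta) +
  (ln (count_factor R M D k e) - ln alpha) / m.

Lemma count_factor_gt0 : 0 < count_factor R M D k e.
Proof.
have e0 : (0 < e)%N by exact: leq_ltn_trans ce.
rewrite /count_factor mulr_gt0 ?exprn_gt0 ?mulr_gt0 ?expR_gt0 //.
by rewrite ltr0n muln_gt0 !expn_gt0 double_gt0 e0.
Qed.

Let S : {set conf e (@dn n) * {ffun 'I_n.+1 -> M}} :=
  [set y | simple y.1 && (y.2 \in good_colorings dist (edges_of y.1) mu k.+1 eps)]%SET.

Lemma good_pairs x f : (x, f) \in S ->
  simple x && good_types (q k.+1) delta (otype D k x f).
Proof.
rewrite finset.in_set /= => /andP[sx fE]; rewrite sx /=; apply/andP; split.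
  by apply/forallP => v; rewrite /otype ffunE ord_star.
apply/forallP => t; have := close fE t; rewrite (inv_law_lutype mu_inv) => /ltW.
congr (`|_%:R / _ - _| <= _); apply: eq_card => v; rewrite !finset.in_set.
by rewrite canon_otype.
Qed.

Lemma card_good_pairs :
  (#|S| = \sum_(x : conf e (@dn n) | simple x) #|good_colorings dist (edges_of x) mu k.+1 eps|)%N.
Proof.
rewrite -sum1_card (eq_bigl (fun y => simple y.1 && (y.2 \in good_colorings dist (edges_of y.1) mu k.+1 eps))); last first.
  by move=> y; rewrite finset.in_set.
rewrite -(pair_big_dep (fun x => simple x)
  (fun x f => f \in good_colorings dist (edges_of x) mu k.+1 eps) (fun _ _ => 1%N)) /=.
by apply: eq_bigr => x _; rewrite sum1_card.
Qed.

Lemma markov_colorings (r : R) :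
  alpha <= prob_entropy_ge dist (@dn) n mu k.+1 eps r%:E ->
  alpha * expR (r * m) <= expR (\sum_(v < n.+1) ln (offs p (dn v) + K1 * delta) +
    m * (ent (ordlaw (q k.+1)) - d / 2 * ent (plaw m0 d (q k.+1)) + count_error M D k d delta)) *
    count_factor R M D k e.
Proof.
rewrite /prob_entropy_ge; set A := [set E in _ | _]%SET; set Gr := graphs _ => hA.
(* If there were no graph, division by zero would make the probability 0, below [alpha]. *)
have Gr0 : 0 < #|Gr|%:R :> R.
  rewrite lt_def ler0n andbT; apply/eqP => Gr0; move: hA; rewrite Gr0 invr0 mulr0.
  by rewrite leNgt alpha0.
move: hA; rewrite ler_pdivlMr // => hA.
have m0' : 0 < m by rewrite ltr0n.
have hF E : E \in A -> expR (r * m) <= #|good_colorings dist E mu k.+1 eps|%:R.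
  rewrite finset.in_set => /andP[_]; rewrite /coloring_entropy; case: eqP => [_|/eqP c0].
    by rewrite leeNy_eq.
  rewrite lee_fin ler_pdivlMr // => h.
  by rewrite -[leRHS]lnK ?ler_expR // posrE ltr0n lt0n.
have hS : #|A|%:R * expR (r * m) <= (\sum_(E in Gr) #|good_colorings dist E mu k.+1 eps|)%:R.
  apply: (@le_trans _ _ (\sum_(E in A) #|good_colorings dist E mu k.+1 eps|%:R)).
    by rewrite mulr_natl -sumr_const; apply: ler_sum => E EA; exact: hF.
  rewrite natr_sum [leRHS]big_mkcond [leLHS]big_mkcond /=; apply: ler_sum => E _.
  by rewrite finset.in_set; case: (E \in Gr) => //=; case: ifP.
have sE := sum_simple de (fun E => #|good_colorings dist E mu k.+1 eps|).
rewrite -card_good_pairs in sE.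
have [G0 GG] : exists G0, G0 \in Gr by apply/card_gt0P; rewrite -(ltr0n R).
have [x xG] := ex_fiber de GG.
have Z0 : 0 < #|[set x : conf e (@dn n) | simple x]%SET|%:R :> R.
  rewrite ltr0n; apply/card_gt0P; exists x; move: xG.
  by rewrite !finset.in_set => /andP[].
set Z := #|[set x : conf e (@dn n) | simple x]%SET| in sE Z0.
have hC := @count_good_le R M m0 D k (q k.+1) d (@qlaw_ge0 R M D mu k.+1) (sum_qlaw D mu k.+1)
  (inv_canon_inv mu_inv (k := k.+1)) d0 (inv_mean_size pD mu_inv k) n e (@dn n) delta de dD
  delta0 deltaC deltad em S ce good_pairs.
rewrite -(ler_pM2l Z0); apply: le_trans (_ : #|S|%:R <= _); last first.
  have -> : \sum_(v < n.+1) ln (offs p (dn v) + K1 * delta) =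
      \sum_(v < n.+1) ln (\sum_(t : ptree M D k.+1 | size (kids t) == dn v) q k.+1 t + K1 * delta).
    by apply: eq_bigr => v _; rewrite (inv_law_size pD mu_inv).
  exact: hC.
rewrite -(ler_pM2r Gr0) -natrM sE natrM -mulrA ler_pM2l // mulrAC.
by apply: le_trans hS; rewrite ler_wpM2r ?expR_ge0.
Qed.

Lemma quantile_le : (entropy_quantile dist (@dn) n mu k.+1 eps alpha <= quantile_bound%:E)%E.
Proof.
apply: ge_ereal_sup => h [[->|/andP[h0 hy]] ha]; first exact: leNye.
case: h h0 hy ha => [r| |] // _ _ /markov_colorings; rewrite lee_fin.
have m0' : 0 < m by rewrite ltr0n.
have cf := count_factor_gt0.
set Y := \sum_(v < _) _; set B := _ - _ + _ => h.
have : ln (alpha * expR (r * m)) <= ln (expR (Y + m * B) * count_factor R M D k e).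
  by rewrite ler_ln ?posrE //; apply: mulr_gt0 => //; exact: expR_gt0.
have lE (c x : R) : 0 < c -> ln (c * expR x) = ln c + x.
  by move=> c0; rewrite lnM ?posrE ?expR_gt0 // expRK.
rewrite [_ * count_factor _ _ _ _ _]mulrC !lE // /quantile_bound -/m -/Y -/B => H.
move: B Y (ln (count_factor R M D k e)) {h} H => B' Y' c H.
rewrite -(ler_pM2r m0') mulrDl mulrDl divfK ?gt_eqF //.
have -> : m^-1 * Y' * m = Y' by rewrite mulrC mulrA divff ?mul1r // gt_eqF.
by move: H; rewrite [m * _]mulrC; move: (r * m) (B' * m) => a b; lra.
Qed.

End markov.

(** * Limits *)

Section real_bounds.
Variable R : realType.

(** A crude bound, enough for the logarithm of a polynomial factor to vanish after division by the
    number of vertices. *)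
Lemma ln_le_sqrt (x : R) : 0 < x -> ln x <= 2 * Num.sqrt x.
Proof.
move=> x0; have s0 : 0 < Num.sqrt x by rewrite sqrtr_gt0.
rewrite -[X in ln X](sqr_sqrtr (ltW x0)) lnXn // mulr2n; have := ln_le_sub1 s0; lra.
Qed.

Lemma xlnx_small (s : R) : 0 < s -> s <= 1 -> s ^+ 2 * - ln (s ^+ 2) <= 2 * s.
Proof.
move=> s0 s1; rewrite lnXn // mulr2n.
have h : s * - ln s <= 1.
  rewrite -lnV ?posrE //; apply: le_trans (ler_wpM2l (ltW s0) (ln_le_sub1 _)) _.
    by rewrite invr_gt0.
  rewrite mulrBr divff ?gt_eqF // mulr1; lra.
have -> : s ^+ 2 * - (ln s + ln s) = 2 * s * (s * - ln s) by rewrite expr2; lra.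
by rewrite -[leRHS]mulr1 ler_wpM2l // mulr_ge0 // ltW.
Qed.

Variables (M : finType) (D k : nat) (d : R).
Hypothesis d0 : 0 < d.
Let K1 : R := #|{: ptree M D k.+1}|%:R.
Let C0 : R := 1 + 2 * (1 + D%:R * K1) / d.

Lemma count_error_small (eta : R) : 0 < eta -> exists delta : R,
  [/\ 0 < delta, delta * (1 + C0) <= 1, delta <= d / 2 &
      count_error M D k d delta + D.+1%:R * K1 * delta + 3 * delta <= eta].
Proof.
move=> eta0.
have K10 : 0 <= K1 by [].
have C00 : 0 < 1 + C0.
  by rewrite addrA ltr_wpDr // divr_ge0 ?mulr_ge0 ?addr_ge0 ?mulr_ge0 // ltW.
pose K2 : R := #|{: ptree M D k * ptree M D k}|%:R.
have K20 : 0 <= K2 by [].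
pose a := K1 + K1 * D%:R * K2 / 2.
pose b := d / 2 * (K2 * C0) + D%:R * (K2 * C0) + D.+1%:R * K1 + 3.
have a0 : 0 <= a by rewrite addr_ge0 // !mulr_ge0.
have C0' : 0 <= C0 by rewrite addr_ge0 // divr_ge0 ?mulr_ge0 ?addr_ge0 ?mulr_ge0 // ltW.
have b0 : 0 < b by rewrite ltr_wpDl // !addr_ge0 ?mulr_ge0 ?divr_ge0 // ltW.
have x0 : 0 < 2 * a + b by rewrite ltr_wpDl // mulr_ge0.
(* [delta] will be [s ^+ 2], for which [delta * - ln delta] is at most [2 * s]. The bound 1 gives
   [s ^+ 2 <= s], the next two give the two conditions on [delta], and the last one gives the
   estimate by [eta]. *)
pose s := Num.min (Num.min 1 (1 + C0)^-1) (Num.min (d / 2) (eta / (2 * a + b))).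
have s0 : 0 < s by rewrite !lt_min invr_gt0 C00 !divr_gt0 //= ltr01.
have : s <= s by []; rewrite {2}/s !le_min => /andP[/andP[s1 s2] /andP[s3 s4]].
have ss : s ^+ 2 <= s by rewrite expr2 ler_piMr // ltW.
exists (s ^+ 2); split.
- by rewrite exprn_gt0.
- by rewrite -ler_pdivlMr // mul1r; exact: le_trans ss s2.
- exact: le_trans ss s3.
have h := xlnx_small s0 s1.
have -> : count_error M D k d (s ^+ 2) + D.+1%:R * K1 * s ^+ 2 + 3 * s ^+ 2 =
    a * (s ^+ 2 * - ln (s ^+ 2)) + b * s ^+ 2.
  rewrite /count_error /a /b -/K1 -/C0 -/K2.
  move: (s ^+ 2) (ln _) (K1) (K2) (C0) (D%:R) (D.+1%:R) => t l k1 k2 c0 dd dd1; lra.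
apply: (@le_trans _ _ (a * (2 * s) + b * s)).
  by apply: lerD; apply: ler_wpM2l => //; exact: ltW.
have -> : a * (2 * s) + b * s = s * (2 * a + b) by lra.
by rewrite -ler_pdivlMr.
Qed.

Lemma ln_count_factor e m : (0 < e)%N -> (e.*2 <= m * D)%N -> (0 < m)%N ->
  ln (count_factor R M D k e) <=
  (#|{: ptree M D k * ptree M D k}| + 3 * (D.+1 * D))%:R * (1 + 2 * Num.sqrt D.+1%:R * Num.sqrt m%:R).
Proof.
move=> e0 em m0; rewrite /count_factor; move: #|_| (D.+1 * D)%N => K c.
set X : R := ln (e.*2).+1%:R.
have e20 : (0 < e.*2)%N by rewrite double_gt0.
have hX : X <= 2 * Num.sqrt D.+1%:R * Num.sqrt m%:R.
  apply: le_trans (ln_le_sqrt _) _; first by rewrite ltr0n.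
  rewrite -mulrA ler_wpM2l // -sqrtrM // ler_sqrt ?mulr_gt0 ?ltr0n //.
  by rewrite -natrM ler_nat mulSn; nia.
have X0 : 0 <= X by rewrite ln_ge0 // ler1n.
have he : ln e%:R <= X by rewrite ler_ln ?posrE ?ltr0n // ler_nat -addnn; lia.
have h2e : ln (e.*2)%:R <= X by rewrite ler_ln ?posrE ?ltr0n // ler_nat.
have lnX (x : R) j : 0 < x -> ln (x ^+ j) = j%:R * ln x by move=> x0; rewrite lnXn // mulr_natl.
have y0 : 0 < expR 1 * (e.*2).+1%:R :> R by rewrite mulr_gt0 ?expR_gt0 ?ltr0n.
have f0 : 0 < (e%:R : R) by rewrite ltr0n.
have g0 : 0 < ((e.*2)%:R : R) by rewrite ltr0n.
have -> : ln ((expR 1 * (e.*2).+1%:R) ^+ K * (e ^ c * e.*2 ^ c.*2)%:R) =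
    K%:R * (1 + X) + (c%:R * ln e%:R + (c.*2)%:R * ln (e.*2)%:R).
  rewrite natrM !natrX lnM ?posrE; [|exact: exprn_gt0|by apply: mulr_gt0; exact: exprn_gt0].
  rewrite (lnX _ _ y0) lnM ?posrE ?expR_gt0 // expRK; congr (_ + _).
  by rewrite lnM ?posrE; [rewrite !lnX|exact: exprn_gt0|exact: exprn_gt0].
apply: (@le_trans _ _ (K%:R * (1 + X) + (c%:R * X + (c.*2)%:R * X))).
  by rewrite lerD2l; apply: lerD; apply: ler_wpM2l.
apply: (@le_trans _ _ ((K + 3 * c)%:R * (1 + X))); last by rewrite ler_wpM2l ?lerD2l.
rewrite natrD natrM -addnn natrD; move: (K%:R) (c%:R) (ler0n R c) => K' c' c0; lra.
Qed.

End real_bounds.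

Lemma limf_esup_le (R : realType) (F : set_system nat) (f : nat -> \bar R) c :
  F [set x | (f x <= c)%E] -> (limf_esup f F <= c)%E.
Proof.
move=> H; apply: ge_ereal_inf; exists (ereal_sup (f @` [set x | (f x <= c)%E])).
  by exists [set x | (f x <= c)%E].
by apply: ge_ereal_sup => _ [x fx <-].
Qed.

Section eventually.
Variables (R : realType) (M : pfinType) (p : probability nat R) (D : nat).
Hypothesis pD : forall k, (D < k)%N -> p [set k] = 0%E.
Local Notation G := (gspace R M).
Variables (N : set nat) (dist : probability G R -> probability G R -> R)
  (mu : probability G R) (dn : forall n : nat, 'I_n.+1 -> nat).
Hypotheses (mu_inv : invariant_process p mu) (dist_weak : weak_distance dist).
Local Notation m0 := (point : M).
Let d := fine (mean p).
Hypotheses (d0 : 0 < d)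
  (dn_even : forall n, N n -> ~~ odd (\sum_(v < n.+1) dn v))
  (dn_cvg : forall phi : nat -> R, (exists C : R, forall k, `|phi k| <= C) ->
       n.+1%:R^-1 * (\sum_(v < n.+1) phi (dn v)) @[n --> within N \oo]
         --> \int[p]_k phi k)
  (dn_le : forall n, N n -> forall v : 'I_n.+1, (dn v <= D)%N).
Variables (k : nat) (alpha : R).
Hypothesis alpha0 : 0 < alpha.
Let K1 : R := #|{: ptree M D k.+1}|%:R.
Let C0 : R := 1 + 2 * (1 + D%:R * K1) / d.

Lemma Rintegral_offs (phi : nat -> R) :
  \int[p]_j phi j = \sum_(j < D.+1) offs p j * phi j.
Proof. by rewrite /Rintegral (integral_offs pD). Qed.

Lemma near_average (phi : nat -> R) (e : R) : 0 < e -> (exists C : R, forall k, `|phi k| <= C) ->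
  (within N \oo) [set n | `|n.+1%:R^-1 * (\sum_(v < n.+1) phi (dn v)) -
    \sum_(j < D.+1) offs p j * phi j| <= e].
Proof.
move=> e0 bphi; have := dn_cvg bphi; rewrite Rintegral_offs => /cvgrPdist_le/(_ _ e0).
by apply: filterS => n; rewrite /mkset distrC.
Qed.

Lemma near_ge (x : R) : (within N \oo) [set n | x <= n.+1%:R].
Proof.
apply: filterS (nbhs_infty_ger x) => n xn _; apply: le_trans xn _.
by rewrite ler_nat.
Qed.

Lemma eventual_quantile (delta eps : R) : 0 < delta -> delta * (1 + C0) <= 1 ->
  delta <= d / 2 ->
  (forall n (E : {set {set 'I_n.+1}}) (f : {ffun 'I_n.+1 -> M}),
    f \in good_colorings dist E mu k.+1 eps -> forall t,
    `|#|[set v | utype D (gnb E) f k.+1 v None == t]%SET|%:R / n.+1%:R -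
      finlaw mu (fun g : G => lutype D k.+1 g [::] None) t| < delta) ->
  (within N \oo) [set n | (entropy_quantile dist (@dn) n mu k.+1 eps alpha <=
    (annealed p D mu k + (count_error M D k d delta + D.+1%:R * K1 * delta + 3 * delta))%:E)%E].
Proof.
move=> delta0 deltaC deltad close.
(* Without the thickening this test function would be unbounded where [offs p] vanishes. Its
   integral is -H(pi) up to an error that vanishes with [delta]. *)
pose phi j := ln (offs p j + K1 * delta).
have K1d : 0 < K1 * delta.
  by rewrite mulr_gt0 // ltr0n; apply/card_gt0P; exists (pt0 D m0 k.+1).
have offs1 j : offs p j <= 1.
  by rewrite /offs -[leRHS]/(fine 1%E) fine_le // ?probability_le1 // fin_num_prob.
have bphi : exists C : R, forall j, `|phi j| <= C.
  exists (`|ln (K1 * delta)| + `|ln (1 + K1 * delta)|) => j.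
  have h1 : ln (K1 * delta) <= phi j.
    by rewrite ler_ln ?posrE ?lerDr ?offs_ge0 // ltr_wpDl // offs_ge0.
  have h2 : phi j <= ln (1 + K1 * delta).
    by rewrite ler_ln ?posrE ?lerD2r // ?ltr_wpDl // offs_ge0.
  rewrite ler_norml; have := ler_norm (ln (1 + K1 * delta)); have := ler_norm (- ln (K1 * delta)).
  have := normr_ge0 (ln (1 + K1 * delta)); have := normr_ge0 (ln (K1 * delta)); rewrite normrN.
  by move: h1 h2; move: (phi j) (ln _) (ln _) => a b c; lra.
(* The degree itself is not a bounded test function; capped at [D] it is, and it yields the
   convergence of the average degree to [d]. *)
have bmin : exists C : R, forall j, `|(minn j D)%:R : R| <= C.
  by exists D%:R => j; rewrite ger0_norm // ler_nat geq_minr.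
have Fn : (within N \oo) N by rewrite /within /=; exact: nearW.
pose c := (D.+1 * D)%N.
pose A : R := (#|{: ptree M D k * ptree M D k}| + 3 * c)%:R.
pose B : R := A * (1 + 2 * Num.sqrt D.+1%:R) + `|ln alpha|.
(* As the average degree is at least [d / 2], [e] is at least [d / 4] times the number of vertices,
   whence the 12 for [3 * c < e]. The other threshold makes [B] at most [delta] times the square
   root of the number of vertices, which absorbs the polynomial factor and [ln alpha]. *)
apply: filterS (filterI (filterI Fn (near_average delta0 bphi)) (filterI (near_average delta0 bmin)
  (filterI (near_ge (12 * c%:R / d + 1)) (near_ge ((B / delta) ^+ 2))))) => n.
move=> [[Nn h1] [h2 [h3 h4]]]; rewrite /mkset in h1 h2 h3 h4 *.
pose e := (\sum_(v < n.+1) dn v)./2.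
have de : (\sum_(v < n.+1) dn v = e.*2)%N by rewrite even_halfK //; exact: dn_even.
have dD := dn_le Nn.
pose m : R := n.+1%:R; have m_gt0 : 0 < m by rewrite ltr0n.
have em : `|e.*2%:R / m - d| <= delta.
  move: h2; have -> : \sum_(v < n.+1) (minn (dn v) D)%:R = e.*2%:R :> R.
    rewrite -de natr_sum; apply: eq_bigr => v _; congr _%:R; apply/minn_idPl; exact: dD.
  have -> : \sum_(j < D.+1) offs p j * (minn j D)%:R = d.
    rewrite /d (mean_offs pD); apply: eq_bigr => j _; rewrite mulrC; congr (_%:R * _).
    by apply/minn_idPl; rewrite -ltnS.
  by rewrite mulrC.
have ce : (3 * c < e)%N.
  rewrite -(ltr_nat R); move: em; rewrite ler_norml => /andP[em _].
  have : d / 2 <= e.*2%:R / m.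
    move: em deltad; move: (_ / m) => x; move: (d) => d'; lra.
  rewrite ler_pdivlMr // => h5.
  have h6 : 12 * c%:R < m * d.
    rewrite -ltr_pdivrMr //; apply: lt_le_trans h3; lra.
  rewrite -addnn natrD in h5; rewrite natrM.
  by move: h5 h6; rewrite mulrAC [d * m]mulrC; move: (m * d) (c%:R) (e%:R) => a b a'; lra.
apply: le_trans (@quantile_le R M p D pD dist mu dn mu_inv d0 k n e delta eps alpha de dD delta0
  deltaC deltad em ce alpha0 (close n)) _.
rewrite lee_fin /quantile_bound /annealed -/d -/K1 -/m.
have hphi : m^-1 * (\sum_(v < n.+1) ln (offs p (dn v) + K1 * delta)) <=
    - ent (fun j : 'I_D.+1 => offs p j) + D.+1%:R * K1 * delta + delta.
  move: h1; rewrite ler_norml => /andP[_]; rewrite lerBlDl => /le_trans; apply.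
  rewrite lerD2r /ent opprK.
  have -> : \sum_(j < D.+1) offs p j * ln (offs p j) + D.+1%:R * K1 * delta =
     \sum_(j < D.+1) (offs p j * ln (offs p j) + K1 * delta).
    by rewrite big_split /= sumr_const card_ord -[in RHS]mulr_natl mulrA.
  apply: ler_sum => j _; rewrite /phi.
  have [->|oj0] := eqVneq (offs p j) 0; first by rewrite !mul0r add0r ltW.
  have op : 0 < offs p j by rewrite lt_def oj0 offs_ge0.
  rewrite -lerBlDl -mulrBr -ln_div ?posrE // ?addr_gt0 //.
  apply: le_trans (ler_wpM2l (ltW op) (ln_le_sub1 _)) _; first by rewrite divr_gt0 ?addr_gt0.
  by rewrite mulrBr mulrCA divff // !mulr1 addrAC subrr add0r.
have hcf : (ln (count_factor R M D k e) - ln alpha) / m <= delta.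
  have e0 : (0 < e)%N by exact: leq_ltn_trans ce.
  have eD : (e.*2 <= n.+1 * D)%N.
    rewrite -de; apply: leq_trans (leq_sum _ (fun v _ => dD v)) _.
    by rewrite sum_nat_const card_ord.
  have := @ln_count_factor R M D k d d0 e n.+1 e0 eD isT; rewrite -/c -/A -/m.
  move: (ln (count_factor _ _ _ _ _)) => l hl.
  have s1 : 1 <= Num.sqrt m by rewrite -[leLHS]sqrtr1 ler_sqrt // ler1n.
  have A0 : 0 <= A by [].
  have B0 : 0 <= B by rewrite addr_ge0 ?mulr_ge0 ?addr_ge0 ?mulr_ge0 ?sqrtr_ge0.
  have hB : l - ln alpha <= B * Num.sqrt m.
    have a1 : - ln alpha <= `|ln alpha| by rewrite -normrN; exact: ler_norm.
    have a2 : `|ln alpha| <= `|ln alpha| * Num.sqrt m by rewrite ler_peMr.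
    have a3 : A * (1 + 2 * Num.sqrt D.+1%:R * Num.sqrt m) <= A * ((1 + 2 * Num.sqrt D.+1%:R) * Num.sqrt m).
      by rewrite ler_wpM2l // [leRHS]mulrDl mul1r lerD2r.
    by rewrite /B mulrDl -mulrA; lra.
  have hm : B <= delta * Num.sqrt m.
    rewrite mulrC -ler_pdivrMr // -[leLHS]ger0_norm ?divr_ge0 // ?(ltW delta0) //.
    by rewrite -sqrtr_sqr ler_sqrt.
  rewrite ler_pdivrMr //; apply: le_trans hB _.
  rewrite -{2}(sqr_sqrtr (ltW m_gt0)) expr2 mulrA ler_wpM2r //.
move: hphi hcf; move: (_ * \sum_(v < _) _) (_ / m) => a b ha hb.
have -> : 3 * delta = delta + delta + delta by lra.
move: (D.+1%:R * K1 * delta) (count_error _ _ _ _ _) (ent _) (ent _) ha => x y z1 z2.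
move: (d / 2 * _) => z3 ha; lra.
Qed.

End eventually.

(** * Monotonicity of the sofic entropy in the tolerance and in the radius *)

Section monotonicity.
Variables (R : realType) (M : pfinType).
Local Notation G := (gspace R M).
Variables (N : set nat) (dist : probability G R -> probability G R -> R)
  (mu : probability G R) (dn : forall n : nat, 'I_n.+1 -> nat) (alpha : R).

Lemma quantile_mono n r r' (eps eps' : R) :
  (forall E : {set {set 'I_n.+1}}, good_colorings dist E mu r eps \subset
     good_colorings dist E mu r' eps') ->
  (entropy_quantile dist dn n mu r eps alpha <= entropy_quantile dist dn n mu r' eps' alpha)%E.
Proof.
move=> sub; apply: ge_ereal_sup => h [h0 hP]; apply: ereal_sup_ubound; split => //.
apply: le_trans hP _; rewrite /prob_entropy_ge ler_wpM2r ?invr_ge0 // ler_nat.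
apply: subset_leq_card; apply/fintype.subsetP => E; rewrite !finset.in_set => /andP[-> /= hE].
apply: le_trans hE _; rewrite /coloring_entropy; have sc := subset_leq_card (sub E).
case: eqP => [_|/eqP c0]; first exact: leNye.
have c0' : (0 < #|good_colorings dist E mu r eps|)%N by rewrite lt0n.
rewrite ifF; last by rewrite gtn_eqF // (leq_trans c0').
by rewrite lee_fin ler_wpM2r ?invr_ge0 // ler_ln ?posrE ?ltr0n ?(leq_trans c0') // ler_nat.
Qed.

Lemma limf_esup_mono (F : set_system nat) (f g : nat -> \bar R) :
  (forall n, (f n <= g n)%E) -> (limf_esup f F <= limf_esup g F)%E.
Proof.
move=> fg; apply: le_ereal_inf_tmp => _ [V FV <-]; apply: ge_ereal_inf.
exists (ereal_sup (f @` V)); first by exists V.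
by apply: ge_ereal_sup => _ [n Vn <-]; apply: (le_trans (fg n)); apply: ereal_sup_ubound; exists n.
Qed.

Definition esup_quantile r eps : \bar R :=
  limf_esup (fun n => entropy_quantile dist dn n mu r eps alpha) (within N \oo).

(** Quantiles increase with the tolerance, so the limit at 0 is an infimum, and a single tolerance
    suffices for an upper bound. *)
Lemma upper_entropy_ballE r : upper_entropy_ball dist N dn mu r alpha =
  ereal_inf (esup_quantile r @` [set` `]0, +oo[%R]).
Proof.
apply: cvg_lim; first exact: ereal_hausdorff.
apply: nondecreasing_at_right_cvge; first by [].
move=> e e' _ _ ee'.
apply: limf_esup_mono => n; apply: quantile_mono => E; apply/fintype.subsetP => f.
by rewrite !finset.in_set => /le_trans; apply.
Qed.

Lemma continuous_measurable (phi : G -> R) : continuous phi -> measurable_fun setT phi.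
Proof.
move=> /continuousP cphi; apply: (measurability _ (RGenOpens.measurableE R)).
move=> _ [_ [a [b ->] <-]]; rewrite setTI; apply: sub_sigma_algebra.
by apply: cphi; exact: interval_open.
Qed.

Lemma restr_law_restr (nu : probability G R) r A :
  restr_law (restr_law nu r.+1) r A = restr_law nu r A.
Proof.
rewrite /restr_law /distribution /pushforward /=; congr (nu _).
apply/seteqP; split => g; rewrite /preimage /mkset /grestr restr_min;
  by rewrite (minn_idPr (leqnSn r)).
Qed.

Lemma Rintegral_restr (nu : probability G R) r (phi : G -> R) : continuous phi ->
  \int[restr_law nu r]_g phi g = \int[nu]_g phi (restr r g).
Proof.
move=> /continuous_measurable mphi; rewrite /Rintegral; congr fine.
have mE : measurable_fun setT (fun g : G => (phi g)%:E) by exact/measurable_EFinP.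
rewrite integralE [RHS]integralE.
rewrite (ge0_integral_pushforward (measurable_grestr r)) //; last exact: measurable_funepos.
rewrite (ge0_integral_pushforward (measurable_grestr r)) //; last exact: measurable_funeneg.
by rewrite preimage_setT; congr (_ - _)%E; apply: eq_integral => g _; rewrite /= ?funeposE ?funenegE.
Qed.

Hypothesis dist_weak : weak_distance dist.

Lemma restr_weak_open r (V : set (probability G R)) : weak_open V ->
  weak_open [set nu | V (restr_law nu r)].
Proof.
move=> oV nu /oV[j [phi [e [bc e0 He]]]].
exists j, (fun i g => phi i (restr r g)), e; split => //.
  move=> i; have [cphi [C hC]] := bc i; split; last by exists C.
  by move=> g; apply: (@continuous_comp _ _ _ (@grestr R M r)) => //; [exact: grestr_continuous|exact: cphi].
move=> nu' H; apply: He => i; have [cphi _] := bc i.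
by rewrite !Rintegral_restr.
Qed.

(** Restriction to a smaller ball is weakly continuous, and nothing more is available for an
    arbitrary [dist]. So [eps'] comes from continuity at [restr_law mu r.+1], uniformly in [n] and
    [E]. *)
Lemma good_colorings_restr r (eps : R) : 0 < eps -> exists2 eps', 0 < eps' &
  forall n (E : {set {set 'I_n.+1}}),
    good_colorings dist E mu r.+1 eps' \subset good_colorings dist E mu r eps.
Proof.
move=> eps0; have [dist0 dsym dtri dopen] := dist_weak.
pose V := [set nu : probability G R | dist nu (restr_law mu r) < eps].
have oV : weak_open V.
  apply/dopen => nu nuV; exists (eps - dist nu (restr_law mu r)); first by rewrite subr_gt0.
  move=> nu' h; rewrite /V /mkset; apply: le_lt_trans (dtri _ nu _) _.
  by move: h; rewrite dsym; lra.
have dr nu : dist (restr_law (restr_law nu r.+1) r) (restr_law nu r) = 0.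
  by apply/dist0 => A _; exact: restr_law_restr.
have [e e0 He] := (dopen _).1 (@restr_weak_open r _ oV) (restr_law mu r.+1) (eq_ind_r (fun x => x < eps) eps0 (dr mu)).
exists (e / 2); first by rewrite divr_gt0.
move=> n E; apply/fintype.subsetP => f; rewrite !finset.in_set => fE.
have h : dist (restr_law mu r.+1) (restr_law (distr R E f) r.+1) < e.
  by rewrite dsym; apply: le_lt_trans fE _; lra.
have := He _ h; rewrite /V /mkset => h2; apply: ltW; apply: le_lt_trans h2.
apply: le_trans (dtri _ (restr_law (restr_law (distr R E f) r.+1) r) _) _.
by rewrite (dsym (restr_law (distr R E f) r)) dr add0r.
Qed.

(** Provides the convergence in the radius that gives [upper_entropy] its meaning. *)
Lemma upper_entropy_ball_le r :
  (upper_entropy_ball dist N dn mu r.+1 alpha <= upper_entropy_ball dist N dn mu r alpha)%E.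
Proof.
rewrite !upper_entropy_ballE; apply: le_ereal_inf_tmp => x [eps + <-].
rewrite /= in_itv /= andbT => eps0.
have [eps' eps'0 sub] := good_colorings_restr r eps0.
apply: ge_ereal_inf; exists (esup_quantile r.+1 eps').
  by exists eps' => //=; rewrite in_itv /= andbT.
by apply: limf_esup_mono => n; apply: quantile_mono => E; exact: sub.
Qed.

End monotonicity.

(** Monotone sequences of extended reals converge. Everything is shifted by one because the
    comparison holds for radii from 1 on. *)
Lemma le_lim_shift (R : realType) (u v : nat -> \bar R) :
  (forall k, (u k.+2 <= u k.+1)%E) -> (forall k, (v k.+2 <= v k.+1)%E) ->
  (forall k, (u k.+1 <= v k.+1)%E) -> (limn u <= limn v)%E.
Proof.
have cS (w : nat -> \bar R) : (forall k, (w k.+2 <= w k.+1)%E) ->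
    cvgn (fun k => w k.+1) /\ limn w = limn (fun k => w k.+1).
  move=> dw; have cw : cvgn (fun k => w k.+1).
    by apply: ereal_nonincreasing_is_cvgn; apply/nonincreasing_seqP.
  by split => //; apply: cvg_lim => //; rewrite -cvg_shiftS.
move=> /cS[cu ->] /cS[cv ->] uv.
by apply: lee_lim => //; exact: nearW.
Qed.

Section ball.
Variables (R : realType) (M : pfinType) (p : probability nat R) (D : nat).
Hypothesis pD : forall k, (D < k)%N -> p [set k] = 0%E.
Local Notation G := (gspace R M).
Variables (N : set nat) (dist : probability G R -> probability G R -> R)
  (mu : probability G R) (dn : forall n : nat, 'I_n.+1 -> nat).
Hypotheses (mu_inv : invariant_process p mu) (dist_weak : weak_distance dist).
Hypotheses (d0 : 0 < fine (mean p))
  (dn_even : forall n, N n -> ~~ odd (\sum_(v < n.+1) dn v))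
  (dn_cvg : forall phi : nat -> R, (exists C : R, forall k, `|phi k| <= C) ->
       n.+1%:R^-1 * (\sum_(v < n.+1) phi (dn v)) @[n --> within N \oo]
         --> \int[p]_k phi k)
  (dn_le : forall n, N n -> forall v : 'I_n.+1, (dn v <= D)%N).
Variables (alpha : R).
Hypothesis alpha0 : 0 < alpha.

Lemma upper_entropy_ball_Sigma k :
  (upper_entropy_ball dist N (@dn) mu k.+1 alpha <= Sigma_ball p mu k.+1)%E.
Proof.
rewrite (Sigma_ballE pD mu_inv d0) upper_entropy_ballE; apply/lee_addgt0Pr => eta eta0.
have [delta [delta0 deltaC deltad small]] := @count_error_small R M D k _ d0 eta eta0.
have [eps eps0 close] := @good_coloring_types R M D dist dist_weak mu k.+1 delta delta0.
apply: ge_ereal_inf; exists (esup_quantile N dist mu (@dn) alpha k.+1 eps).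
  by exists eps => //=; rewrite in_itv /= andbT.
apply: limf_esup_le.
have := eventual_quantile pD mu_inv d0 dn_even dn_cvg dn_le alpha0 delta0 deltaC deltad (close eps (lexx _)).
apply: filterS => n /le_trans; apply.
by rewrite -EFinD lee_fin lerD2l.
Qed.

Lemma upper_entropy_Sigma :
  (upper_entropy dist N (@dn) mu alpha <= Sigma p mu)%E.
Proof.
apply: le_lim_shift => k; first exact: upper_entropy_ball_le.
  by rewrite !(Sigma_ballE pD mu_inv d0) lee_fin; exact: (annealed_le pD mu_inv d0).
exact: upper_entropy_ball_Sigma.
Qed.

End ball.

(** The indicator of the integers above [D] vanishes on all degrees, so its average is 0 along [N],
    which has arbitrarily large elements; weak convergence passes this on to [p]. *)
Lemma offspring_bound (R : realType) (p : probability nat R) (N : set nat)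
    (dn : forall n : nat, 'I_n.+1 -> nat) (D : nat) : infinite_set N ->
  (forall phi : nat -> R, (exists C : R, forall k, `|phi k| <= C) ->
     n.+1%:R^-1 * (\sum_(v < n.+1) phi (dn n v)) @[n --> within N \oo]
       --> \int[p]_k phi k) ->
  (forall n, N n -> forall v, (dn n v <= D)%N) ->
  forall k, (D < k)%N -> p [set k] = 0%E.
Proof.
move=> Ninf dn_cvg dD k Dk.
pose phi j : R := \1_[set j | (D < j)%N] j.
have bphi : exists C : R, forall j, `|phi j| <= C.
  by exists 1 => j; rewrite /phi indicE ger0_norm // lern1; case: (_ \in _).
have IE : \int[p]_j phi j = fine (p [set j | (D < j)%N]).
  by rewrite /Rintegral integral_indic // setIT.
have I0 : \int[p]_j phi j = 0.
  apply/eqP; rewrite -normr_le0; apply/ler_addgt0Pr => e e0; rewrite add0r.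
  have /cvgrPdist_le/(_ _ e0)[n0 _ H] := dn_cvg _ bphi.
  have [n n0n Nn] : exists2 n, (n0 <= n)%N & N n.
    apply: contrapT => nex; apply: Ninf; apply: (@sub_finite_set _ _ `I_n0); last exact: finite_II.
    by move=> n Nn /=; rewrite ltnNge; apply/negP => n0n; apply: nex; exists n.
  have := H n n0n Nn; rewrite big1 ?mulr0 ?subr0 // => v _.
  by rewrite /phi indicE memNset //=; apply/negP; rewrite -leqNgt; exact: dD.
have p0 : p [set j | (D < j)%N] = 0%E.
  by rewrite -[LHS]fineK ?fin_num_prob // -IE I0.
apply/eqP; rewrite eq_le measure_ge0 andbT -p0 le_measure ?inE //.
by move=> j ->.
Qed.

(* The graphs have n.+1 vertices, with n ranging over the infinite set N. *)
Theorem theorem4p3 (R : realType) (M : pfinType) (p : probability nat R)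
    (N : set nat) (dn : forall n : nat, 'I_n.+1 -> nat) (Delta : R)
    (dist : probability (gspace R M) R -> probability (gspace R M) R -> R)
    (p_mean : (0 < mean p < +oo)%E)
    (N_infinite : infinite_set N)
    (dn_even : forall n, N n -> ~~ odd (\sum_(v < n.+1) dn n v))
    (dn_cvg : forall phi : nat -> R, (exists C : R, forall k, `|phi k| <= C) ->
       n.+1%:R^-1 * (\sum_(v < n.+1) phi (dn n v)) @[n --> within N \oo]
         --> \int[p]_k phi k)
    (dn_bounded : forall n, N n -> forall v, (dn n v)%:R <= Delta)
    (dist_weak : weak_distance dist)
    (mu : probability (gspace R M) R) (mu_inv : invariant_process p mu)
    (alpha : R) (alpha01 : 0 < alpha < 1) :
  (forall r : nat, (1 <= r)%N ->
     (upper_entropy_ball dist N dn mu r alpha <= Sigma_ball p mu r)%E) /\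
  (upper_entropy dist N dn mu alpha <= Sigma p mu)%E.
Proof.
have /andP[alpha0 _] := alpha01; have /andP[mean0 meany] := p_mean.
have d0 : 0 < fine (mean p) by rewrite fine_gt0 // mean0.
have dD n : N n -> forall v : 'I_n.+1, (dn n v <= Num.truncn Delta)%N.
  by move=> Nn v; have := le_truncn (dn_bounded n Nn v); rewrite natrK.
have pD := offspring_bound N_infinite dn_cvg dD.
split; last exact: (upper_entropy_Sigma pD mu_inv dist_weak d0 dn_even dn_cvg dD alpha0).
case=> // k _; exact: (upper_entropy_ball_Sigma pD mu_inv dist_weak d0 dn_even dn_cvg dD alpha0).
Qed.
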